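(* Let $(M^{2m+1},g,\eta,J)$ be a metric contact manifold and $\nabla$ an adapted connection. Then its torsion tensor $T$ has the following properties: (1) The $(0,2)$-part is given by $T^{0,2}=N^{0,2}$; in particular it is independent of $\nabla$. (2) The parts of type $(2,0)$ and $(1,1)$ satisfy $$T^{2,0}-\phi^{-1}(T^{1,1}_a)=0,$$ or, equivalently, $\mathfrak{b}(T^{2,0}-T^{1,1}_a)=0$. (3) The part in $\Omega^2(\mathcal{C},\Xi)$ is independent of $\nabla$ and given by $T^2=T^2_+=d\eta$ (i.e. it equals $\xi\otimes d\eta$). (4) The symmetric part $T^1_+$ of the endomorphism $T^1$ is independent of $\nabla$ and given by $T^1_+=-\tfrac12 J\mathcal{J}$, while the skew-symmetric part $T^1_-$ lies in $\operatorname{End}^J_-(\mathcal{C})$. (5) The part $T^1_{\mathbb{R}}$ vanishes. Conversely, for any $\omega\in\Omega^+(\mathcal{C})$, $B\in\Omega^{1,1}_s(\mathcal{C},\mathcal{C})$ and $\Phi\in\operatorname{End}^J_-(\mathcal{C})$, there exists an adapted connection whose torsion tensor satisfies $$(\mathfrak{b}T)^+=\omega,\qquad T^{1,1}_s=B\qquad\text{and}\qquad T^1_-=\Phi.$$ The total torsion tensor then has the following form: $$T=N^{0,2}+\tfrac98\omega-\tfrac38\mathcal{M}\omega+B+\xi\otimes d\eta-\tfrac12\,\eta\wedge(J\mathcal{J})+\eta\wedge\Phi.$$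
   Context: Metric contact manifolds. A metric contact manifold is a tuple $(M^{2m+1},g,\eta,J)$ with $g$ a Riemannian metric, $\eta\in\Omega^1(M)$, $J\in\operatorname{End}(TM)$ such that $\|\eta_x\|=1$ for all $x\in M$, $d\eta(X,Y)=g(JX,Y)$ for all vector fields $X,Y$, and $J^2=-\mathrm{Id}+\eta\otimes\xi$, where $\xi=\eta^\natural$ is the metric dual of $\eta$. Convention: $d\eta(X,Y)=X(\eta(Y))-Y(\eta(X))-\eta([X,Y])$. Then $\eta(\xi)=1$, $\xi\lrcorner d\eta=0$, $J\xi=0$. Put $\mathcal{C}=\ker\eta$ and $\Xi=\mathbb{R}\xi$, so $TM=\mathcal{C}\oplus\Xi$; $J|_{\mathcal{C}}$ is an almost complex structure on $\mathcal{C}$. Put $\mathcal{J}=L_\xi J$ (Lie derivative). The Nijenhuis tensor is $N(X,Y)=\tfrac14\big([JX,JY]+J^2[X,Y]-J([JX,Y]+[X,JY])\big)$. Adapted connections. A connection $\nabla$ on $TM$ is adapted if $\nabla g=0$, $\nabla J=0$, $\nabla\eta=0$, $\nabla\xi=0$. Its torsion is $T(X,Y)=\nabla_XY-\nabla_YX-[X,Y]\in\Omega^2(M,TM)$. Forms. $\Omega^2(M,TM)$ is the space of $TM$-valued two-forms; for $B$ in it write $B(X;Y,Z)=g(X,B(Y,Z))$. A three-form $\omega$ is regarded as a $TM$-valued two-form via $\omega(X,Y,Z)=g(X,\omega(Y,Z))$. Forms on $\mathcal{C}$ are regarded as forms on $M$ by extending by zero on $\xi$. The Bianchi operator $\mathfrak{b}:\Omega^2(M,TM)\to\Omega^3(M)$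 is $\mathfrak{b}B(X,Y,Z)=\tfrac13(B(X;Y,Z)+B(Y;Z,X)+B(Z;X,Y))$, and $\mathcal{M}B=B(J\cdot,J\cdot)$. Let $\Omega^2(\mathcal{C},\mathcal{C})=\Gamma(\mathcal{C}\otimes\Lambda^2\mathcal{C}^* )$, $\Omega^2(\mathcal{C},\Xi)=\Gamma(\Xi\otimes\Lambda^2\mathcal{C}^* )$, $\Omega^3(\mathcal{C})=\Gamma(\Lambda^3\mathcal{C}^* )$. Define $\Omega^{1,1}(\mathcal{C},\mathcal{C})=\{B\in\Omega^2(\mathcal{C},\mathcal{C}):\mathcal{M}B=B\}$, $\Omega^{2,0}(\mathcal{C},\mathcal{C})=\{B: B(JX,Y)=JB(X,Y)\ \forall X,Y\in\Gamma(\mathcal{C})\}$, $\Omega^{0,2}(\mathcal{C},\mathcal{C})=\{B: B(JX,Y)=-JB(X,Y)\ \forall X,Y\in\Gamma(\mathcal{C})\}$; $\Omega^2(\mathcal{C},\mathcal{C})$ is the direct sum of these three. $\Omega^{1,1}_s(\mathcal{C},\mathcal{C})$ is the subspace of $\Omega^{1,1}(\mathcal{C},\mathcal{C})$ of elements vanishing under $\mathfrak{b}$, and $\Omega^{1,1}_a(\mathcal{C},\mathcal{C})$ its orthogonal complement in $\Omega^{1,1}(\mathcal{C},\mathcal{C})$ with respect to $g$ (extended to forms). Let $\mathcal{C}\otimes\mathbb{C}=\mathcal{C}^{1,0}\oplus\mathcal{C}^{0,1}$ be the splitting into $\pm i$-eigenspaces of $J$, with induced $(p,q)$-types of complex forms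 on $\mathcal{C}$. For $\omega\in\Omega^3(\mathcal{C})$ put $\omega^+=\omega^{2,1}+\omega^{1,2}$, $\omega^-=\omega^{3,0}+\omega^{0,3}$; $\Omega^+(\mathcal{C})=\{\omega\in\Omega^3(\mathcal{C}):\omega=\omega^+\}$. For a three-form on $M$ the superscript $+$ denotes the corresponding part of its $\Omega^3(\mathcal{C})$-component. The isomorphism $\phi:\Omega^{2,0}(\mathcal{C},\mathcal{C})\to\Omega^{1,1}_a(\mathcal{C},\mathcal{C})$ is $\phi(B)=\tfrac34(\mathfrak{b}B+\mathcal{M}\mathfrak{b}B)$, with inverse $\phi^{-1}(A)=\tfrac32(\mathfrak{b}A-\mathcal{M}\mathfrak{b}A)$. For an endomorphism $\Phi$ of $\mathcal{C}$ (extended by $\Phi\xi=0$), $\eta\wedge\Phi\in\Omega^2(M,TM)$ is defined by $(\eta\wedge\Phi)(X;Y,Z)=\eta(Y)g(X,\Phi Z)-\eta(Z)g(X,\Phi Y)$. $\operatorname{End}_-^J(\mathcal{C})$ is the space of $g$-skew-symmetric endomorphisms of $\mathcal{C}$ commuting with $J$. Every $B\in\Omega^2(M,TM)$ decomposes uniquely as $$B=B^{2,0}+B^{1,1}+B^{0,2}+\xi\otimes B^2_++\xi\otimes B^2_-+\eta\wedge B^1_++\eta\wedge B^1_-+\xi\otimes\eta\wedge B^1_{\mathbb{R}},$$ with $B^{p,q}\in\Omega^{p,q}(\mathcal{C},\mathcal{C})$, $B^2_\pm\in\Omega^2(\mathcal{C})$ satisfying $B^2_\pm(J\cdot,J\cdot)=\pm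 B^2_\pm$, $B^1_+$ a symmetric and $B^1_-$ a skew-symmetric endomorphism of $\mathcal{C}$, and $B^1_{\mathbb{R}}\in\Gamma(\mathcal{C}^* )$. One writes $B^{1,1}=B^{1,1}_s+B^{1,1}_a$ for the parts in $\Omega^{1,1}_s,\Omega^{1,1}_a$, $B^2=B^2_++B^2_-$ and $B^1=B^1_++B^1_-+B^1_{\mathbb{R}}$. The same sub-/superscripts applied to $T$ or $N$ denote the respective parts. *)

(* Defs.v *)
From HB Require Import structures.
From mathcomp Require Import all_boot all_order all_algebra.
From mathcomp Require Import all_classical all_reals all_analysis.
From mathcomp Require Import ring.

Set Implicit Arguments.
Unset Strict Implicit.
Unset Printing Implicit Defensive.
Import Order.TTheory GRing.Theory Num.Theory.
Import numFieldNormedType.Exports.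
Local Open Scope classical_set_scope.
Local Open Scope ring_scope.

Section CkFunctions.
Variables (R : realType) (V : normedModType R).

(* [U] is meant to be open. *)
Fixpoint Ck_on (W : normedModType R) (k : nat) (U : set V) (f : V -> W) : Prop :=
  if k is k'.+1 then
    (forall x, U x -> differentiable f x) /\ (forall v, Ck_on k' U ('D_v f))
  else forall x, U x -> {for x, continuous f}.

Definition smooth_on (W : normedModType R) (U : set V) (f : V -> W) :=
  forall k, Ck_on k U f.

Lemma near_eq_differentiable (W : normedModType R) (f g : V -> W) x :
  {near x, f =1 g} -> differentiable f x -> differentiable g x.
Proof.
move=> fg df; have dfC := diff_continuous df.
have fgx : f x = g x by exact: nbhs_singleton fg.
have gE : g \o shift x = cst (g x) + 'd f x +o_ 0 id.
  apply/eqaddoP => e e0.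
  have /eqaddoP/(_ e e0) := diff_locally df.
  have : \forall h \near 0, f (h + x) = g (h + x).
    by move: fg; rewrite {1}(near_shift 0) subr0.
  move=> fgh; apply: filterS2 fgh => h fgh /=.
  by rewrite !fctE /= fgh fgx.
apply/diff_locallyP; rewrite (diff_unique dfC gE); split=> //.
Qed.

Lemma Ck_on_congr (W : normedModType R) k (U : set V) (f g : V -> W) : open U ->
  (forall x, U x -> f x = g x) -> Ck_on k U f -> Ck_on k U g.
Proof.
move=> oU; have nfg f' g' x : (forall x, U x -> f' x = g' x) -> U x ->
    {near x, f' =1 g' :> (V -> W)}.
  move=> fg Ux; have : nbhs x U by exact: open_nbhs_nbhs.
  exact: filterS.
elim: k f g => [|k IH] f g fg /=.
  move=> fC x Ux; rewrite /prop_for /continuous_at -(fg _ Ux).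
  exact: cvg_trans (near_eq_cvg (nfg _ _ _ fg Ux)) (fC x Ux).
move=> [df Df]; split=> [x Ux|v].
  exact: near_eq_differentiable (nfg _ _ _ fg Ux) (df x Ux).
apply: IH (Df v) => x Ux.
exact: near_eq_derive (nfg _ _ _ fg Ux).
Qed.

Lemma Ck_on_cst (W : normedModType R) k (U : set V) (c : W) :
  Ck_on k U (cst c).
Proof.
elim: k c => [|k IH] c /=; first by move=> x _; exact: cst_continuous.
split=> [x _|v]; first exact: differentiable_cst.
rewrite (_ : 'D_v (cst c) = cst 0) //.
by apply/funext => x; rewrite derive_cst.
Qed.

Lemma Ck_onS (W : normedModType R) k (U : set V) (f : V -> W) :
  Ck_on k.+1 U f -> Ck_on k U f.
Proof.
elim: k f => [|k IH] f [df Df] /=; last by split=> // v; exact/IH/Df.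
by move=> x Ux; apply: differentiable_continuous; exact: df.
Qed.

Lemma Ck_onD (W : normedModType R) k (U : set V) (f g : V -> W) : open U ->
  Ck_on k U f -> Ck_on k U g -> Ck_on k U (f + g).
Proof.
move=> oU; elim: k f g => [|k IH] f g /=.
  by move=> fC gC x Ux; apply: continuousD; [exact: fC|exact: gC].
move=> [df Df] [dg Dg]; split=> [x Ux|v].
  by apply: differentiableD; [exact: df|exact: dg].
apply: Ck_on_congr (IH _ _ (Df v) (Dg v)) => // x Ux.
by rewrite deriveD //; apply: diff_derivable; [exact: df|exact: dg].
Qed.

Lemma Ck_onM k (U : set V) (f g : V -> R) : open U ->
  Ck_on k U f -> Ck_on k U g -> Ck_on k U (f * g).
Proof.
move=> oU; elim: k f g => [|k IH] f g.
  by move=> fC gC x Ux; apply: continuousM; [exact: fC|exact: gC].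
move=> fk gk; have [df Df] := fk; have [dg Dg] := gk; split=> [x Ux|v].
  by apply: differentiableM; [exact: df|exact: dg].
have := Ck_onD oU (IH _ _ (Ck_onS fk) (Dg v)) (IH _ _ (Ck_onS gk) (Df v)).
apply: Ck_on_congr => // x Ux.
by rewrite deriveM //; apply: diff_derivable; [exact: df|exact: dg].
Qed.

End CkFunctions.

Record chart (R : realType) (n : nat) (M : topologicalType) := Chart {
  chart_dom : set M;
  chart_cod : set 'rV[R]_n;
  chart_map : M -> 'rV[R]_n;
  chart_inv : 'rV[R]_n -> M;
  chart_dom_open : open chart_dom;
  chart_cod_open : open chart_cod;
  chart_map_sub : forall x, chart_dom x -> chart_cod (chart_map x);
  chart_inv_sub : forall y, chart_cod y -> chart_dom (chart_inv y);
  chart_mapK : forall x, chart_dom x -> chart_inv (chart_map x) = x;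
  chart_invK : forall y, chart_cod y -> chart_map (chart_inv y) = y;
  chart_map_continuous :
    forall x, chart_dom x -> {for x, continuous chart_map};
  chart_inv_continuous :
    forall y, chart_cod y -> {for y, continuous chart_inv} }.

Arguments chart_dom_open {R n M} c.
Arguments chart_cod_open {R n M} c.

(* The atlas need not be maximal. *)
Record manifold (R : realType) (n : nat) := Manifold {
  points :> topologicalType;
  manifold_hausdorff : hausdorff_space points;
  manifold_second_countable : @second_countable points;
  chart_index : Type;
  atlas : chart_index -> chart R n points;
  atlas_cover : forall x, exists i, chart_dom (atlas i) x;
  atlas_smooth : forall i j,
    smooth_on
      (chart_cod (atlas i) `&` (chart_inv (atlas i) @^-1` chart_dom (atlas j)))
      (chart_map (atlas j) \o chart_inv (atlas i)) }.

Section SmoothFunctions.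
Variables (R : realType) (n : nat) (M : manifold R n).

Definition smooth_function (f : M -> R) : Prop :=
  forall i : chart_index M,
    smooth_on (chart_cod (atlas i)) (f \o chart_inv (atlas i)).

Definition smooth_pred : pred (M -> R) := fun f => `[< smooth_function f >].

(* The ring of smooth real functions on [M]. *)
Record Cinf := MkCinf {
  Cinf_fun :> M -> R;
  Cinf_smooth : Cinf_fun \in smooth_pred }.

HB.instance Definition _ := [isSub for Cinf_fun].
HB.instance Definition _ := [Choice of Cinf by <:].

Lemma smooth_subring_closed : subring_closed smooth_pred.
Proof.
have sC c : smooth_function (cst c) by move=> i k; exact: Ck_on_cst.
have sD f g : smooth_function f -> smooth_function g -> smooth_function (f + g).
  move=> fs gs i k.
  exact: (Ck_onD (chart_cod_open (atlas i)) (fs i k) (gs i k)).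
have sM f g : smooth_function f -> smooth_function g -> smooth_function (f * g).
  move=> fs gs i k.
  exact: (Ck_onM (chart_cod_open (atlas i)) (fs i k) (gs i k)).
split=> [|f g /asboolP fs /asboolP gs|f g /asboolP fs /asboolP gs];
  apply/asboolP; [exact: sC| |exact: sM].
suff -> : f - g = f + cst (-1) * g by apply: sD => //; exact: sM.
by apply/funext => x; rewrite !fctE mulN1r.
Qed.

HB.instance Definition _ :=
  GRing.SubChoice_isSubComPzRing.Build _ _ Cinf smooth_subring_closed.

Lemma smooth_cst (c : R) : (cst c : M -> R) \in smooth_pred.
Proof. by apply/asboolP => i k; exact: Ck_on_cst. Qed.

Definition cstf (c : R) : Cinf := MkCinf (smooth_cst c).

End SmoothFunctions.

Section VectorFields.
Variables (R : realType) (n : nat) (M : manifold R n).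
Implicit Types f h : Cinf M.

(* The smooth vector fields on [M] are the R-linear derivations of the ring of
   smooth functions. *)
Definition derivation (D : Cinf M -> Cinf M) : Prop :=
  [/\ forall f h, D (f + h) = D f + D h,
      forall c f, D (cstf M c * f) = cstf M c * D f
    & forall f h, D (f * h) = D f * h + f * D h].

Record vfield := VField {
  vfield_fun :> Cinf M -> Cinf M;
  vfield_derivation : derivation vfield_fun }.

Lemma vfieldP (X Y : vfield) : X =1 Y -> X = Y.
Proof.
case: X Y => [X dX] [Y dY] /= /funext XY; move: dX; rewrite XY => dX.
by congr VField; exact: Prop_irrelevance.
Qed.

HB.instance Definition _ := gen_eqMixin vfield.
HB.instance Definition _ := gen_choiceMixin vfield.

Lemma vfield0_derivation : derivation (fun=> 0).
Proof. by split=> *; rewrite ?mulr0 ?mul0r ?addr0. Qed.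

Lemma vfieldN_derivation (X : vfield) : derivation (fun f => - X f).
Proof.
case: (vfield_derivation X) => XD XZ XM; split=> *.
- by rewrite XD opprD.
- by rewrite XZ mulrN.
- by rewrite XM opprD mulNr mulrN.
Qed.

Lemma vfieldD_derivation (X Y : vfield) : derivation (fun f => X f + Y f).
Proof.
case: (vfield_derivation X) => XD XZ XM.
case: (vfield_derivation Y) => YD YZ YM; split=> *.
- by rewrite XD YD addrACA.
- by rewrite XZ YZ mulrDr.
- by rewrite XM YM addrACA mulrDl mulrDr.
Qed.

Lemma vfieldZ_derivation a (X : vfield) : derivation (fun f => a * X f).
Proof.
case: (vfield_derivation X) => XD XZ XM; split=> *.
- by rewrite XD mulrDr.
- by rewrite XZ mulrCA.
- by rewrite XM mulrDr mulrA (mulrCA a).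
Qed.

Definition vfield0 := VField vfield0_derivation.
Definition vfieldN X := VField (vfieldN_derivation X).
Definition vfieldD X Y := VField (vfieldD_derivation X Y).
Definition vfieldZ a X := VField (vfieldZ_derivation a X).

Lemma vfieldDA : associative vfieldD.
Proof. by move=> X Y Z; apply: vfieldP => f /=; rewrite addrA. Qed.
Lemma vfieldDC : commutative vfieldD.
Proof. by move=> X Y; apply: vfieldP => f /=; rewrite addrC. Qed.
Lemma vfield0D : left_id vfield0 vfieldD.
Proof. by move=> X; apply: vfieldP => f /=; rewrite add0r. Qed.
Lemma vfieldND : left_inverse vfield0 vfieldN vfieldD.
Proof. by move=> X; apply: vfieldP => f /=; rewrite addNr. Qed.

HB.instance Definition _ :=
  GRing.isZmodule.Build vfield vfieldDA vfieldDC vfield0D vfieldND.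

Lemma vfieldZA a b X : vfieldZ a (vfieldZ b X) = vfieldZ (a * b) X.
Proof. by apply: vfieldP => f /=; rewrite mulrA. Qed.
Lemma vfield1Z : left_id 1 vfieldZ.
Proof. by move=> X; apply: vfieldP => f /=; rewrite mul1r. Qed.
Lemma vfieldZDr : right_distributive vfieldZ +%R.
Proof. by move=> a X Y; apply: vfieldP => f /=; rewrite mulrDr. Qed.
Lemma vfieldZDl X : {morph vfieldZ^~ X : a b / a + b}.
Proof. by move=> a b; apply: vfieldP => f /=; rewrite mulrDl. Qed.

HB.instance Definition _ := GRing.Zmodule_isLmodule.Build (Cinf M) vfield
  vfieldZA vfield1Z vfieldZDr vfieldZDl.

Lemma bracket_derivation (X Y : vfield) :
  derivation (fun f => X (Y f) - Y (X f)).
Proof.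
case: (vfield_derivation X) => XD XZ XM.
case: (vfield_derivation Y) => YD YZ YM; split=> [f h|c f|f h].
- by rewrite YD !XD YD; ring.
- by rewrite YZ !XZ YZ; ring.
- by rewrite YM XM XD YD !XM !YM; ring.
Qed.

Definition bracket (X Y : vfield) : vfield := VField (bracket_derivation X Y).

Definition extd (a : vfield -> Cinf M) (X Y : vfield) : Cinf M :=
  X (a Y) - Y (a X) - a (bracket X Y).

End VectorFields.

Notation "[| X , Y |]" := (bracket X Y)
  (at level 0, X, Y at level 99, format "[|  X ,  Y  |]").

(* Definite description, with default value [d]. *)
Definition the (T : Type) (d : T) (P : T -> Prop) : T :=
  if pselect (exists x, P x) is left h then projT1 (cid h) else d.

Section Riemannian.
Variables (R : realType) (n : nat) (M : manifold R n).
Local Notation X := (vfield M).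

(* [X] does not vanish at [p] iff it differentiates some function there. *)
Record metric := Metric {
  metric_fun :> X -> X -> Cinf M;
  metric_linear : forall V, scalar (metric_fun^~ V);
  metric_sym : forall U V, metric_fun U V = metric_fun V U;
  metric_pos : forall (U : X) (p : M),
    (exists f, U f p != 0) -> 0 < metric_fun U U p }.

(* The metric dual of a one-form. *)
Definition sharp (g : metric) (a : X -> Cinf M) : X :=
  the 0 (fun Z => forall V, g Z V = a V).

Definition connection (nabla : X -> X -> X) : Prop :=
  [/\ forall V, linear (nabla^~ V),
      forall U V W, nabla U (V + W) = nabla U V + nabla U W
    & forall U f V, nabla U (f *: V) = U f *: V + f *: nabla U V].

Definition torsion (nabla : X -> X -> X) (U V : X) : X :=
  nabla U V - nabla V U - [| U, V |].

End Riemannian.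

(* The norm of the one-form [eta] is that of its metric dual. *)
Record metric_contact (R : realType) (m : nat) (M : manifold R m.*2.+1) :=
  MetricContact {
    cg : metric M;
    ceta : {scalar vfield M};
    cJ : {linear vfield M -> vfield M};
    contact_norm : cg (sharp cg ceta) (sharp cg ceta) = 1;
    contact_extd : forall X Y, extd ceta X Y = cg (cJ X) Y;
    contact_J : forall X, cJ (cJ X) = - X + ceta X *: sharp cg ceta }.

Section Contact.
Variables (R : realType) (m : nat) (M : manifold R m.*2.+1).
Variable K : metric_contact M.
Local Notation VF := (vfield M).
Local Notation C := (Cinf M).
Local Notation g := (cg K).
Local Notation eta := (ceta K).
Local Notation J := (cJ K).
Implicit Types X Y Z : VF.

Definition Reeb : VF := sharp g eta.
Local Notation xi := Reeb.

Definition LieJ (X : VF) : VF := [| xi, J X |] - J [| xi, X |].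

Definition nijenhuis (X Y : VF) : VF :=
  cstf M (1 / 4) *: ([| J X, J Y |] + J (J [| X, Y |])
                     - J ([| J X, Y |] + [| X, J Y |])).

Definition adapted (nabla : VF -> VF -> VF) : Prop :=
  [/\ connection nabla,
      forall X Y Z, X (g Y Z) = g (nabla X Y) Z + g Y (nabla X Z),
      forall X Y, nabla X (J Y) = J (nabla X Y),
      forall X Y, X (eta Y) = eta (nabla X Y)
    & forall X, nabla X xi = 0].

(** Tensors on the contact distribution are extended by zero on [xi]; the
    predicates below say in particular that their arguments are so extended. *)

Definition horizontal (X : VF) : Prop := eta X = 0.

Definition hproj (X : VF) : VF := X - eta X *: xi.

Definition endC (F : VF -> VF) : Prop :=
  [/\ linear F, F xi = 0 & forall X, horizontal (F X)].

Definition symmetric_end (F : VF -> VF) : Prop :=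
  forall X Y, g (F X) Y = g X (F Y).

Definition skew_end (F : VF -> VF) : Prop :=
  forall X Y, g (F X) Y = - g X (F Y).

Definition EndJ_minus (F : VF -> VF) : Prop :=
  [/\ endC F, skew_end F & forall X, F (J X) = J (F X)].

Definition Omega1_C (a : VF -> C) : Prop := scalar a /\ a xi = 0.

Definition Omega2_C (a : VF -> VF -> C) : Prop :=
  [/\ forall Y, scalar (a^~ Y), forall X Y, a X Y = - a Y X
    & forall Y, a xi Y = 0].

Definition Omega3_C (w : VF -> VF -> VF -> C) : Prop :=
  [/\ forall Y Z, scalar (fun X => w X Y Z),
      forall X Y Z, w X Y Z = - w Y X Z,
      forall X Y Z, w X Y Z = - w X Z Y
    & forall Y Z, w xi Y Z = 0].

Definition Omega2_CC (B : VF -> VF -> VF) : Prop :=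
  [/\ forall Y, linear (B^~ Y), forall X Y, B X Y = - B Y X,
      forall Y, B xi Y = 0 & forall X Y, horizontal (B X Y)].

Definition Mop (T : Type) (B : VF -> VF -> T) (X Y : VF) : T := B (J X) (J Y).

Definition Omega20 (B : VF -> VF -> VF) : Prop :=
  Omega2_CC B /\
  forall X Y, horizontal X -> horizontal Y -> B (J X) Y = J (B X Y).

Definition Omega11 (B : VF -> VF -> VF) : Prop :=
  Omega2_CC B /\ forall X Y, Mop B X Y = B X Y.

Definition Omega02 (B : VF -> VF -> VF) : Prop :=
  Omega2_CC B /\
  forall X Y, horizontal X -> horizontal Y -> B (J X) Y = - J (B X Y).

Definition bianchi (B : VF -> VF -> VF) (X Y Z : VF) : C :=
  cstf M (1 / 3) * (g X (B Y Z) + g Y (B Z X) + g Z (B X Y)).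

(* A three-form seen as a vector-valued two-form: [g X (vec2 w Y Z) = w X Y Z]. *)
Definition vec2 (w : VF -> VF -> VF -> C) (Y Z : VF) : VF :=
  sharp g (fun X => w X Y Z).

Definition Omega11_s (B : VF -> VF -> VF) : Prop :=
  Omega11 B /\ forall X Y Z, bianchi B X Y Z = 0.

Definition orthonormal_at (p : M) (e : 'I_(m.*2.+1) -> VF) : Prop :=
  forall i j, g (e i) (e j) p = (i == j)%:R.

Definition orthogonal_forms (A B : VF -> VF -> VF) : Prop :=
  forall (p : M) (e : 'I_(m.*2.+1) -> VF), orthonormal_at p e ->
    \sum_i \sum_j g (A (e i) (e j)) (B (e i) (e j)) p = 0.

Definition Omega11_a (A : VF -> VF -> VF) : Prop :=
  Omega11 A /\ forall B, Omega11_s B -> orthogonal_forms A B.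

(* The inverse of the isomorphism
   [phi B = 3/4 (bianchi B + Mop (bianchi B))] from Omega20 to Omega11_a. *)
Definition phi_inv (A : VF -> VF -> VF) (Y Z : VF) : VF :=
  cstf M (3 / 2) *: (vec2 (bianchi A) Y Z - Mop (vec2 (bianchi A)) Y Z).

(** Complex types. The pair [(X, Y)] stands for the complex vector field
    [X + i Y], and a pair of smooth functions for a complex function. *)

(* [ctype true] is C^{1,0} and [ctype false] is C^{0,1}. *)
Definition ctype (b : bool) (Z : VF * VF) : Prop :=
  [/\ horizontal Z.1, horizontal Z.2
    & if b then J Z.1 = - Z.2 /\ J Z.2 = Z.1
           else J Z.1 = Z.2 /\ J Z.2 = - Z.1].

(* The complex trilinear extension of a real form. *)
Definition cext (w : VF -> VF -> VF -> C) (Z1 Z2 Z3 : VF * VF) : C * C :=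
  (w Z1.1 Z2.1 Z3.1 - w Z1.1 Z2.2 Z3.2 - w Z1.2 Z2.1 Z3.2 - w Z1.2 Z2.2 Z3.1,
   w Z1.2 Z2.1 Z3.1 + w Z1.1 Z2.2 Z3.1 + w Z1.1 Z2.1 Z3.2 - w Z1.2 Z2.2 Z3.2).

(* A complex three-form is given by its values [(Re, Im)] on real fields. *)
Definition cform_eval (a : VF -> VF -> VF -> C * C) (Z1 Z2 Z3 : VF * VF) : C * C :=
  let u := cext (fun X Y Z => (a X Y Z).1) Z1 Z2 Z3 in
  let v := cext (fun X Y Z => (a X Y Z).2) Z1 Z2 Z3 in
  (u.1 - v.2, u.2 + v.1).

(* Type [(p, 3 - p)]. *)
Definition pq_type (p : nat) (a : VF -> VF -> VF -> C * C) : Prop :=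
  [/\ Omega3_C (fun X Y Z => (a X Y Z).1),
      Omega3_C (fun X Y Z => (a X Y Z).2)
    & forall (b1 b2 b3 : bool) (Z1 Z2 Z3 : VF * VF),
        ctype b1 Z1 -> ctype b2 Z2 -> ctype b3 Z3 ->
        (b1 + b2 + b3 != p)%N -> cform_eval a Z1 Z2 Z3 = (0, 0)].

Definition is_plus_part (w wp : VF -> VF -> VF -> C) : Prop :=
  exists a30 a21 a12 a03,
    [/\ pq_type 3 a30, pq_type 2 a21, pq_type 1 a12 & pq_type 0 a03] /\
    forall X Y Z,
      (w X Y Z, 0) = a30 X Y Z + a21 X Y Z + a12 X Y Z + a03 X Y Z /\
      (wp X Y Z, 0) = a21 X Y Z + a12 X Y Z.

(* The superscript + of the component in Omega^3(C) of a three-form on [M]. *)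
Definition plus_part (w : VF -> VF -> VF -> C) : VF -> VF -> VF -> C :=
  the (fun _ _ _ => 0)
      (is_plus_part (fun X Y Z => w (hproj X) (hproj Y) (hproj Z))).

Definition Omega_plus (w : VF -> VF -> VF -> C) : Prop :=
  Omega3_C w /\ forall X Y Z, w X Y Z = plus_part w X Y Z.

Definition eta_wedge (F : VF -> VF) (Y Z : VF) : VF :=
  eta Y *: F Z - eta Z *: F Y.

Record parts := Parts {
  p20 : VF -> VF -> VF;
  p11 : VF -> VF -> VF;
  p11s : VF -> VF -> VF;
  p11a : VF -> VF -> VF;
  p02 : VF -> VF -> VF;
  p2plus : VF -> VF -> C;
  p2minus : VF -> VF -> C;
  p1plus : VF -> VF;
  p1minus : VF -> VF;
  p1R : VF -> C }.

Definition is_parts (B : VF -> VF -> VF) (d : parts) : Prop :=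
  [/\ [/\ Omega20 (p20 d), Omega11 (p11 d) & Omega02 (p02 d)],
      [/\ Omega11_s (p11s d), Omega11_a (p11a d)
        & forall Y Z, p11 d Y Z = p11s d Y Z + p11a d Y Z],
      [/\ Omega2_C (p2plus d), forall Y Z, Mop (p2plus d) Y Z = p2plus d Y Z,
          Omega2_C (p2minus d)
        & forall Y Z, Mop (p2minus d) Y Z = - p2minus d Y Z],
      [/\ endC (p1plus d), symmetric_end (p1plus d), endC (p1minus d),
          skew_end (p1minus d) & Omega1_C (p1R d)]
    & forall Y Z, B Y Z =
        p20 d Y Z + p11 d Y Z + p02 d Y Z
        + p2plus d Y Z *: xi + p2minus d Y Z *: xi
        + eta_wedge (p1plus d) Y Z + eta_wedge (p1minus d) Y Z
        + (eta Y * p1R d Z - eta Z * p1R d Y) *: xi].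

Definition parts0 : parts :=
  Parts (fun _ _ => 0) (fun _ _ => 0) (fun _ _ => 0) (fun _ _ => 0)
    (fun _ _ => 0) (fun _ _ => 0) (fun _ _ => 0) (fun=> 0) (fun=> 0) (fun=> 0).

(* The unique decomposition of a vector-valued two-form. *)
Definition parts_of (B : VF -> VF -> VF) : parts := the parts0 (is_parts B).

End Contact.

(* Main.v *)
(* An adapted connection preserves [eta], so d eta (X, Y) = eta (T(X, Y)): this gives
   the [xi]-component of the torsion. Since d eta = g(J -, -) is closed and parallel,
   the cyclic sum of g(J T(X, Y), Z) vanishes; its part of type (2,1) + (1,2) on
   [C] ties T^{2,0} to T^{1,1}, and evaluating it at [xi] shows that T(xi, -) splits
   into a symmetric part anticommuting with J, which L_xi J determines, and a skew
   part commuting with J. As J is parallel, the Nijenhuis tensor is an expression in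
   T and J alone, and its (0,2) part is that of T.

   Conversely, an adapted connection arises from the Levi-Civita connection by
   averaging over J on ker eta and splitting off [xi]. Adding to it a tensor with
   values in the g-skew J-commuting endomorphisms of ker eta moves the parameters
   (omega, B, Phi) of the torsion to any prescribed values.

   Vector fields being derivations of the algebra of smooth functions, every
   pointwise argument needs local frames, and these come from Hadamard's lemma and
   bump functions. The dual of a function-linear form is smooth because around each
   point it is a quotient of global functions, so no partition of unity is needed. *)
Require Import Defs.
From HB Require Import structures.
From mathcomp Require Import all_boot all_order all_algebra.
From mathcomp Require Import all_classical all_reals all_analysis.
From mathcomp Require Import ring lra.
Import Order.TTheory GRing.Theory Num.Theory.
Import numFieldNormedType.Exports.

Set Implicit Arguments.
Unset Strict Implicit.
Unset Printing Implicit Defensive.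
Local Open Scope classical_set_scope.
Local Open Scope ring_scope.

(** * Smooth functions on open sets *)

(** Parts of a tensor are named by definite description, so a statement about [parts_of] needs
    uniqueness of the decomposition. The delicate component is (1,1): an element of [Omega11_s] that
    is orthogonal to all of [Omega11_s] must vanish. This takes a positive definite pairing at each
    point, hence orthonormal frames there. Both directions go through one normal form,
    [torsion_form], depending on (N, w, B, F, Phi). Every adapted torsion has this form, with N and
    F imposed by the structure; changing the connection shifts only (w, B, Phi). The constants come
    from one fact. If w has type (2,1) + (1,2), the cyclic sum of w(X, JY, JZ) is w, so the Bianchi
    operator sends Mw to w/3. Hence 3/4 (w - Mw), of type (2,0), and 3/8 (w + Mw), in [Omega11_a],
    both have Bianchi image w/2, and their sum is 9/8 w - 3/8 Mw. Complex types of three-forms are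
    traded once and for all for the eigenvalues 1 and -3 of the real operator [Sop]. *)

Section SmoothCalculus.
Variables (R : realType) (V : normedModType R).

(** [Ck_on] differentiates in the ambient space, so it is a condition at each point of [U] and makes
    sense on singletons. Smoothness can then be checked point by point, with a neighbourhood
    depending on the point. *)
Lemma Ck_onP (W : normedModType R) k (U : set V) (f : V -> W) :
  Ck_on k U f <-> forall x, U x -> Ck_on k [set x] f.
Proof.
elim: k f => [ |k IH] f /=.
  split=> [H x Ux y ->|H x Ux]; first exact: H.
  exact: (H x Ux).
split=> [[H1 H2] x Ux|H].
  split=> [y ->|v]; first exact: H1.
  by move/IH: (H2 v); exact.
split=> [x Ux|v]; first by apply: (H x Ux).1.
by apply/IH => x Ux; exact: (H x Ux).2.
Qed.

Lemma smooth_onP (W : normedModType R) (U : set V) (f : V -> W) :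
  smooth_on U f <-> forall x, U x -> smooth_on [set x] f.
Proof.
split=> [H x Ux k|H k]; first by move/Ck_onP: (H k); exact.
by apply/Ck_onP => x Ux; exact: H.
Qed.

Lemma smooth_onW (W : normedModType R) (U U' : set V) (f : V -> W) :
  U `<=` U' -> smooth_on U' f -> smooth_on U f.
Proof. by move=> UU' /smooth_onP H; apply/smooth_onP => x /UU'; exact: H. Qed.

Lemma smooth_on_cst (W : normedModType R) (U : set V) (c : W) :
  smooth_on U (cst c).
Proof. by move=> k; exact: Ck_on_cst. Qed.

Lemma smooth_onD (W : normedModType R) (U : set V) (f g : V -> W) : open U ->
  smooth_on U f -> smooth_on U g -> smooth_on U (f + g).
Proof. by move=> oU fs gs k; exact: Ck_onD. Qed.

Lemma smooth_onM (U : set V) (f g : V -> R) : open U ->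
  smooth_on U f -> smooth_on U g -> smooth_on U (f * g).
Proof. by move=> oU fs gs k; exact: Ck_onM. Qed.

Lemma smooth_on_sum (I : Type) (r : seq I) (U : set V) (f : I -> V -> R) :
  open U -> (forall i, smooth_on U (f i)) -> smooth_on U (\sum_(i <- r) f i).
Proof.
move=> oU sf; elim: r => [ |i r IH]; last by rewrite big_cons; exact: smooth_onD.
by rewrite big_nil; exact: smooth_on_cst.
Qed.

Lemma smooth_on_differentiable (W : normedModType R) (U : set V) (f : V -> W) x :
  smooth_on U f -> U x -> differentiable f x.
Proof. by move=> /(_ 1%N)/= [+ _]; exact. Qed.

Lemma smooth_on_derive (W : normedModType R) (U : set V) (f : V -> W) v :
  smooth_on U f -> smooth_on U ('D_v f).
Proof. by move=> H k; exact: (H k.+1).2. Qed.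

Lemma open_eq_near (T : Type) (U : set V) (f g : V -> T) x : open U ->
  (forall y, U y -> f y = g y) -> U x -> {near x, f =1 g}.
Proof.
move=> oU fg Ux; have : nbhs x U by exact: open_nbhs_nbhs.
exact: filterS.
Qed.

Lemma smooth_on_eq (W : normedModType R) (U : set V) (f g : V -> W) : open U ->
  (forall x, U x -> f x = g x) -> smooth_on U f -> smooth_on U g.
Proof. by move=> oU fg sf k; exact: Ck_on_congr (sf k). Qed.

(* Differentiating [d * h = e] gives [d ^+ 2 * 'D_v h = d * 'D_v e - e * 'D_v d],
   which has the same shape. *)
Lemma smooth_on_quotient (U : set V) (h : V -> R) : open U ->
  (forall x, U x -> exists d e : V -> R, [/\ smooth_on U d, smooth_on U e, d x != 0
     & forall y, U y -> d y * h y = e y]) -> smooth_on U h.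
Proof.
move=> oU; have dH h' : (forall x, U x -> exists d e : V -> R, [/\ smooth_on U d,
    smooth_on U e, d x != 0 & forall y, U y -> d y * h' y = e y]) ->
    forall x, U x -> differentiable h' x.
  move=> H x Ux; have [d [e [sd se dx0 dhe]]] := H x Ux.
  have dd := smooth_on_differentiable sd Ux.
  apply: (@near_eq_differentiable _ _ _ (fun y => (d y)^-1 * e y)); last first.
    apply: differentiableM; last exact: smooth_on_differentiable se Ux.
    exact: differentiableV.
  have dn0 : \forall y \near x, d y != 0.
    have dc : {for x, continuous d} by exact: differentiable_continuous.
    have : nbhs (d x) [set y : R | y != 0].
      by apply: open_nbhs_nbhs; split=> //; exact: open_neq.
    exact: dc.
  have nU : nbhs x U by exact: open_nbhs_nbhs.
  near=> y.
  have dy : d y != 0 by near: y.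
  have Uy : U y by near: y.
  by rewrite -(dhe y Uy) mulKf.
move=> H k; elim: k h H => [ |k IH] h H /=.
  by move=> x Ux; exact/differentiable_continuous/dH.
split; first exact: dH.
move=> v; apply: IH => x Ux; have [d [e [sd se dx0 dhe]]] := H x Ux.
exists (d * d), (d * 'D_v e + cst (-1) * (e * 'D_v d)); split.
- exact: smooth_onM.
- apply: smooth_onD => //.
    by apply: smooth_onM => //; exact: smooth_on_derive.
  apply: smooth_onM => //; first exact: smooth_on_cst.
  by apply: smooth_onM => //; exact: smooth_on_derive.
- by rewrite mulf_neq0.
- move=> y Uy; rewrite !fctE.
  have -> : 'D_v e y = 'D_v (d * h) y.
    apply/esym/near_eq_derive; exact: open_eq_near dhe Uy.
  rewrite deriveM; first last.
  - exact/diff_derivable/(dH _ H).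
  - exact/diff_derivable/(smooth_on_differentiable sd Uy).
  by rewrite -dhe // /GRing.scale /=; ring.
Unshelve. all: by end_near. Qed.

Lemma smooth_on_linear (W : normedModType R) (L : {linear V -> W}) (U : set V) :
  continuous L -> smooth_on U L.
Proof.
move=> cL [ |k] /=; first by move=> x _; exact: cL.
split=> [x _|v]; first exact: linear_differentiable.
rewrite (_ : 'D_v L = cst (L v)); first exact: Ck_on_cst.
by apply/funext => x; rewrite deriveE ?diff_lin //; exact: linear_differentiable.
Qed.

End SmoothCalculus.

Section Coordinates.
Variables (R : realType) (n : nat).
Local Notation E := 'rV[R]_n.
Local Notation e_ := (fun i : 'I_n => delta_mx 0 i : E).

Definition coordinate (i : 'I_n) (x : E) : R := x 0 i.

Lemma coordinate_is_linear i : linear (coordinate i).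
Proof. by move=> a x y; rewrite /coordinate !mxE. Qed.

HB.instance Definition _ i :=
  GRing.isLinear.Build R E R *:%R (coordinate i) (coordinate_is_linear i).

Lemma coordinate_continuous i : continuous (coordinate i).
Proof. exact: coord_continuous. Qed.

Lemma smooth_coordinate i (U : set E) : smooth_on U (coordinate i).
Proof. exact/smooth_on_linear/coordinate_continuous. Qed.

Lemma derive_coordinate i (v : E) : 'D_v (coordinate i) = cst (v 0 i).
Proof.
have cL : continuous (coordinate i) by exact: coordinate_continuous.
by apply/funext => x; rewrite deriveE ?diff_lin //; exact: linear_differentiable.
Qed.

Lemma derive_sum_coord (W : normedModType R) (f : E -> W) x v :
  differentiable f x -> 'D_v f x = \sum_i v 0 i *: 'D_(e_ i) f x.
Proof.
move=> df; rewrite deriveE // {1}(row_sum_delta v) linear_sum.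
by apply: eq_bigr => i _; rewrite linearZ /= -deriveE.
Qed.

Variable V : normedModType R.

Lemma Ck_on_coordinate k (U : set V) (phi : V -> E) i : open U ->
  Ck_on k U phi -> Ck_on k U (coordinate i \o phi).
Proof.
have cL : continuous (coordinate i) by exact: coordinate_continuous.
move=> oU; elim: k phi => [ |k IH] phi /=.
  move=> H x Ux; apply: continuous_comp; [exact: H|exact: cL].
move=> [H1 H2]; split=> [x Ux|v].
  by apply: differentiable_comp; [exact: H1|exact: linear_differentiable].
apply: (Ck_on_congr oU _ (IH _ (H2 v))) => x Ux.
have dL : differentiable (coordinate i) (phi x) by exact: linear_differentiable.
have dp := H1 x Ux.
rewrite [RHS]deriveE; last exact: differentiable_comp.
by rewrite diff_comp //= diff_lin //= deriveE.
Qed.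

(** Chain rule in coordinates: the derivative of the composite is a sum of products of scalar
    functions, each of class C^k. The induction is over all [f], since the partial derivatives of
    [f] take its place. *)
Lemma Ck_on_comp k (U : set V) (U' : set E) (f : E -> R) (phi : V -> E) :
  open U -> open U' -> (forall x, U x -> U' (phi x)) ->
  Ck_on k U' f -> Ck_on k U phi -> Ck_on k U (f \o phi).
Proof.
move=> oU oU' UU'; elim: k f => [ |k IH] f.
  move=> /= fC pC x Ux; apply: continuous_comp; first exact: pC.
  exact/fC/UU'.
move=> [df Df] pk; have [dp Dp] := pk; split=> [x Ux|v].
  by apply: differentiable_comp; [exact: dp|exact/df/UU'].
pose F := \sum_i (coordinate i \o 'D_v phi) * ('D_(e_ i) f \o phi).
have : Ck_on k U F.
  rewrite /F; elim: (index_enum _) => [ |i r IHr].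
    by rewrite big_nil; exact: Ck_on_cst.
  rewrite big_cons; apply: Ck_onD => //; apply: Ck_onM => //.
    exact/Ck_on_coordinate/Dp.
  by apply: IH; [exact: Df|exact: Ck_onS pk].
apply: Ck_on_congr => // x Ux.
have dfx := df _ (UU' _ Ux); have dpx := dp _ Ux.
rewrite [RHS]deriveE; last exact: differentiable_comp.
rewrite diff_comp //= -(deriveE _ dpx) -(deriveE _ dfx) derive_sum_coord //.
by rewrite /F fct_sumE.
Qed.

Lemma smooth_on_comp (U : set V) (U' : set E) (f : E -> R) (phi : V -> E) :
  open U -> open U' -> (forall x, U x -> U' (phi x)) ->
  smooth_on U' f -> smooth_on U phi -> smooth_on U (f \o phi).
Proof. by move=> oU oU' UU' sf sp k; exact: (Ck_on_comp oU oU' UU'). Qed.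

End Coordinates.

(** * Bump functions *)

Section FlatFunction.
Variable R : realType.

(** The index makes the family stable under differentiation: the derivative of [flat j] is a
    combination of [flat j.+1] and [flat j.+2]. *)
Definition flat (j : nat) (s : R) : R :=
  if 0 < s then s^-1 ^+ j * expR (- s^-1) else 0.

(** Keep only the term of degree j + 2 in the series of exp(1/s). The factor s^2 that it leaves
    makes the difference quotient at 0 tend to 0. *)
Lemma flat_bound j s : 0 < s -> flat j s <= j.+2`!%:R * s ^+ 2.
Proof.
move=> s0; rewrite /flat s0; have si0 : 0 < s^-1 by rewrite invr_gt0.
have := expR_ge1Dxn j.+1 (ltW si0).
set F := j.+2`!%:R : R; have F0 : 0 < F by rewrite ltr0n fact_gt0.
move=> H; have {}H : s^-1 ^+ j.+2 <= F * expR s^-1.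
  rewrite -ler_pdivrMl // mulrC.
  by apply: le_trans H; rewrite lerDr.
rewrite expRN -ler_pdivlMr ?invr_gt0 ?expR_gt0 // invrK.
have -> : s^-1 ^+ j = s ^+ 2 * s^-1 ^+ j.+2.
  by rewrite (exprD _ 2 j) mulrA -exprMn divff ?gt_eqF // expr1n mul1r.
have q0 : 0 <= s ^+ 2 by rewrite exprn_ge0 // ltW.
move: (s ^+ 2) q0 => q q0; rewrite -[leRHS]mulrA (mulrCA F).
by rewrite ler_wpM2l.
Qed.

Lemma is_derive_flat j (s : R) :
  is_derive s (1 : R) (flat j) (- j%:R * flat j.+1 s + flat j.+2 s).
Proof.
case: (ltgtP s 0) => [s0|s0|->].
- have fz k : flat k s = 0 by rewrite /flat ltNge (ltW s0).
  rewrite !fz mulr0 addr0.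
  apply: (near_eq_is_derive (f := cst 0)).
  have : \forall y \near s, y < 0 by exact: lt_nbhsl.
  by apply: filterS => y y0; rewrite /flat ltNge (ltW y0).
- have sn0 : s != 0 by rewrite gt_eqF.
  pose iv : R -> R := fun y => y^-1.
  suff : is_derive s (1 : R) (iv ^+ j * (expR \o (- iv)))
      (- j%:R * flat j.+1 s + flat j.+2 s).
    apply: near_eq_is_derive.
    have : \forall y \near s, 0 < y by exact: lt_nbhsr.
    by apply: filterS => y y0; rewrite /flat y0 !fctE.
  have div : is_derive s 1 iv (- s ^- 2 *: 1) by exact: is_deriveV.
  have dexp : is_derive (- iv s) 1 expR (expR (- iv s)).
    by apply: is_derive_eq.
  have dcomp := @is_derive1_comp _ expR (- iv) _ _ _ dexp (is_deriveN div).
  have dX := is_deriveX j div.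
  apply: (is_derive_eq (is_deriveM dX dcomp)).
  rewrite /flat s0 !fctE /iv /GRing.scale /= !mulr1.
  case: j {dX} => [ |j] /=.
    by rewrite -(exprVn s 2); move: (expR (- s^-1)) (s^-1) => e t; ring.
  rewrite -(exprVn s 2); move: (expR (- s^-1)) (s^-1) => e t.
  by rewrite !(exprS t); move: (t ^+ j) (j.+1%:R : R) => q N; ring.
- have fz k : flat k 0 = 0 by rewrite /flat ltxx.
  rewrite !fz mulr0 addr0.
  have lim0 : (fun h : R => h^-1 *: (flat j (h *: 1 + 0) - flat j 0)) @ 0^' --> 0.
    apply/cvgrPdist_le => e e0.
    set F := j.+2`!%:R : R; have F0 : 0 < F by rewrite ltr0n fact_gt0.
    have eF : 0 < e / F by rewrite divr_gt0.
    near=> h.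
    rewrite sub0r normrN addr0 /flat ltxx subr0 /GRing.scale /= mulr1.
    case: ifPn => h0; last by rewrite mulr0 normr0 ltW.
    have := flat_bound j h0; rewrite {1}/flat h0 -/F.
    move=> H; rewrite ger0_norm; last first.
      rewrite !mulr_ge0 ?exprn_ge0 ?invr_ge0 ?expR_ge0 //; exact: ltW.
    rewrite ler_pdivrMl //; apply: le_trans H _.
    rewrite expr2 mulrCA ler_wpM2l ?ltW //.
    have : `|h| < e / F by near: h; exact: dnbhs0_lt.
    by rewrite gtr0_norm // => hF; rewrite mulrC -ltr_pdivlMr.
  apply: DeriveDef; first by apply/cvg_ex; exists 0.
  exact: cvg_lim lim0.
Unshelve. all: by end_near. Qed.

Lemma smooth_flat_comp (V : normedModType R) (u : V -> R) (U : set V) j :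
  open U -> smooth_on U u -> smooth_on U (flat j \o u).
Proof.
move=> oU su k; elim: k j => [ |k IH] j.
  move=> x Ux; apply: continuous_comp.
    exact/differentiable_continuous/(smooth_on_differentiable su).
  apply: differentiable_continuous; apply/derivable1_diffP.
  exact/ex_derive/is_derive_flat.
have df s : differentiable (flat j) s.
  by apply/derivable1_diffP/ex_derive/is_derive_flat.
split=> [x Ux|v].
  exact/differentiable_comp/df/(smooth_on_differentiable su).
pose F := (cst (- j%:R) * (flat j.+1 \o u) + (flat j.+2 \o u)) * 'D_v u.
have : Ck_on k U F.
  apply: Ck_onM => //; last exact: smooth_on_derive.
  by apply: Ck_onD => //; apply: Ck_onM => //; exact: Ck_on_cst.
apply: Ck_on_congr => // x Ux.
have du : differentiable u x by exact: smooth_on_differentiable Ux.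
rewrite [RHS]deriveE; last exact: differentiable_comp.
rewrite diff_comp //= -(deriveE _ du) diff1E ?derive1E //.
rewrite (@derive_val _ _ _ _ _ _ _ (is_derive_flat j (u x))).
by rewrite /F !fctE /GRing.scale /= mulrC.
Qed.

End FlatFunction.

(** * Hadamard's lemma *)

Section UnitIntervalIntegral.
Variable R : realType.
Local Notation mu := (@lebesgue_measure R).
Local Notation I01 := `[0%R, 1%R]%classic.

Definition int01 (h : R -> R) : R := (\int[mu]_(t in I01) h t)%R.

(** Continuity in the ambient line, endpoints included: integrands along segments inside an open set
    have it, and it is stable under composition without restricting functions. *)
Definition cont01 (h : R -> R) := forall t, I01 t -> {for t, continuous h}.

Lemma cont01_within h : cont01 h -> {within I01, continuous h}.
Proof.
by move=> ch; apply: continuous_in_subspaceT => t /set_mem; exact: ch.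
Qed.

Lemma cont01_integrable h : cont01 h -> mu.-integrable I01 (EFin \o h).
Proof.
move=> ch; apply: continuous_compact_integrable; first exact: segment_compact.
exact: cont01_within.
Qed.

Lemma int01D h k : cont01 h -> cont01 k ->
  int01 (fun t => h t + k t) = int01 h + int01 k.
Proof. by move=> ch ck; rewrite /int01 RintegralD //; exact: cont01_integrable. Qed.

Lemma int01Z c h : cont01 h -> int01 (fun t => c * h t) = c * int01 h.
Proof. by move=> ch; rewrite /int01 RintegralZl //; exact: cont01_integrable. Qed.

Lemma int01B h k : cont01 h -> cont01 k ->
  int01 (fun t => h t - k t) = int01 h - int01 k.
Proof. by move=> ch ck; rewrite /int01 RintegralB //; exact: cont01_integrable. Qed.

Lemma eq_int01 h k : (forall t, I01 t -> h t = k t) -> int01 h = int01 k.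
Proof. by move=> hk; apply: eq_Rintegral => t /set_mem; exact: hk. Qed.

Lemma int01_cst (c : R) : int01 (fun=> c) = c.
Proof.
have m1 : mu (`[0%R, 1%R]%classic : set R) = 1%E.
  by rewrite lebesgue_measure_itv /= lte_fin ltr01 oppr0 adde0.
by rewrite /int01 Rintegral_cst // [X in fine X]m1 mulr1.
Qed.

Lemma cont01_cst (c : R) : cont01 (fun=> c).
Proof. by move=> t _; exact: cst_continuous. Qed.

Lemma cont01D h k : cont01 h -> cont01 k -> cont01 (fun t => h t + k t).
Proof. by move=> ch ck t It; apply: continuousD; [exact: ch|exact: ck]. Qed.

Lemma cont01M h k : cont01 h -> cont01 k -> cont01 (fun t => h t * k t).
Proof. by move=> ch ck t It; apply: continuousM; [exact: ch|exact: ck]. Qed.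

Lemma cont01X j : cont01 (fun t => t ^+ j).
Proof. by move=> t _; exact: exprn_continuous. Qed.

Lemma int01_sum (I : Type) (r : seq I) (h : I -> R -> R) :
  (forall i, cont01 (h i)) ->
  int01 (fun t => \sum_(i <- r) h i t) = \sum_(i <- r) int01 (h i) /\
  cont01 (fun t => \sum_(i <- r) h i t).
Proof.
move=> ch; elim: r => [ |i r [IH1 IH2]].
  rewrite big_nil (_ : (fun=> _) = fun=> 0); last first.
    by apply/funext => t; rewrite big_nil.
  by rewrite int01_cst; split=> //; exact: cont01_cst.
rewrite big_cons (_ : (fun=> _) = fun t => h i t + \sum_(i <- r) h i t); last first.
  by apply/funext => t; rewrite big_cons.
by rewrite int01D // IH1; split=> //; exact: cont01D.
Qed.

Lemma int01_le h (c : R) : cont01 h -> (forall t, I01 t -> `|h t| <= c) ->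
  `|int01 h| <= c.
Proof.
move=> ch hc; have ih := cont01_integrable ch.
have iN : mu.-integrable I01 (EFin \o (fun t => `|h t|)).
  apply: cont01_integrable => t It.
  by apply: continuous_comp; [exact: ch|exact: norm_continuous].
apply: le_trans (le_normr_Rintegral _ ih) _ => //.
rewrite -[leRHS]int01_cst; apply: le_Rintegral => //.
exact/cont01_integrable/cont01_cst.
Qed.

Lemma int01_FTC (F f : R -> R) : cont01 f ->
  (forall t : R, I01 t -> is_derive t (1 : R) F (f t)) ->
  int01 f = F 1 - F 0.
Proof.
move=> cf dF; have cF t : I01 t -> {for t, continuous F}.
  move=> It; apply: differentiable_continuous; apply/derivable1_diffP.
  by have [] := dF t It.
have I0 : I01 (0 : R) by rewrite /= in_itv /= lexx ler01.
have I1 : I01 (1 : R) by rewrite /= in_itv /= lexx ler01.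
rewrite /int01 /Rintegral (@continuous_FTC2 _ f F) //.
- exact: cont01_within.
- split.
  + by move=> t /subset_itv_oo_cc It; have [] := dF t It.
  + exact/cvg_at_right_filter/cF.
  + exact/cvg_at_left_filter/cF.
- by move=> t /subset_itv_oo_cc It; rewrite derive1E; have [_ ->] := dF t It.
Qed.

Lemma mean_value01 (F f : R -> R) :
  (forall t : R, I01 t -> is_derive t (1 : R) F (f t)) ->
  exists2 c, I01 c & F 1 - F 0 = f c.
Proof.
move=> dF; have le01 : 0 <= 1 :> R by exact: ler01.
have dF' (t : R) : t \in `]0, 1[ -> is_derive t (1 : R) F (f t).
  by move=> /subset_itv_oo_cc; exact: dF.
have cF : {within I01, continuous F}.
  apply: continuous_in_subspaceT => t /set_mem It.
  apply: differentiable_continuous; apply/derivable1_diffP.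
  by have [] := dF t It.
have [c Ic ->] := MVT_segment le01 dF' cF.
by exists c => //; rewrite subr0 mulr1.
Qed.

End UnitIntervalIntegral.

Section Hadamard.
Variables (R : realType) (n : nat).
Local Notation E := 'rV[R]_n.
Local Notation e_ := (fun i : 'I_n => delta_mx 0 i : E).
Local Notation I01 := `[0%R, 1%R]%classic.

Lemma coordinate_le_norm (x : E) i : `|x 0 i| <= `|x|.
Proof.
rewrite [leRHS]mx_normrE.
exact: (le_bigmax _ (fun ij : 'I_1 * 'I_n => `|x ij.1 ij.2|) (0, i)).
Qed.

Lemma is_derive_line (f : E -> R) (a v : E) (s : R) :
  differentiable f (a + s *: v) ->
  is_derive s (1 : R) (fun s => f (a + s *: v)) ('D_v f (a + s *: v)).
Proof.
move=> /(@diff_derivable _ _ _ f _ v) df.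
have lE : (fun h : R => h^-1 *: (f (a + (h *: (1 : R) + s) *: v) - f (a + s *: v)))
    = (fun h : R => h^-1 *: (f (h *: v + (a + s *: v)) - f (a + s *: v))).
  apply/funext => h; congr (_ *: (f _ - _)).
  by rewrite [h *: 1]mulr1 scalerDl addrCA.
apply: DeriveDef; first by rewrite /derivable lE.
by rewrite /derive lE.
Qed.

Variables (U : set E) (q : E).
Hypothesis oU : open U.
Hypothesis starU : forall x (t : R), U x -> I01 t -> U (q + t *: (x - q)).

Definition ray (x : E) (t : R) : E := q + t *: (x - q).

(* Differentiating [f] along the ray at [x] produces a factor [t], hence the
   family indexed by [j]. *)
Definition ray_mean (j : nat) (f : E -> R) (x : E) : R :=
  int01 (fun t => t ^+ j * f (ray x t)).

Lemma ray_continuous (x : E) (t : R) :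
  (fun p : E * R => ray p.1 p.2) @ nbhs (x, t) --> ray x t.
Proof.
apply: cvgD; first exact: cvg_cst.
apply: cvgZ; first exact: cvg_snd.
by apply: cvgB; [exact: cvg_fst|exact: cvg_cst].
Qed.

Lemma cont01_ray (f : E -> R) x : (forall y, U y -> {for y, continuous f}) -> U x ->
  cont01 (fun t => f (ray x t)).
Proof.
move=> cf Ux t It; apply: (continuous_comp (f := ray x)); last exact/cf/starU.
apply: cvgD; first exact: cvg_cst.
by apply: cvgZ; [exact: cvg_id|exact: cvg_cst].
Qed.

(** Joint continuity at each (x, t) gives a neighbourhood of x depending on t; compactness of [0, 1]
    makes it uniform. *)
Lemma ray_uniform (f : E -> R) x (e : R) : (forall y, U y -> {for y, continuous f}) ->
  U x -> 0 < e ->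
  \forall x' \near x, forall t, I01 t -> `|f (ray x' t) - f (ray x t)| <= e.
Proof.
move=> cf Ux e0; have e20 : 0 < e / 2 by rewrite divr_gt0.
have : compact (I01 : set R) by exact: segment_compact.
move=> /compact_near_coveringP cov.
apply: (cov E (nbhs x) (fun x' t => `|f (ray x' t) - f (ray x t)| <= e)) => t It.
have cft : {for ray x t, continuous f} by exact/cf/starU.
have /cvgrPdist_lt /(_ _ e20) nf := cft.
have nfc := ray_continuous nf.
have [[A B] /= [nA nB] AB] := nfc.
exists (B, A) => //= -[t' x'] /= [Bt' Ax'].
have := AB (x', t') (conj Ax' Bt').
have := AB (x, t') (conj (nbhs_singleton nA) Bt') => /=.
set a := f _; set b := f (ray x t'); set c := f _ => H1 H2.
rewrite (_ : c - b = (a - b) - (a - c)); last by ring.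
apply: le_trans (ler_normB _ _) _.
by rewrite [leRHS]splitr lerD // ltW.
Qed.

Lemma ray_mean_continuous j (f : E -> R) : (forall y, U y -> {for y, continuous f}) ->
  forall y, U y -> {for y, continuous (ray_mean j f)}.
Proof.
move=> cf x Ux; 
  apply/(@cvgrPdist_le _ _ _ (nbhs x) (nbhs_filter x)) => e e0.
have nU : nbhs x U by exact: open_nbhs_nbhs.
suff : \forall x' \near x, `|ray_mean j f x - ray_mean j f x'| <= e by [].
have := ray_uniform cf Ux e0; move: nU; apply: filterS2 => x' Ux' H.
have cM y : U y -> cont01 (fun t => t ^+ j * f (ray y t)).
  by move=> Uy; apply: cont01M; [exact: cont01X|exact: cont01_ray].
rewrite distrC -int01B; [ |exact: cM|exact: cM].
apply: int01_le.
  apply: cont01D; first exact: cM.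
  by move=> t It; apply: continuousN; exact: (cM _ Ux t It).
move=> t It; rewrite -mulrBr normrM -[leRHS]mul1r.
move: (It); rewrite /= in_itv /= => /andP[t0 t1].
by apply: ler_pM => //; [rewrite ger0_norm ?exprn_ge0 // exprn_ile1|exact: H].
Qed.

Lemma differentiable_of_estimate (f : E -> R) (c : 'I_n -> R) x :
  (forall e : R, 0 < e -> \forall h \near (0 : E),
     `|f (h + x) - f x - \sum_i h 0 i * c i| <= e * `|h|) ->
  differentiable f x /\ forall v, 'D_v f x = \sum_i v 0 i * c i.
Proof.
pose L : E -> R := fun h => \sum_i h 0 i * c i.
move=> est; have Ll : linear L.
  move=> a u v; rewrite /L scaler_sumr -big_split; apply: eq_bigr => i _ /=.
  by rewrite !mxE mulrDl -scalerAl.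
pose Lm := GRing.isLinear.Build R E R *:%R L Ll.
pose L' : {linear E -> R} := HB.pack L Lm.
have cL : continuous L'.
  move=> y; rewrite /L' /= /L.
  have -> : (fun h : E => \sum_i h 0 i * c i) =
      \sum_i (coordinate i * cst (c i)).
    by apply/funext => h; rewrite fct_sumE.
  elim: (index_enum _) => [ |i r IH].
    by rewrite big_nil; exact: cst_continuous.
  rewrite big_cons; apply: continuousD => //.
  apply: continuousM; last exact: cst_continuous.
  exact: coordinate_continuous.
have gE : f \o shift x = cst (f x) + L' +o_ (0 : E) id.
  apply/eqaddoP => e e0.
  have := est e e0; apply: filterS => h; rewrite !fctE /=.
  by rewrite opprD addrA.
have dE := diff_unique cL gE.
have df : differentiable f x by apply/diff_locallyP; rewrite dE.
by split=> // v; rewrite deriveE // dE.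
Qed.

(** Differentiation under the integral sign: for each t the mean value theorem compares [f] at the
    two ray points, and [ray_uniform] bounds the error independently of t. *)
Lemma ray_mean_estimate j (f : E -> R) x : smooth_on U f -> U x ->
  forall e : R, 0 < e -> \forall h \near (0 : E),
    `|ray_mean j f (h + x) - ray_mean j f x
      - \sum_i h 0 i * ray_mean j.+1 ('D_(e_ i) f) x| <= e * `|h|.
Proof.
move=> sf Ux e e0.
have df y : U y -> differentiable f y by exact: smooth_on_differentiable.
have cf y : U y -> {for y, continuous f}.
  by move=> /df; exact: differentiable_continuous.
have cDf i y : U y -> {for y, continuous ('D_(e_ i) f)}.
  move=> Uy; apply: differentiable_continuous.
  by apply: smooth_on_differentiable Uy; exact: smooth_on_derive.
(* The n coordinates contribute at most [e' * |h|] each; dividing by n + 1 also covers n = 0. *)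
pose e' := e / n.+1%:R; have e'0 : 0 < e' by rewrite divr_gt0.
have near1 : \forall x' \near x, U x' /\ forall i t, I01 t ->
    `|'D_(e_ i) f (ray x' t) - 'D_(e_ i) f (ray x t)| <= e'.
  have nU : nbhs x U by exact: open_nbhs_nbhs.
  have nD i : \forall x' \near x, forall t, I01 t ->
      `|'D_(e_ i) f (ray x' t) - 'D_(e_ i) f (ray x t)| <= e'.
    exact: ray_uniform (cDf i) Ux e'0.
  exact: filterI nU (filter_forall _ nD).
have /nbhs_ballP [r /= r0 rP] := near1.
have : \forall h \near (0 : E), `|h| < r by exact: nbhs0_lt.
apply: filterS => h hr.
have Px (s : R) : I01 s -> U (x + s *: h) /\ forall i t, I01 t ->
    `|'D_(e_ i) f (ray (x + s *: h) t) - 'D_(e_ i) f (ray x t)| <= e'.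
  rewrite /= in_itv /= => /andP[s0 s1]; apply: rP.
  rewrite -ball_normE /= opprD addNKr normrN normrZ ger0_norm //.
  by apply: le_lt_trans hr; rewrite ler_piMl.
have I1 : I01 (1 : R) by rewrite /= in_itv /= lexx ler01.
have Uhx : U (h + x) by have [+ _] := Px 1 I1; rewrite scale1r addrC.
have c1 y : U y -> cont01 (fun t => t ^+ j * f (ray y t)).
  by move=> Uy; apply: cont01M; [exact: cont01X|exact: cont01_ray cf Uy].
have c2 i : cont01 (fun t => h 0 i * (t ^+ j.+1 * 'D_(e_ i) f (ray x t))).
  apply: cont01M; first exact: cont01_cst.
  by apply: cont01M; [exact: cont01X|exact: cont01_ray (cDf i) Ux].
have [S1 S2] := int01_sum (index_enum 'I_n) c2.
have -> : \sum_i h 0 i * ray_mean j.+1 ('D_(e_ i) f) x =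
    int01 (fun t => \sum_i h 0 i * (t ^+ j.+1 * 'D_(e_ i) f (ray x t))).
  rewrite S1; apply: eq_bigr => i _; rewrite int01Z //.
  by apply: cont01M; [exact: cont01X|exact: cont01_ray (cDf i) Ux].
have cB h1 h2 : cont01 h1 -> cont01 h2 -> cont01 (fun t : R => h1 t - h2 t : R).
  move=> ch1 ch2; apply: cont01D => // t It.
  by apply: continuousN; exact: ch2.
rewrite -int01B; [ |exact: c1|exact: c1]; rewrite -int01B //; last first.
  by apply: cB; exact: c1.
apply: int01_le; first exact: (cB _ _ (cB _ _ (c1 _ Uhx) (c1 _ Ux)) S2).
move=> t It.
(* Moving the endpoint by s h moves the ray point by s t h; this extra t turns t^j into t^(j+1). *)
have rayD s : ray (x + s *: h) t = ray x t + s *: (t *: h).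
  rewrite /ray addrAC scalerDr addrA; congr (_ + _).
  by rewrite !scalerA mulrC.
pose F (s : R) := f (ray x t + s *: (t *: h)).
pose dF (s : R) := \sum_i (t * h 0 i) * 'D_(e_ i) f (ray (x + s *: h) t).
have dFs (s : R) : I01 s -> is_derive s (1 : R) F (dF s).
  move=> Is; have dfs : differentiable f (ray x t + s *: (t *: h)).
    by rewrite -rayD; apply: df; apply: starU => //; exact: (Px s Is).1.
  apply: (is_derive_eq (is_derive_line dfs)).
  rewrite derive_sum_coord // -rayD; apply: eq_bigr => i _.
  by rewrite !mxE.
have [c Ic Fc] := mean_value01 dFs.
have F1 : F 1 = f (ray (h + x) t) by rewrite /F -rayD scale1r addrC.
have F0 : F 0 = f (ray x t) by rewrite /F scale0r addr0.
rewrite -mulrBr -F1 -F0 Fc /dF mulr_sumr -sumrB.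
apply: le_trans (ler_norm_sum _ _ _) _.
move: (It); rewrite /= in_itv /= => /andP[t0 t1].
apply: (@le_trans _ _ (\sum_(i < n) e' * `|h|)); last first.
  rewrite sumr_const card_ord -mulr_natl mulrA ler_wpM2r //.
  rewrite /e' mulrCA ler_piMr ?(ltW e0) // ler_pdivrMr ?ltr0n // mul1r.
  by rewrite ler_nat.
apply: ler_sum => i _.
set A := 'D_(e_ i) f (ray (x + c *: h) t); set B := 'D_(e_ i) f (ray x t).
have -> : t ^+ j * (t * h 0 i * A) - h 0 i * (t ^+ j.+1 * B)
   = t ^+ j.+1 * ((A - B) * h 0 i) by rewrite exprS; ring.
rewrite normrM -[leRHS]mul1r; apply: ler_pM => //.
  by rewrite ger0_norm ?exprn_ge0 // exprn_ile1.
rewrite normrM; apply: ler_pM => //; last exact: coordinate_le_norm.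
exact: (Px c Ic).2.
Qed.

Lemma smooth_ray_mean (f : E -> R) j : smooth_on U f ->
  smooth_on U (ray_mean j f).
Proof.
move=> sf k; elim: k j f sf => [ |k IH] j f sf.
  move=> x Ux; apply: ray_mean_continuous => // y Uy.
  exact/differentiable_continuous/(smooth_on_differentiable sf).
have est x Ux := differentiable_of_estimate (ray_mean_estimate j sf (x := x) Ux).
split=> [x Ux|v]; first exact: (est x Ux).1.
pose F := \sum_i cst (v 0 i) * ray_mean j.+1 ('D_(e_ i) f).
have : Ck_on k U F.
  rewrite /F; elim: (index_enum _) => [ |i r IHr].
    by rewrite big_nil; exact: Ck_on_cst.
  rewrite big_cons; apply: Ck_onD => //; apply: Ck_onM => //.
    exact: Ck_on_cst.
  exact/IH/smooth_on_derive.
apply: Ck_on_congr => // x Ux.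
by rewrite (est x Ux).2 /F fct_sumE.
Qed.

(** Integrate the derivative of [f] along the segment from [q] to [x]: [h i] is the mean of the i-th
    partial derivative. Its value at [q] is what a derivation at [q] sees. *)
Lemma hadamard (f : E -> R) : U q -> smooth_on U f ->
  exists h : 'I_n -> E -> R, [/\ forall i, smooth_on U (h i),
    forall x, U x -> f x = f q + \sum_i (x 0 i - q 0 i) * h i x
    & forall i, h i q = 'D_(e_ i) f q].
Proof.
move=> Uq sf; exists (fun i => ray_mean 0 ('D_(e_ i) f)).
have cDf i y : U y -> {for y, continuous ('D_(e_ i) f)}.
  move=> Uy; apply: differentiable_continuous.
  by apply: smooth_on_differentiable Uy; exact: smooth_on_derive.
split=> [i|x Ux|i].
- exact/smooth_ray_mean/smooth_on_derive.
- have c i : cont01 (fun t => (x 0 i - q 0 i) * ('D_(e_ i) f (ray x t))).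
    by apply: cont01M; [exact: cont01_cst|exact: cont01_ray (cDf i) Ux].
  have [S1 S2] := int01_sum (index_enum 'I_n) c.
  have dF (t : R) : I01 t -> is_derive t (1 : R) (fun t => f (ray x t))
      (\sum_i (x 0 i - q 0 i) * 'D_(e_ i) f (ray x t)).
    move=> It; have dft : differentiable f (q + t *: (x - q)).
      by apply: (smooth_on_differentiable sf); exact: starU.
    apply: (is_derive_eq (is_derive_line dft)).
    by rewrite derive_sum_coord //; apply: eq_bigr => i _; rewrite !mxE.
  have := int01_FTC S2 dF; rewrite S1 /ray scale1r scale0r addr0 subrKC.
  move=> H; apply/eqP; rewrite addrC -subr_eq -H; apply/eqP.
  apply: eq_bigr => i _; rewrite /ray_mean.
  rewrite -int01Z; last first.
    apply: cont01M; first exact: cont01X.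
    exact: cont01_ray (cDf i) Ux.
  by apply: eq_int01 => t _; rewrite expr0 mul1r.
- rewrite /ray_mean -[RHS](int01_cst ('D_(e_ i) f q)).
  by apply: eq_int01 => t _; rewrite /ray subrr scaler0 addr0 expr0 mul1r.
Qed.

End Hadamard.

(** * Vector fields in charts *)

Section Evaluation.
Variables (R : realType) (n : nat) (M : manifold R n).
Implicit Types (f h : Cinf M) (q : M).

Lemma CinfP f h : (forall q, f q = h q) -> f = h.
Proof. by move=> fh; apply: val_inj; exact/funext. Qed.

Lemma CinfD f h q : (f + h) q = f q + h q. Proof. by []. Qed.
Lemma CinfN f q : (- f) q = - f q. Proof. by []. Qed.
Lemma CinfM f h q : (f * h) q = f q * h q. Proof. by []. Qed.
Lemma Cinf0 q : (0 : Cinf M) q = 0. Proof. by []. Qed.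
Lemma Cinf1 q : (1 : Cinf M) q = 1. Proof. by []. Qed.
Lemma Cinf_cst c q : cstf M c q = c. Proof. by []. Qed.

Lemma Cinf_sum (I : Type) (r : seq I) (P : pred I) (f : I -> Cinf M) q :
  (\sum_(i <- r | P i) f i) q = \sum_(i <- r | P i) f i q.
Proof.
by apply: (big_morph (fun f : Cinf M => f q)) => [x y| ]; rewrite ?CinfD ?Cinf0.
Qed.

Definition CinfE := (CinfD, CinfN, CinfM, Cinf0, Cinf1, Cinf_cst, Cinf_sum).

End Evaluation.

Section Derivations.
Variables (R : realType) (n : nat) (M : manifold R n).
Implicit Types (f h : Cinf M) (X Y : vfield M) (q : M).

Lemma vfield_apD X f h : X (f + h) = X f + X h.
Proof. by case: (vfield_derivation X). Qed.

Lemma vfield_apM X f h : X (f * h) = X f * h + f * X h.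
Proof. by case: (vfield_derivation X). Qed.

Lemma vfield_apZ X c f : X (cstf M c * f) = cstf M c * X f.
Proof. by case: (vfield_derivation X). Qed.

Lemma vfield_ap0 X : X 0 = 0.
Proof.
have : X (0 + 0) = X 0 + X 0 by exact: vfield_apD.
by rewrite addr0 => /eqP; rewrite -subr_eq subrr => /eqP.
Qed.

Lemma vfield_apN X f : X (- f) = - X f.
Proof. by apply/eqP; rewrite -addr_eq0 -vfield_apD addNr vfield_ap0. Qed.

Lemma vfield_apB X f h : X (f - h) = X f - X h.
Proof. by rewrite vfield_apD vfield_apN. Qed.

Lemma vfield_ap1 X : X 1 = 0.
Proof.
have : X (1 * 1) = X 1 * 1 + 1 * X 1 by exact: vfield_apM.
by rewrite !mulr1 mul1r => /eqP; rewrite -subr_eq subrr eq_sym => /eqP.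
Qed.

Lemma vfield_ap_cst X c : X (cstf M c) = 0.
Proof. by rewrite -[cstf M c]mulr1 vfield_apZ vfield_ap1 mulr0. Qed.

Lemma vfield_ap_sum X (I : Type) (r : seq I) (P : pred I) (f : I -> Cinf M) :
  X (\sum_(i <- r | P i) f i) = \sum_(i <- r | P i) X (f i).
Proof. by apply: (big_morph X) => [x y| ]; rewrite ?vfield_apD ?vfield_ap0. Qed.

Lemma vfieldDE X Y f : (X + Y) f = X f + Y f. Proof. by []. Qed.
Lemma vfieldNE X f : (- X) f = - X f. Proof. by []. Qed.
Lemma vfieldZE a X f : (a *: X) f = a * X f. Proof. by []. Qed.
Lemma vfield0E f : (0 : vfield M) f = 0. Proof. by []. Qed.

Lemma bracket_skew X Y : [| Y, X |] = - [| X, Y |].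
Proof. by apply: vfieldP => f; rewrite vfieldNE /=; ring. Qed.

Lemma vfield_sumE (I : Type) (r : seq I) (P : pred I) (X : I -> vfield M) f :
  (\sum_(i <- r | P i) X i) f = \sum_(i <- r | P i) X i f.
Proof.
by apply: (big_morph (fun X : vfield M => X f)).
Qed.

(* Local smoothness suffices, and no partition of unity is needed when the local
   pieces are quotients of global functions. *)
Lemma smooth_of_quotients (h : M -> R) :
  (forall p, exists d e : Cinf M, d p != 0 /\ forall q, d q * h q = e q) ->
  h \in @smooth_pred R n M.
Proof.
move=> H; apply/asboolP => i; apply: smooth_on_quotient => [ |y Uy].
  exact: chart_cod_open.
have [d [e [dn0 dhe]]] := H (chart_inv (atlas i) y).
exists (d \o chart_inv (atlas i)), (e \o chart_inv (atlas i)); split.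
- by have /asboolP := Cinf_smooth d; exact.
- by have /asboolP := Cinf_smooth e; exact.
- by [].
- by move=> z _ /=; exact: dhe.
Qed.

End Derivations.

(** * Extension by zero from a chart *)

Section Extension.
Variables (R : realType) (n : nat) (M : manifold R n).
Local Notation E := 'rV[R]_n.

Lemma open_chart_inv_preimage (c : chart R n M) (O : set M) : open O ->
  open (chart_cod c `&` (chart_inv c @^-1` O)).
Proof.
move=> oO; rewrite openE => y [cy Oy]; apply: filterI.
  by apply: open_nbhs_nbhs; split=> //; exact: chart_cod_open.
by apply: (chart_inv_continuous cy); exact: open_nbhs_nbhs.
Qed.

Lemma open_chart_map_preimage (c : chart R n M) (O : set E) : open O ->
  open (chart_dom c `&` (chart_map c @^-1` O)).
Proof.
move=> oO; rewrite openE => x [cx Ox]; apply: filterI.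
  by apply: open_nbhs_nbhs; split=> //; exact: chart_dom_open.
by apply: (chart_map_continuous cx); exact: open_nbhs_nbhs.
Qed.

Definition extend0 (c : chart R n M) (h : E -> R) (q : M) : R :=
  if pselect (chart_dom c q) then h (chart_map c q) else 0.

Lemma extend0_in c h q : chart_dom c q -> extend0 c h q = h (chart_map c q).
Proof. by rewrite /extend0; case: pselect. Qed.

(** The image of [A] is closed, being compact in a Hausdorff space. Near it, the transition map
    reduces the claim to [h]; on its open complement the extension is zero. *)
Lemma extend0_smooth (i : chart_index M) (h : E -> R) (A U : set E) :
  compact A -> open U -> A `<=` U -> U `<=` chart_cod (atlas i) ->
  smooth_on U h -> (forall y, ~ A y -> h y = 0) ->
  extend0 (atlas i) h \in @smooth_pred R n M.
Proof.
move=> cA oU AU Ucod sh h0; set c := atlas i.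
pose S := chart_inv c @` A.
have clS : closed S.
  apply: compact_closed; first exact: manifold_hausdorff.
  apply: continuous_compact => //.
  apply: continuous_in_subspaceT => y /set_mem Ay.
  exact/chart_inv_continuous/Ucod/AU.
apply/asboolP => j; apply/smooth_onP => y Uy; set cj := atlas j.
have [Sq|nSq] := pselect (S (chart_inv cj y)).
  pose W := chart_dom c `&` (chart_map c @^-1` U).
  have oW : open W by exact: open_chart_map_preimage.
  pose O := chart_cod cj `&` (chart_inv cj @^-1` W).
  have oO : open O by exact: open_chart_inv_preimage.
  have Oy : O y.
    split=> //; case: Sq => z Az zq; rewrite /W /preimage /= -zq.
    have cz : chart_cod c z by exact/Ucod/AU.
    by split; [exact: chart_inv_sub|rewrite /= chart_invK //; exact: AU].
  have sO : smooth_on O (h \o (chart_map c \o chart_inv cj)).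
    apply: (@smooth_on_comp _ _ _ _ U) => //; first by move=> z [_ []].
    by apply: smooth_onW (atlas_smooth (j) i) => z [cz [dz _]].
  have : smooth_on O (extend0 c h \o chart_inv cj).
    apply: smooth_on_eq sO => // z [cz [dz _]] /=.
    by rewrite extend0_in.
  by apply: smooth_onW => _ ->.
pose O := chart_cod cj `&` (chart_inv cj @^-1` ~` S).
have oO : open O by apply: open_chart_inv_preimage; exact: closed_openC.
have : smooth_on O (extend0 c h \o chart_inv cj).
  apply: (@smooth_on_eq _ _ _ O (cst 0)) => //; last exact: smooth_on_cst.
  move=> z [cz nSz] /=; rewrite /extend0; case: pselect => // dz.
  apply/esym/h0 => Az; apply: nSz; exists (chart_map c (chart_inv cj z)) => //.
  exact: chart_mapK.
by apply: smooth_onW => _ ->.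
Qed.

End Extension.

Section Bump.
Variables (R : realType) (n : nat).
Local Notation E := 'rV[R]_n.

Lemma norm_le_coordinates (x : E) (r : R) : 0 <= r ->
  (forall i, `|x 0 i| <= r) -> `|x| <= r.
Proof.
move=> r0 H; rewrite [leLHS]mx_normrE.
by apply: bigmax_le => // -[i j] _ /=; rewrite ord1.
Qed.

Lemma ball_star (y q x : E) (r t : R) : ball y r q -> ball y r x ->
  `[0, 1]%classic t -> ball y r (q + t *: (x - q)).
Proof.
rewrite -ball_normE /= in_itv /= => qr xr /andP[t0 t1].
have -> : y - (q + t *: (x - q)) = (1 - t) *: (y - q) + t *: (y - x).
  rewrite !scalerBr !scalerBl scale1r opprD opprB.
  rewrite [t *: y - t *: x]addrC addrA.
  by rewrite -[y - t *: y]opprB; apply/eqP; rewrite -subr_eq0; apply/eqP;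
    apply/rowP => i; rewrite !mxE; ring.
have t1' : 0 <= 1 - t by rewrite subr_ge0.
apply: le_lt_trans (ler_normD _ _) _; rewrite !normrZ !ger0_norm //.
have [->|tn0] := eqVneq t 0; first by rewrite subr0 mul1r mul0r addr0.
have tp : 0 < t by rewrite lt_neqAle eq_sym tn0.
rewrite [ltRHS](_ : r = (1 - t) * r + t * r); last by ring.
by apply: ler_ltD; [exact: ler_wpM2l (ltW qr)|rewrite ltr_pM2l].
Qed.

Lemma bump (U : set E) (y : E) : open U -> U y ->
  exists (chi : E -> R) (A : set E) (r : R),
  [/\ compact A, A `<=` ball y r & ball y r `<=` U] /\
  [/\ smooth_on setT chi, forall x, ~ A x -> chi x = 0 & chi y != 0].
Proof.
move=> oU Uy; have nU : nbhs y U by exact: open_nbhs_nbhs.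
have /nbhs_ballP [r /= r0 rU] := nU.
pose s := r / 2; have s0 : 0 < s by rewrite divr_gt0.
pose w i : E -> R := coordinate i + cst (- y 0 i).
(* The norm of row vectors is the maximum norm, which is not smooth. The cutoff uses the squared
   Euclidean distance instead, whose closed disc of radius [s] lies in the norm ball of radius
   [r]. *)
pose u : E -> R := cst (s ^+ 2) + cst (-1) * \sum_i (w i * w i).
have uE x : u x = s ^+ 2 - \sum_i (x 0 i - y 0 i) ^+ 2.
  by rewrite /u !fctE mulN1r fct_sumE.
have su : smooth_on setT u.
  apply: smooth_onD; [exact: openT|exact: smooth_on_cst| ].
  apply: smooth_onM; [exact: openT|exact: smooth_on_cst| ].
  apply: smooth_on_sum => [ |i]; first exact: openT.
  have sw : smooth_on setT (w i).
    apply: smooth_onD; [exact: openT|exact: smooth_coordinate| ].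
    exact: smooth_on_cst.
  by apply: smooth_onM => //; exact: openT.
pose A : set E := [set x | 0 <= u x].
have As x : A x -> `|x - y| <= s.
  rewrite /A /= uE subr_ge0 => H; apply: norm_le_coordinates => [ |i].
    exact: ltW.
  rewrite -(@ler_pXn2r _ 2) ?nnegrE //; last exact: ltW.
  rewrite real_normK ?num_real // !mxE; apply: le_trans H.
  rewrite (bigD1 i) //= lerDl; apply: sumr_ge0 => j _; exact: sqr_ge0.
have As' x : A x -> ball y r x.
  move=> /As H; rewrite -ball_normE /= distrC; apply: le_lt_trans H _.
  by rewrite /s ltr_pdivrMr // ltr_pMr // ltr1n.
exists (flat 0 \o u), A, r; split; split => //.
- apply: bounded_closed_compact.
    exists (`|y| + s); split; first exact: num_real.
    move=> N /ltW ltN x /As xs; apply: le_trans ltN.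
    by rewrite -[x](subrK y) addrC (le_trans (ler_normD _ _)) // lerD2l.
  apply: (@closed_comp _ _ u [set z | 0 <= z]) => [x _| ]; last exact: closed_ge.
  exact/differentiable_continuous/(smooth_on_differentiable su).
- by apply: smooth_flat_comp => //; exact: openT.
- by move=> x /negP; rewrite /= /flat -ltNge => /ltW; rewrite leNgt => /negbTE ->.
- rewrite /= uE big1 ?subr0; last by move=> i _; rewrite subrr expr0n.
  by rewrite /flat exprn_gt0 // expr0 mul1r gt_eqF // expR_gt0.
Qed.

End Bump.

(** * Local frames *)

Section LocalFrame.
Variables (R : realType) (n : nat) (M : manifold R n).
Local Notation E := 'rV[R]_n.
Local Notation e_ := (fun i : 'I_n => delta_mx 0 i : E).

Section Chart.
Variables (i : chart_index M) (chi : E -> R) (A : set E) (y0 : E) (r : R).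
Local Notation c := (atlas i).
Hypotheses (cA : compact A) (AB : A `<=` ball y0 r)
  (BU : ball y0 r `<=` chart_cod c) (schi : smooth_on setT chi)
  (chi0 : forall x, ~ A x -> chi x = 0).

Lemma smooth_chart (f : Cinf M) : smooth_on (chart_cod c) (f \o chart_inv c).
Proof. by have /asboolP := Cinf_smooth f; exact. Qed.

Lemma cutoff_smooth (U : set E) (k : E -> R) : open U -> A `<=` U ->
  U `<=` chart_cod c -> smooth_on U k ->
  extend0 c (chi * k) \in @smooth_pred R n M.
Proof.
move=> oU AU Uc sk; apply: (extend0_smooth cA oU AU Uc).
  by apply: smooth_onM => //; apply: smooth_onW schi.
by move=> y /chi0; rewrite !fctE => ->; rewrite mul0r.
Qed.

Lemma Acod : A `<=` chart_cod c. Proof. by move=> x /AB /BU. Qed.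

Definition cutoff (k : E -> R) (sk : smooth_on (chart_cod c) k) : Cinf M :=
  MkCinf (cutoff_smooth (chart_cod_open c) Acod (fun _ h => h) sk).

Definition chi_hat : Cinf M := cutoff (smooth_on_cst (chart_cod c) (1 : R)).
Definition y_hat k : Cinf M := cutoff (@smooth_coordinate _ _ k (chart_cod c)).

Definition cut_partial k (f : Cinf M) : Cinf M :=
  cutoff (smooth_on_derive (e_ k) (smooth_chart f)).

Lemma cutoff_in k (sk : smooth_on (chart_cod c) k) q : chart_dom c q ->
  cutoff sk q = chi (chart_map c q) * k (chart_map c q).
Proof. by move=> cq; rewrite /= extend0_in. Qed.

Lemma cutoff_out k (sk : smooth_on (chart_cod c) k) q : ~ chart_dom c q ->
  cutoff sk q = 0.
Proof. by rewrite /= /extend0; case: pselect. Qed.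

Lemma cut_partial_derivation k : derivation (cut_partial k).
Proof.
have dd (f : Cinf M) q : chart_dom c q ->
    derivable (f \o chart_inv c) (chart_map c q) (e_ k).
  move=> cq; apply: diff_derivable.
  exact: smooth_on_differentiable (smooth_chart f) (chart_map_sub cq).
split=> [f h|a f|f h]; apply: CinfP => q; rewrite !CinfE;
  (have [cq|nq] := pselect (chart_dom c q);
    [rewrite !cutoff_in //|by rewrite !cutoff_out // ?(mulr0, mul0r, addr0)]).
- have -> : (f + h : Cinf M) \o chart_inv c = (f \o chart_inv c) + (h \o chart_inv c).
    by [].
  by rewrite deriveD ?mulrDr //; exact: dd.
- have -> : (cstf M a * f : Cinf M) \o chart_inv c = a *: (f \o chart_inv c) by [].
  by rewrite deriveZ /=; [rewrite mulrCA|exact: dd].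
- have -> : (f * h : Cinf M) \o chart_inv c = (f \o chart_inv c) * (h \o chart_inv c).
    by [].
  rewrite deriveM; [ |exact: dd|exact: dd].
  by rewrite /= chart_mapK // /GRing.scale /=; ring.
Qed.

Definition frame_field k : vfield M := VField (cut_partial_derivation k).

(** Formally chi^2 X(y_k): by the Leibniz rule the subtraction removes the derivative of the cutoff.
    Hence [chi] need not be constant near the point. *)
Definition frame_coord k (X : vfield M) : Cinf M :=
  chi_hat * X (y_hat k) - y_hat k * X chi_hat.

Lemma frame_coord_scalar k : scalar (frame_coord k).
Proof. by move=> a X Y; rewrite /frame_coord !vfieldDE !vfieldZE; ring. Qed.

Lemma frame_coord_neq0 k X q : frame_coord k X q != 0 -> exists f, X f q != 0.
Proof.
have [Xy|Xy _] := eqVneq (X (y_hat k) q) 0; last by exists (y_hat k).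
have [Xc|Xc _] := eqVneq (X chi_hat q) 0; last by exists chi_hat.
by rewrite /frame_coord !CinfE Xy Xc !mulr0 subrr eqxx.
Qed.

Lemma frame_coord_field k l :
  frame_coord k (frame_field l) = chi_hat ^+ 3 * (k == l)%:R.
Proof.
apply: CinfP => q; have -> : (k == l)%:R = cstf M (k == l)%:R.
  by apply: CinfP => x; case: (k == l).
rewrite !exprS expr0 !CinfE.
have [cq|nq] := pselect (chart_dom c q); last by rewrite !cutoff_out // !mul0r subrr.
have cy := chart_map_sub cq; set y := chart_map c q in cy *.
rewrite !cutoff_in // -/y mulr1.
have dchi : derivable chi y (e_ l).
  exact/diff_derivable/(smooth_on_differentiable schi).
have nearE (k0 : E -> R) (sk : smooth_on (chart_cod c) k0) :
    'D_(e_ l) (cutoff sk \o chart_inv c) y = 'D_(e_ l) (chi * k0) y.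
  apply: near_eq_derive.
  apply: open_eq_near (chart_cod_open c) _ cy => z cz.
  by rewrite [LHS]cutoff_in ?chart_invK //; exact: chart_inv_sub.
have D1 : 'D_(e_ l) (chi * cst 1) y = 'D_(e_ l) chi y.
  have -> // : chi * cst 1 = chi by apply/funext => z; exact: mulr1.
have D2 : 'D_(e_ l) (chi * coordinate k) y =
    chi y * (k == l)%:R + y 0 k * 'D_(e_ l) chi y.
  have dk : derivable (coordinate k) y (e_ l).
    exact/diff_derivable/(smooth_on_differentiable (@smooth_coordinate _ _ _ setT)).
  have dkE : 'D_(e_ l) (coordinate k) y = (k == l)%:R.
    by have /(congr1 (@^~ y)) /= -> := derive_coordinate k (e_ l); rewrite mxE eqxx.
  by rewrite (deriveM dchi dk) dkE.
rewrite !nearE D1 D2 /coordinate /=.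
by ring.
Qed.

(** Hadamard's lemma writes f - f(q) as a sum of products (y_k - y_k(q)) h_k. Cut off by chi^2, this
    becomes an identity of global functions to which the derivation [X] applies; at q, only the
    terms X(y_k) h_k(q) survive. *)
Lemma frame_expand X :
  chi_hat ^+ 3 *: X = \sum_k frame_coord k X *: frame_field k.
Proof.
apply: vfieldP => f; apply: CinfP => q.
rewrite vfield_sumE vfieldZE !exprS expr0 !CinfE mulr1.
have [cq|nq] := pselect (chart_dom c q); last first.
  rewrite !cutoff_out // !mul0r big1 // => k _.
  by rewrite vfieldZE CinfE [frame_field k f q]cutoff_out // mulr0.
have cy := chart_map_sub cq; set y := chart_map c q in cy *.
have [Ay|nAy] := pselect (A y); last first.
  rewrite !cutoff_in // -/y chi0 // !mul0r big1 // => k _.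
  by rewrite vfieldZE CinfE [frame_field k f q]cutoff_in // -/y chi0 // mul0r mulr0.
have By := AB Ay.
have oB : open (ball y0 r) by exact: ball_open.
have sF : smooth_on (ball y0 r) (f \o chart_inv c).
  by apply: smooth_onW (smooth_chart f).
have [h [sh hE hy]] := hadamard oB (fun x t Bx It => ball_star By Bx It) By sF.
(* The functions [h k] are smooth on the ball only, so they are cut off from there; [A] lies inside
   it. *)
pose H k : Cinf M := MkCinf (cutoff_smooth oB AB BU (sh k)).
have Hin k x : chart_dom c x -> H k x = chi (chart_map c x) * h k (chart_map c x).
  by move=> cx; rewrite /= extend0_in.
have Hout k x : ~ chart_dom c x -> H k x = 0.
  by rewrite /= /extend0; case: pselect.
have main : chi_hat * chi_hat * (f - cstf M (f q)) =
    \sum_k (y_hat k - cstf M (y 0 k) * chi_hat) * H k.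
  apply: CinfP => x; rewrite !CinfE.
  have [cx|nx] := pselect (chart_dom c x); last first.
    rewrite cutoff_out // !mul0r big1 // => k _.
    by rewrite !CinfE Hout // mulr0.
  rewrite !cutoff_in //.
  have [Ax|nAx] := pselect (A (chart_map c x)); last first.
    rewrite chi0 // !mul0r big1 // => k _.
    by rewrite !CinfE Hin // chi0 // mul0r mulr0.
  have fx : f x = f q + \sum_k (chart_map c x 0 k - y 0 k) * h k (chart_map c x).
    by have := hE _ (AB Ax); rewrite /= chart_mapK // /y chart_mapK.
  rewrite fx.
  rewrite addrC addKr mulr_sumr; apply: eq_bigr => k _.
  by rewrite !CinfE Hin // !cutoff_in // /coordinate /=; ring.
have := congr1 (fun g => X g q) main.
rewrite !vfield_apM vfield_apB vfield_ap_cst vfield_ap_sum !CinfE subrr.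
rewrite mulr0 add0r subr0 => mainq.
rewrite -mulrA mainq mulr_sumr.
apply: eq_bigr => k _.
rewrite vfield_apM vfield_apB vfield_apM vfield_ap_cst vfieldZE !CinfE.
rewrite [frame_field k f q]cutoff_in // Hin // hy !cutoff_in // -/y /coordinate /=.
by ring.
Qed.

End Chart.

(** [theta] is a common denominator, nonzero at [p], so that all the data are global. The last
    clause expresses nonvanishing of [X] in the form that [metric_pos] asks for. *)
Lemma local_frame (p : M) : exists (theta : Cinf M) (F : 'I_n -> vfield M)
    (a : 'I_n -> vfield M -> Cinf M),
  [/\ theta p != 0, forall k, scalar (a k),
      forall X, theta *: X = \sum_k a k X *: F k,
      forall k l, a k (F l) = theta * (k == l)%:R
    & forall k X q, a k X q != 0 -> exists f, X f q != 0].
Proof.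
have [i cp] := atlas_cover p.
have [chi [A [r [[cA AB BU] [schi chi0 chip]]]]] :=
  bump (chart_cod_open (atlas i)) (chart_map_sub cp).
exists (chi_hat cA AB BU schi chi0 ^+ 3), (frame_field cA AB BU schi chi0),
  (frame_coord cA AB BU schi chi0); split.
- rewrite !exprS expr0 !CinfE cutoff_in // !mulr1.
  by rewrite !mulf_neq0.
- exact: frame_coord_scalar.
- exact: frame_expand.
- exact: frame_coord_field.
- exact: frame_coord_neq0.
Qed.

End LocalFrame.

(** * Riesz representation for the metric *)

Section PositiveDefinite.
Variables (R : rcfType) (n : nat) (G : 'M[R]_n).
Hypothesis symG : G^T = G.
Hypothesis posG : forall v : 'rV[R]_n, v != 0 -> 0 < (v *m G *m v^T) 0 0.

Lemma posdef_det : \det G != 0.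
Proof.
apply/negP => /det0P [v v0 vG]; have := posG v0.
by rewrite vG mul0mx mxE ltxx.
Qed.

(** The next vector is any nonzero one in the left kernel of [G *m A^T], which exists because this n
    by k matrix has rank at most k < n; only its length has to be normalized. *)
Lemma gram_schmidt k : (k <= n)%N -> exists A : 'M[R]_(k, n),
  A *m G *m A^T = 1%:M.
Proof.
elim: k => [ |k IH] kn; first by exists 0; apply/matrixP => -[].
have [A AG] := IH (ltnW kn).
have : kermx (G *m A^T) != 0.
  rewrite -mxrank_eq0 mxrank_ker subn_eq0 -ltnNge.
  exact: leq_ltn_trans (rank_leq_col _) kn.
move=> /rowV0Pn [v /sub_kermxP vK v0]; rewrite mulmxA in vK.
have vG := posG v0; set s := Num.sqrt ((v *m G *m v^T) 0 0).
have s0 : 0 < s by rewrite sqrtr_gt0.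
pose w := s^-1 *: v.
have ww : w *m G *m w^T = 1%:M.
  have -> : w^T = s^-1 *: v^T by apply/matrixP => i j; rewrite !mxE.
  rewrite /w -!scalemxAl -scalemxAr scalerA -expr2.
  rewrite [v *m G *m v^T]mx11_scalar scale_scalar_mx; congr (_%:M).
  by rewrite -(sqr_sqrtr (ltW vG)) -/s -exprMn mulVf ?expr1n // gt_eqF.
have wA : w *m G *m A^T = 0 by rewrite /w -!scalemxAl vK scaler0.
have Aw : A *m G *m w^T = 0.
  by apply: trmx_inj; rewrite !trmx_mul trmxK symG mulmxA wA trmx0.
have BG : (col_mx w A : 'M[R]_(1 + k, n)) *m G *m (col_mx w A)^T = 1%:M.
  by rewrite tr_col_mx mul_col_mx mul_col_row ww wA AG Aw -scalar_mx_block.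
by exists (col_mx w A).
Qed.

End PositiveDefinite.

Lemma scalar_bundle (A : pzRingType) (V : lmodType A) (al : V -> A) :
  scalar al -> exists al' : {scalar V}, al = al'.
Proof.
move=> als; pose am := GRing.isLinear.Build A V A *%R al als.
by exists (HB.pack al am : {scalar V}).
Qed.

Section Metric.
Variables (R : realType) (n : nat) (M : manifold R n) (g : metric M).
Implicit Types (X Y Z V : vfield M) (f : Cinf M) (p q : M).

Lemma metricDl X Y Z : g (X + Y) Z = g X Z + g Y Z.
Proof. by have := metric_linear g Z 1 X Y; rewrite scale1r /= mul1r. Qed.

Lemma metricZl f X Z : g (f *: X) Z = f * g X Z.
Proof.
have g0 : g 0 Z = 0.
  have := metricDl 0 0 Z; rewrite addr0 => /eqP.
  by rewrite -subr_eq subrr => /eqP.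
by have := metric_linear g Z f X 0; rewrite addr0 g0 addr0.
Qed.

Lemma metric0l Z : g 0 Z = 0.
Proof. by rewrite -(scale0r 0) metricZl mul0r. Qed.

Lemma metricNl X Z : g (- X) Z = - g X Z.
Proof. by rewrite -scaleN1r metricZl mulN1r. Qed.

Lemma metricDr X Y Z : g X (Y + Z) = g X Y + g X Z.
Proof. by rewrite Defs.metric_sym metricDl !(Defs.metric_sym g X). Qed.

Lemma metricZr f X Z : g X (f *: Z) = f * g X Z.
Proof. by rewrite Defs.metric_sym metricZl (Defs.metric_sym g X). Qed.

Lemma metric0r Z : g Z 0 = 0.
Proof. by rewrite Defs.metric_sym metric0l. Qed.

Lemma metricNr X Z : g X (- Z) = - g X Z.
Proof. by rewrite Defs.metric_sym metricNl (Defs.metric_sym g X). Qed.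

Lemma metric_suml (I : Type) (r : seq I) (P : pred I) (X : I -> vfield M) Z :
  g (\sum_(i <- r | P i) X i) Z = \sum_(i <- r | P i) g (X i) Z.
Proof.
by apply: (big_morph (fun X => g X Z)) => [x y| ]; rewrite ?metricDl ?metric0l.
Qed.

Lemma metric_sumr (I : Type) (r : seq I) (P : pred I) (X : I -> vfield M) Z :
  g Z (\sum_(i <- r | P i) X i) = \sum_(i <- r | P i) g Z (X i).
Proof.
by rewrite Defs.metric_sym metric_suml; apply: eq_bigr => i _; rewrite Defs.metric_sym.
Qed.

Lemma metric_definite X : (forall q, g X X q = 0) -> X = 0.
Proof.
move=> X0; apply: vfieldP => f; apply: CinfP => q; rewrite vfield0E Cinf0.
apply/eqP; apply: contraT => Xf; have := @metric_pos _ _ _ g X q.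
by rewrite X0 ltxx => /(_ (ex_intro _ f Xf)).
Qed.

Lemma metric_inj X Y : (forall V, g X V = g Y V) -> X = Y.
Proof.
move=> XY; apply/eqP; rewrite -subr_eq0; apply/eqP/metric_definite => q.
by rewrite metricDl metricNl XY subrr.
Qed.

Section Frame.
Variables (theta : Cinf M) (F : 'I_n -> vfield M)
  (a : 'I_n -> vfield M -> Cinf M).
Hypotheses (a_scalar : forall k, scalar (a k))
  (a_expand : forall X, theta *: X = \sum_k a k X *: F k)
  (a_dual : forall k l, a k (F l) = theta * (k == l)%:R)
  (a_neq0 : forall k X q, a k X q != 0 -> exists f, X f q != 0).

Lemma a_comb k (v : 'I_n -> Cinf M) : a k (\sum_i v i *: F i) = v k * theta.
Proof.
have [a' aE] := scalar_bundle (a_scalar k).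
rewrite aE linear_sum (bigD1 k) //= big1 => [ |i ik]; rewrite linearZ /= -aE a_dual.
  by rewrite eqxx mulr1 addr0.
by rewrite eq_sym (negbTE ik) !mulr0.
Qed.

Definition gram q : 'M[R]_n := \matrix_(i, j) g (F i) (F j) q.

Lemma gram_sym q : (gram q)^T = gram q.
Proof. by apply/matrixP => i j; rewrite !mxE Defs.metric_sym. Qed.

Lemma metric_comb (v w : 'rV[R]_n) q :
  g (\sum_i cstf M (v 0 i) *: F i) (\sum_i cstf M (w 0 i) *: F i) q =
  (v *m gram q *m w^T) 0 0.
Proof.
rewrite metric_suml Cinf_sum !mxE; under [RHS]eq_bigr => j _.
  rewrite !mxE mulr_suml; under eq_bigr => i _ do rewrite !mxE.
  over.
rewrite exchange_big; apply: eq_bigr => i _ /=.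
rewrite metricZl metric_sumr CinfM mulrC Cinf_sum mulr_suml.
apply: eq_bigr => j _; rewrite metricZr !CinfE.
by ring.
Qed.

Lemma gram_pos q (v : 'rV[R]_n) : theta q != 0 -> v != 0 ->
  0 < (v *m gram q *m v^T) 0 0.
Proof.
move=> tq /rV0Pn [k vk]; rewrite -metric_comb; apply: metric_pos.
apply: (a_neq0 (k := k)); rewrite a_comb !CinfE.
exact: mulf_neq0.
Qed.

Definition coords p X : 'rV[R]_n := \row_k (a k X p / theta p).

Lemma metric_coords p X Y : theta p != 0 ->
  g X Y p = (coords p X *m gram p *m (coords p Y)^T) 0 0.
Proof.
move=> tp; have := congr1 (fun f => f p) (erefl (g (theta *: X) (theta *: Y))).
rewrite {1}metricZl metricZr !CinfE [in RHS]a_expand [in RHS]a_expand.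
move=> H.
have {}H : g X Y p = theta p ^- 2 *
    g (\sum_k a k X *: F k) (\sum_k a k Y *: F k) p.
  by rewrite -H; field.
rewrite H metric_suml Cinf_sum -metric_comb metric_suml Cinf_sum mulr_sumr.
apply: eq_bigr => i _; rewrite !metricZl !metric_sumr !CinfE !mulr_sumr.
apply: eq_bigr => j _; rewrite !metricZr !CinfE !mxE.
by field.
Qed.

End Frame.

(** Orthonormality is required at [p] alone, so constant combinations of a local frame suffice. *)
Lemma orthonormal_exists p : exists e : 'I_n -> vfield M,
  forall i j, g (e i) (e j) p = (i == j)%:R.
Proof.
have [theta [F [a [tp as_ ae ad an]]]] := local_frame p.
have [A AG] := gram_schmidt (gram_sym F p)
  (fun v => gram_pos as_ ad an tp (v := v)) (leqnn n).
exists (fun i => \sum_j cstf M (row i A 0 j) *: F j) => i j.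
rewrite metric_comb -row_mul tr_row -row_mul.
have := congr1 (fun B : 'M[R]_n => B i j) AG; rewrite !mxE => <-.
by apply: eq_bigr => k _; rewrite !mxE.
Qed.

Lemma orthonormal_expand p (e : 'I_n -> vfield M) X Y :
  (forall i j, g (e i) (e j) p = (i == j)%:R) ->
  g X Y p = \sum_i g X (e i) p * g Y (e i) p.
Proof.
move=> eo; have [theta [F [a [tp as_ ae ad an]]]] := local_frame p.
pose A := \matrix_(i < n) coords theta a p (e i).
pose G := gram F p.
have gE U V : g U V p = (coords theta a p U *m G *m (coords theta a p V)^T) 0 0.
  exact: metric_coords.
have AGA : A *m (G *m A^T) = 1%:M.
  apply/matrixP => i j; rewrite [RHS]mxE -eo gE mulmxA.
  rewrite !mxE; apply: eq_bigr => k _; rewrite !mxE; congr (_ * _).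
  by apply: eq_bigr => l _; rewrite !mxE.
(* A one-sided inverse of a square matrix is two-sided: n orthonormal vectors are complete. *)
have GAA := mulmx1C AGA.
transitivity ((coords theta a p X *m (G *m A^T) *m
    (coords theta a p Y *m (G *m A^T))^T) 0 0).
  rewrite !trmx_mul trmxK gram_sym -/G -(mulmxA A) mulmxA.
  by rewrite -(mulmxA (coords _ _ _ X)) GAA mulmx1 mulmxA gE.
rewrite mxE; apply: eq_bigr => i _.
have cE U : (coords theta a p U *m (G *m A^T)) 0 i = g U (e i) p.
  rewrite gE mulmxA !mxE; apply: eq_bigr => k _; rewrite !mxE; congr (_ * _).
by rewrite [X in _ * X]mxE !cE.
Qed.

Lemma metric_ge0 X p : 0 <= g X X p.
Proof.
have [e eo] := orthonormal_exists p.
by rewrite (orthonormal_expand X X eo) sumr_ge0 // => i _; rewrite -expr2 sqr_ge0.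
Qed.

Section Riesz.
Variable alpha : {scalar vfield M}.

(** Cramer's rule: the adjugate of the Gram matrix replaces its inverse, and the denominator
    [theta * \det G] is kept as [d]. *)
Lemma local_riesz p : exists (d : Cinf M) (Z : vfield M), d p != 0 /\
  forall V, g Z V = d * alpha V.
Proof.
have [theta [F [a [tp as_ ae ad an]]]] := local_frame p.
pose G : 'M[Cinf M]_n := \matrix_(i, j) g (F i) (F j).
pose Z := \sum_i \sum_j (\adj G i j * alpha (F j)) *: F i.
have ZF k : g Z (F k) = \det G * alpha (F k).
  rewrite /Z metric_suml; under eq_bigr => i _ do rewrite metric_suml.
  rewrite exchange_big /=.
  transitivity (\sum_j (\det G)%:M k j * alpha (F j)).
    apply: eq_bigr => j _; rewrite -mul_mx_adj mxE mulr_suml.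
    by apply: eq_bigr => i _; rewrite metricZl !mxE Defs.metric_sym; ring.
  rewrite (bigD1 k) //= big1 ?addr0 ?mxE ?eqxx //.
  by move=> i ik; rewrite mxE eq_sym (negbTE ik) mul0r.
exists (theta * \det G), (theta *: Z); split.
  rewrite CinfE mulf_neq0 //.
  suff -> : \det G p = \det (gram F p).
    exact: posdef_det (fun v => gram_pos as_ ad an tp (v := v)).
  rewrite /determinant Cinf_sum; apply: eq_bigr => s _.
  have sgn (b : bool) : ((-1) ^+ b : Cinf M) p = (-1) ^+ b by case: b.
  rewrite CinfM sgn.
  congr (_ * _); apply: (big_ind2 (fun (f : Cinf M) (x : R) => f p = x)) => //.
    by move=> f x h y <- <-.
  by move=> i _; rewrite !mxE.
move=> V; have thV : theta * alpha V = \sum_k a k V * alpha (F k).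
  have -> : theta * alpha V = alpha (theta *: V) by rewrite linearZ.
  by rewrite ae linear_sum; apply: eq_bigr => k _; rewrite linearZ.
rewrite metricZl -metricZr ae metric_sumr [_ * \det G]mulrC -mulrA thV mulr_sumr.
by apply: eq_bigr => k _; rewrite metricZr ZF mulrCA.
Qed.

Lemma riesz : exists Z, forall V, g Z V = alpha V.
Proof.
have [d H] := choice local_riesz; have [Z dZ] := choice H.
have dp p : d p p != 0 by have [] := dZ p.
have gZ p V : g (Z p) V = d p * alpha V by have [_] := dZ p; exact.
(* Both sides represent the form [d p * d q * alpha]. *)
have dZE p q : d q *: Z p = d p *: Z q.
  by apply: metric_inj => V; rewrite !metricZl !gZ; ring.
have key f p q : d p q * (Z q f q / d q q) = Z p f q.
  have := congr1 (fun X : vfield M => X f q) (dZE p q).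
  rewrite !vfieldZE !CinfE => H'.
  by rewrite mulrA -H' mulrC mulKf.
(* The value at [q] uses the local solution chosen for [q]; by [key] it agrees near any [p] with the
   quotient of the solution chosen for [p], and is therefore smooth. *)
have sm f : (fun q => Z q f q / d q q) \in @smooth_pred R n M.
  by apply: smooth_of_quotients => p; exists (d p), (Z p f).
pose W f := MkCinf (sm f).
have WE f q : W f q = Z q f q / d q q by [].
have WD : derivation W.
  split=> [f h|c f|f h]; apply: CinfP => q; rewrite !(WE, CinfE).
  - by rewrite vfield_apD CinfE mulrDl.
  - by rewrite vfield_apZ !CinfE mulrA.
  - by rewrite vfield_apM !CinfE; ring.
exists (VField WD) => V; apply: CinfP => p.
apply: (mulfI (dp p)); rewrite -!CinfM -gZ -metricZl; congr (g _ V p).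
by apply: vfieldP => f; apply: CinfP => q; rewrite vfieldZE CinfE /= key.
Qed.

Lemma sharpP V : g (sharp g alpha) V = alpha V.
Proof.
rewrite /sharp /the; case: pselect => [ex|[]]; last exact: riesz.
by case: cid.
Qed.

End Riesz.

Lemma sharp_scalar (al : vfield M -> Cinf M) : scalar al ->
  forall V, g (sharp g al) V = al V.
Proof.
by move=> /scalar_bundle [al' ->]; exact: sharpP.
Qed.

End Metric.

(** * Metric contact structures *)

Section ContactBasics.
Variables (R : realType) (m : nat) (M : manifold R m.*2.+1).
Variable K : metric_contact M.
Local Notation VF := (vfield M).
Local Notation C := (Cinf M).
Local Notation g := (cg K).
Local Notation eta := (ceta K).
Local Notation J := (cJ K).
Local Notation xi := (Reeb K).
Local Notation P := (hproj K).
Implicit Types (X Y Z V W : VF) (f : C).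

Lemma extd_skew X Y : extd eta X Y = - extd eta Y X.
Proof. by rewrite /extd (bracket_skew X) linearN; ring. Qed.

Lemma Reeb_dual V : g xi V = eta V.
Proof. exact: sharpP. Qed.

Lemma eta_Reeb : eta xi = 1.
Proof. by rewrite -Reeb_dual; exact: contact_norm. Qed.

Lemma J_skew X Y : g (J X) Y = - g X (J Y).
Proof.
by rewrite -(contact_extd K) extd_skew (contact_extd K) Defs.metric_sym.
Qed.

Lemma J_skewr X Y : g X (J Y) = - g (J X) Y.
Proof. by rewrite J_skew opprK. Qed.

Lemma JJ X : J (J X) = - P X.
Proof. by rewrite (contact_J K) /hproj opprB addrC. Qed.

(** The square of J sends the Reeb field to -xi + xi = 0, and J is skew, so the norm of J xi
    vanishes. *)
Lemma J_Reeb : J xi = 0.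
Proof.
apply: (@metric_definite _ _ _ g) => q.
rewrite J_skew (contact_J K) -/xi eta_Reeb scale1r addNr metric0r.
by rewrite oppr0.
Qed.

Lemma eta_J X : eta (J X) = 0.
Proof. by rewrite -Reeb_dual J_skewr J_Reeb metric0l oppr0. Qed.

Lemma hproj_is_linear : linear P.
Proof.
by move=> a X Y; rewrite /hproj linearP; apply: vfieldP => f;
  rewrite !(vfieldDE, vfieldNE, vfieldZE) /=; ring.
Qed.

HB.instance Definition _ :=
  GRing.isLinear.Build (Cinf M) VF VF *:%R P hproj_is_linear.

Lemma eta_hproj X : eta (P X) = 0.
Proof. by rewrite /hproj linearB linearZ /= eta_Reeb mulr1 subrr. Qed.

Lemma hproj_id X : eta X = 0 -> P X = X.
Proof. by rewrite /hproj => ->; rewrite scale0r subr0. Qed.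

Lemma hproj_Reeb : P xi = 0.
Proof. by rewrite /hproj eta_Reeb scale1r subrr. Qed.

Lemma hproj_J X : P (J X) = J X.
Proof. by rewrite hproj_id // eta_J. Qed.

Lemma J_hproj X : J (P X) = J X.
Proof. by rewrite /hproj linearB linearZ /= J_Reeb scaler0 subr0. Qed.

Lemma hproj_hproj X : P (P X) = P X.
Proof. by rewrite hproj_id // eta_hproj. Qed.

Lemma hproj_split X : X = P X + eta X *: xi.
Proof. by rewrite /hproj subrK. Qed.

Lemma metric_hproj X Y : g (P X) Y = g X (P Y).
Proof.
rewrite /hproj !(metricDl, metricDr, metricNl, metricNr, metricZl, metricZr).
by rewrite (Defs.metric_sym g X xi) !Reeb_dual mulrC.
Qed.

Lemma metric_eta X : g X xi = eta X.
Proof. by rewrite Defs.metric_sym Reeb_dual. Qed.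

Lemma metricJJ X Y : g (J X) (J Y) = g X (P Y).
Proof. by rewrite J_skew JJ metricNr opprK. Qed.

Definition gE := (@metricDl R _ M g, @metricDr R _ M g, @metricNl R _ M g,
  @metricNr R _ M g, @metricZl R _ M g, @metricZr R _ M g,
  @metric0l R _ M g, @metric0r R _ M g).

Definition twoform (T : VF -> VF -> VF) : Prop :=
  (forall Y, linear (T^~ Y)) /\ (forall X Y, T X Y = - T Y X).

Section TwoForm.
Variable T : VF -> VF -> VF.
Hypothesis hT : twoform T.

Lemma twoformDl X X' Y : T (X + X') Y = T X Y + T X' Y.
Proof. by have := hT.1 Y 1 X X'; rewrite !scale1r. Qed.
Lemma twoform0l Y : T 0 Y = 0.
Proof.
by have := twoformDl 0 0 Y; rewrite addr0 => /eqP; rewrite -subr_eq subrr => /eqP.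
Qed.
Lemma twoformZl f X Y : T (f *: X) Y = f *: T X Y.
Proof. by have := hT.1 Y f X 0; rewrite twoform0l !addr0. Qed.
Lemma twoformNl X Y : T (- X) Y = - T X Y.
Proof. by rewrite -scaleN1r twoformZl scaleN1r. Qed.
Lemma twoformDr X Y Y' : T X (Y + Y') = T X Y + T X Y'.
Proof. by rewrite hT.2 twoformDl opprD -!hT.2. Qed.
Lemma twoformZr f X Y : T X (f *: Y) = f *: T X Y.
Proof. by rewrite hT.2 twoformZl -scalerN -hT.2. Qed.
Lemma twoformNr X Y : T X (- Y) = - T X Y.
Proof. by rewrite hT.2 twoformNl -hT.2. Qed.
Lemma twoform_diag X : T X X = 0.
Proof.
have H : T X X + T X X = 0 by rewrite {1}hT.2 addNr.
apply: vfieldP => f; apply: CinfP => q.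
have := congr1 (fun Z : VF => Z f q) H; rewrite !(vfieldDE, vfield0E, CinfE).
by lra.
Qed.
End TwoForm.

Lemma Omega2_CC_twoform B : Omega2_CC K B -> twoform B.
Proof. by case. Qed.

Lemma twoform_torsion nabla : connection nabla -> twoform (torsion nabla).
Proof.
move=> [n1 n2 n3]; split=> [Y a X X'|X Y]; rewrite /torsion.
  rewrite n1 n2 n3.
  have -> : [| a *: X + X', Y |] = a *: [| X, Y |] + [| X', Y |] - Y a *: X.
    by apply: vfieldP => f; rewrite /= vfield_apD vfield_apM; ring.
  by apply: (@metric_inj _ _ _ g) => V; rewrite !gE; ring.
rewrite (bracket_skew X).
by apply: (@metric_inj _ _ _ g) => V; rewrite !gE; ring.
Qed.

End ContactBasics.

(** * Types of three-forms *)

Section ThreeForms.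
Variables (R : realType) (m : nat) (M : manifold R m.*2.+1).
Variable K : metric_contact M.
Local Notation VF := (vfield M).
Local Notation C := (Cinf M).
Local Notation g := (cg K).
Local Notation eta := (ceta K).
Local Notation J := (cJ K).
Local Notation xi := (Reeb K).
Local Notation P := (hproj K).
Local Notation form3 := (VF -> VF -> VF -> C).
Implicit Types (X Y Z V W : VF) (f : C).

Section Rules.
Variable w : form3.
Hypothesis hw : Omega3_C K w.

Lemma form3_12 X Y Z : w X Y Z = - w Y X Z. Proof. by case: hw. Qed.
Lemma form3_23 X Y Z : w X Y Z = - w X Z Y. Proof. by case: hw. Qed.
Lemma form3_rot X Y Z : w X Y Z = w Y Z X.
Proof. by rewrite form3_12 form3_23 opprK. Qed.

Lemma form3_D1 X X' Y Z : w (X + X') Y Z = w X Y Z + w X' Y Z.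
Proof. by case: hw => /(_ Y Z 1 X X'); rewrite scale1r /= mul1r. Qed.
Lemma form3_01 Y Z : w 0 Y Z = 0.
Proof.
by have := form3_D1 0 0 Y Z; rewrite addr0 => /eqP; rewrite -subr_eq subrr => /eqP.
Qed.
Lemma form3_Z1 f X Y Z : w (f *: X) Y Z = f * w X Y Z.
Proof. by case: hw => /(_ Y Z f X 0); rewrite form3_01 !addr0. Qed.
Lemma form3_N1 X Y Z : w (- X) Y Z = - w X Y Z.
Proof. by rewrite -scaleN1r form3_Z1 mulN1r. Qed.
Lemma form3_D2 X X' Y Z : w Y (X + X') Z = w Y X Z + w Y X' Z.
Proof. by rewrite form3_12 form3_D1 opprD -!(form3_12 Y). Qed.
Lemma form3_Z2 f X Y Z : w Y (f *: X) Z = f * w Y X Z.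
Proof. by rewrite form3_12 form3_Z1 -mulrN -form3_12. Qed.
Lemma form3_N2 X Y Z : w Y (- X) Z = - w Y X Z.
Proof. by rewrite -scaleN1r form3_Z2 mulN1r. Qed.
Lemma form3_D3 X X' Y Z : w Y Z (X + X') = w Y Z X + w Y Z X'.
Proof. by rewrite form3_23 form3_D2 opprD -!(form3_23 Y Z). Qed.
Lemma form3_Z3 f X Y Z : w Y Z (f *: X) = f * w Y Z X.
Proof. by rewrite form3_23 form3_Z2 -mulrN -form3_23. Qed.
Lemma form3_N3 X Y Z : w Y Z (- X) = - w Y Z X.
Proof. by rewrite -scaleN1r form3_Z3 mulN1r. Qed.

Lemma form3_xi1 Y Z : w xi Y Z = 0. Proof. by case: hw. Qed.
Lemma form3_xi2 Y Z : w Y xi Z = 0. Proof. by rewrite form3_12 form3_xi1 oppr0. Qed.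

Lemma form3_P1 X Y Z : w (P X) Y Z = w X Y Z.
Proof. by rewrite /hproj form3_D1 form3_N1 form3_Z1 form3_xi1 mulr0 subr0. Qed.
Lemma form3_P2 X Y Z : w X (P Y) Z = w X Y Z.
Proof. by rewrite form3_12 form3_P1 -form3_12. Qed.
Lemma form3_P3 X Y Z : w X Y (P Z) = w X Y Z.
Proof. by rewrite form3_23 form3_P2 -form3_23. Qed.

Lemma form3_JJ1 X Y Z : w (J (J X)) Y Z = - w X Y Z.
Proof. by rewrite JJ form3_N1 form3_P1. Qed.
Lemma form3_JJ2 X Y Z : w X (J (J Y)) Z = - w X Y Z.
Proof. by rewrite JJ form3_N2 form3_P2. Qed.
Lemma form3_JJ3 X Y Z : w X Y (J (J Z)) = - w X Y Z.
Proof. by rewrite JJ form3_N3 form3_P3. Qed.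

Definition form3E := (form3_D1, form3_D2, form3_D3, form3_Z1, form3_Z2, form3_Z3,
  form3_N1, form3_N2, form3_N3).
Definition form3J := (form3_N1, form3_N2, form3_N3, form3_P1, form3_P2, form3_P3,
  form3_JJ1, form3_JJ2, form3_JJ3).
End Rules.

(* On [C] one has [S w = w] for types (2,1) and (1,2) and [S w = - 3 w] for types
   (3,0) and (0,3). *)
Definition Sop (w : form3) X Y Z : C :=
  w X (J Y) (J Z) + w (J X) Y (J Z) + w (J X) (J Y) Z.
Definition Dop (w : form3) X Y Z : C := w (J X) Y Z + w X (J Y) Z + w X Y (J Z).
Definition Top (w : form3) X Y Z : C := w (J X) (J Y) (J Z).

Definition comb3 (a b : C) (w w' : form3) X Y Z : C :=
  a * w X Y Z + b * w' X Y Z.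

Lemma Omega3_comb a b w w' : Omega3_C K w -> Omega3_C K w' ->
  Omega3_C K (comb3 a b w w').
Proof.
move=> hw hw'; split=> [Y Z f X X'|X Y Z|X Y Z|Y Z]; rewrite /comb3 /=.
- by rewrite !(form3E hw) !(form3E hw'); ring.
- by rewrite (form3_12 hw X) (form3_12 hw' X); ring.
- by rewrite (form3_23 hw X) (form3_23 hw' X); ring.
- by rewrite (form3_xi1 hw) (form3_xi1 hw'); ring.
Qed.

Lemma Omega3_S w : Omega3_C K w -> Omega3_C K (Sop w).
Proof.
move=> hw; split=> [Y Z f X X'|X Y Z|X Y Z|Y Z]; rewrite /Sop /=.
- by rewrite !linearP /= !(form3E hw); ring.
- by rewrite !(form3_12 hw X) !(form3_12 hw (J X)); ring.
- by rewrite !(form3_23 hw _ Y) !(form3_23 hw _ (J Y)); ring.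
- by rewrite J_Reeb !(form3_xi1 hw, form3_01 hw) !addr0.
Qed.

Lemma Omega3_D w : Omega3_C K w -> Omega3_C K (Dop w).
Proof.
move=> hw; split=> [Y Z f X X'|X Y Z|X Y Z|Y Z]; rewrite /Dop /=.
- by rewrite !linearP /= !(form3E hw); ring.
- by rewrite !(form3_12 hw X) !(form3_12 hw (J X)); ring.
- by rewrite !(form3_23 hw _ Y) !(form3_23 hw _ (J Y)); ring.
- by rewrite J_Reeb !(form3_xi1 hw, form3_01 hw) !addr0.
Qed.

Lemma Omega3_T w : Omega3_C K w -> Omega3_C K (Top w).
Proof.
move=> hw; split=> [Y Z f X X'|X Y Z|X Y Z|Y Z]; rewrite /Top /=.
- by rewrite !linearP /= !(form3E hw); ring.
- by rewrite !(form3_12 hw (J X)); ring.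
- by rewrite !(form3_23 hw _ (J Y)); ring.
- by rewrite J_Reeb !(form3_xi1 hw, form3_01 hw).
Qed.

(* The type (p, 3 - p) part, obtained by expanding the projections
   [X |-> (X -+ i J X) / 2] onto the eigenspaces of [J]. *)
Definition type_part (p : nat) (w : form3) X Y Z : C * C :=
  let e := cstf M (1 / 8) in
  match p with
  | 3 => (comb3 e (- e) w (Sop w) X Y Z, comb3 (- e) e (Dop w) (Top w) X Y Z)
  | 2 => (comb3 (e * 3) e w (Sop w) X Y Z, comb3 (- e) (- e * 3) (Dop w) (Top w) X Y Z)
  | 1 => (comb3 (e * 3) e w (Sop w) X Y Z, comb3 e (e * 3) (Dop w) (Top w) X Y Z)
  | _ => (comb3 e (- e) w (Sop w) X Y Z, comb3 e (- e) (Dop w) (Top w) X Y Z)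
  end.

Lemma ctypeP b (Z : VF * VF) : ctype K b Z ->
  exists U, Z = (U, if b then - J U else J U).
Proof.
case: Z => U V [/= _ _]; case: b => -[H _]; exists U; first by rewrite H opprK.
by rewrite H.
Qed.

(** The projection (3 + S) / 4 onto the eigenvalue 1 of [Sop], whose other eigenvalue is -3. *)
Definition plus_formula (w : form3) : form3 :=
  comb3 (cstf M (3 / 4)) (cstf M (1 / 4)) w (Sop w).

Lemma type_part_pq p w : (p <= 3)%N -> Omega3_C K w ->
  pq_type K p (type_part p w).
Proof.
move=> p3 hw.
have hS := Omega3_S hw; have hD := Omega3_D hw; have hT := Omega3_T hw.
split.
- by case: p p3 => [ | [ |[ | [ | ]]]] //= _; exact: Omega3_comb.
- by case: p p3 => [ | [ |[ | [ | ]]]] //= _; exact: Omega3_comb.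
move=> b1 b2 b3 Z1 Z2 Z3 /ctypeP [U1 ->] /ctypeP [U2 ->] /ctypeP [U3 ->].
(* Beyond this point only the additivity of J and the rule J^2 = -1 in each slot matter: what
   remains is a finite check over the sign patterns. *)
have [j jE] : exists j : VF -> VF, forall X, J X = j X by exists J.
have jN X : j (- X) = - j X by rewrite -!jE linearN.
have J1 X Y Z : w (j (j X)) Y Z = - w X Y Z by rewrite -!jE (form3_JJ1 hw).
have J2 X Y Z : w X (j (j Y)) Z = - w X Y Z by rewrite -!jE (form3_JJ2 hw).
have J3 X Y Z : w X Y (j (j Z)) = - w X Y Z by rewrite -!jE (form3_JJ3 hw).
have N1 := form3_N1 hw; have N2 := form3_N2 hw; have N3 := form3_N3 hw.
case: p p3 => [ | [ |[ | [ | ]]]] //= _; move: (cstf M (1 / 8)) => e;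
  rewrite /cform_eval /cext /= /comb3 /Sop /Dop /Top !jE;
  clear -jN J1 J2 J3 N1 N2 N3; case: b1; case: b2; case: b3 => //= _;
  rewrite ?jN !(N1, N2, N3, J1, J2, J3) ?jN ?(N1, N2, N3, J1, J2, J3);
  by congr pair; ring.
Qed.

Lemma is_plus_part_formula w : Omega3_C K w -> is_plus_part K w (plus_formula w).
Proof.
move=> hw; exists (type_part 3 w), (type_part 2 w), (type_part 1 w), (type_part 0 w).
split; first by split; exact: type_part_pq.
(* All constants become multiples of 1/8, treated as an unknown [e]; the relation 8 e = 1 is used
   only where the four types must add up to w. *)
have c8 : cstf M (1 / 8) *+ 8 = 1.
  by apply: CinfP => q; rewrite !mulrS !CinfE mulr0n; field.
have {}c8 (x : C) : x = cstf M (1 / 8) *+ 8 * x by rewrite c8 mul1r.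
have c3 : cstf M (3 / 4) = cstf M (1 / 8) *+ 6.
  by apply: CinfP => q; rewrite !mulrS !CinfE mulr0n; field.
have c1 : cstf M (1 / 4) = cstf M (1 / 8) *+ 2.
  by apply: CinfP => q; rewrite !mulrS !CinfE mulr0n; field.
move=> X Y Z; split; rewrite /= /plus_formula /comb3 ?c3 ?c1; congr pair => /=;
  move: (cstf M (1 / 8)) c8 {c3 c1} => e c8.
- by transitivity (e *+ 8 * w X Y Z); [exact: c8|ring].
- by ring.
- by ring.
- by ring.
Qed.

Lemma ctype_of b X : ctype K b (P X, if b then - J X else J X).
Proof.
by case: b; split; rewrite /horizontal /= ?eta_hproj ?linearN ?eta_J ?oppr0 //;
  rewrite J_hproj ?JJ ?opprK.
Qed.

(** The real part of the vanishing of [a] on eigenvectors P X + i s J X, with s = -1 for type (1,0).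
    Adding such relations over several sign patterns isolates the even part in J. *)
Lemma pq_type_vanish p a (b1 b2 b3 : bool) X Y Z :
  pq_type K p a -> (b1 + b2 + b3 != p)%N ->
  let s (b : bool) : C := if b then -1 else 1 in
  let u X Y Z := (a X Y Z).1 in let v X Y Z := (a X Y Z).2 in
  u X Y Z - s b2 * s b3 * u X (J Y) (J Z) - s b1 * s b3 * u (J X) Y (J Z)
    - s b1 * s b2 * u (J X) (J Y) Z
  = s b1 * v (J X) Y Z + s b2 * v X (J Y) Z + s b3 * v X Y (J Z)
    - s b1 * s b2 * s b3 * v (J X) (J Y) (J Z).
Proof.
case=> hu hv H bp s u v; apply/eqP; rewrite -subr_eq0; apply/eqP.
have := congr1 fst (H _ _ _ _ _ _ (ctype_of b1 X) (ctype_of b2 Y) (ctype_of b3 Z) bp).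
rewrite /cform_eval /cext /= -/(u _ _ _) => <-; rewrite /u /v.
have sJ b V : (if b then - J V else J V) = s b *: J V.
  by case: b; rewrite /s ?scale1r ?scaleN1r.
rewrite !sJ !(form3_Z1 hu, form3_Z2 hu, form3_Z3 hu)
  !(form3_P1 hu, form3_P2 hu, form3_P3 hu).
by rewrite !(form3_Z1 hv, form3_Z2 hv, form3_Z3 hv)
  !(form3_P1 hv, form3_P2 hv, form3_P3 hv); ring.
Qed.

(** The all-plus and all-minus patterns are both excluded. Their terms with an odd number of J are
    opposite and cancel in the sum. *)
Lemma pq_type_S12 p a X Y Z : pq_type K p a -> (p == 1)%N || (p == 2)%N ->
  Sop (fun X Y Z => (a X Y Z).1) X Y Z = (a X Y Z).1.
Proof.
move=> ha p12; apply: CinfP => q.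
have pt : (true + true + true != p)%N by case/orP: p12 => /eqP ->.
have pf : (false + false + false != p)%N by case/orP: p12 => /eqP ->.
have /(congr1 (fun f : C => f q)) := pq_type_vanish X Y Z ha pt.
have /(congr1 (fun f : C => f q)) := pq_type_vanish X Y Z ha pf.
by rewrite /Sop !CinfE; lra.
Qed.

(** The six mixed patterns are excluded. In the sum of their relations the odd terms cancel and each
    product of two signs adds up to -2, which leaves 6 u + 2 S u = 0. *)
Lemma pq_type_S03 p a X Y Z : pq_type K p a -> (p == 0)%N || (p == 3)%N ->
  Sop (fun X Y Z => (a X Y Z).1) X Y Z = - (cstf M 3 * (a X Y Z).1).
Proof.
move=> ha p03; apply: CinfP => q.
have H (b1 b2 b3 : bool) : (b1 + b2 + b3 != p)%N -> _ :=
  fun h => congr1 (fun f : C => f q) (@pq_type_vanish p a b1 b2 b3 X Y Z ha h).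
have pE (k : nat) : (k == 1)%N || (k == 2)%N -> k != p.
  by case/orP: p03 => /eqP ->; case/orP => /eqP ->.
have := H true true false (pE 2 isT); have := H true false true (pE 2 isT).
have := H false true true (pE 2 isT); have := H true false false (pE 1 isT).
have := H false true false (pE 1 isT); have := H false false true (pE 1 isT).
rewrite /Sop !CinfE.
lra.
Qed.

Lemma plus_formula_unique w wp : is_plus_part K w wp ->
  forall X Y Z, wp X Y Z = plus_formula w X Y Z.
Proof.
move=> [a3 [a2 [a1 [a0 [[h3 h2 h1 h0] H]]]]] X Y Z.
have wE X' Y' Z' : w X' Y' Z' = (a3 X' Y' Z').1 + (a2 X' Y' Z').1
    + (a1 X' Y' Z').1 + (a0 X' Y' Z').1.
  exact: (congr1 fst (H X' Y' Z').1).
have wpE : wp X Y Z = (a2 X Y Z).1 + (a1 X Y Z).1.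
  exact: (congr1 fst (H X Y Z).2).
apply: CinfP => q; rewrite wpE /plus_formula /comb3.
have := congr1 (fun f : C => f q) (pq_type_S03 X Y Z h3 isT).
have := congr1 (fun f : C => f q) (pq_type_S03 X Y Z h0 isT).
have := congr1 (fun f : C => f q) (pq_type_S12 X Y Z h1 isT).
have := congr1 (fun f : C => f q) (pq_type_S12 X Y Z h2 isT).
rewrite /Sop !wE !CinfE.
lra.
Qed.

Lemma plus_partE w : Omega3_C K (fun X Y Z => w (P X) (P Y) (P Z)) ->
  forall X Y Z, plus_part K w X Y Z =
    plus_formula (fun X Y Z => w (P X) (P Y) (P Z)) X Y Z.
Proof.
move=> hw; apply: plus_formula_unique; rewrite /plus_part /the.
case: pselect => [ex|[]]; first by case: cid.
exists (plus_formula (fun X Y Z => w (P X) (P Y) (P Z))).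
exact: is_plus_part_formula.
Qed.

Lemma plus_formula_fix w X Y Z : Sop w X Y Z = w X Y Z ->
  plus_formula w X Y Z = w X Y Z.
Proof.
by rewrite /plus_formula /comb3 => ->; apply: CinfP => q; rewrite !CinfE; field.
Qed.

(** w = (3 w + S w) / 4 amounts to S w = w; from here on types of three-forms enter only through
    this equation. *)
Lemma Omega_plusP w : Omega_plus K w <->
  Omega3_C K w /\ forall X Y Z, Sop w X Y Z = w X Y Z.
Proof.
have wP : Omega3_C K w -> (fun X Y Z => w (P X) (P Y) (P Z)) = w.
  move=> hw; apply/funext => X; apply/funext => Y; apply/funext => Z.
  by rewrite !(form3_P1 hw, form3_P2 hw, form3_P3 hw).
split=> -[hw H]; split=> // X Y Z.
  have E X' Y' Z' : w X' Y' Z' = plus_formula w X' Y' Z'.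
    by rewrite [LHS]H plus_partE wP.
  apply: CinfP => q.
  have := congr1 (fun f : C => f q) (E X Y Z).
  by rewrite /plus_formula /comb3 !CinfE; lra.
by rewrite plus_partE wP // plus_formula_fix.
Qed.

End ThreeForms.

(** * Types of vector-valued two-forms *)

Section TwoForms.
Variables (R : realType) (m : nat) (M : manifold R m.*2.+1).
Variable K : metric_contact M.
Local Notation VF := (vfield M).
Local Notation C := (Cinf M).
Local Notation g := (cg K).
Local Notation eta := (ceta K).
Local Notation J := (cJ K).
Local Notation xi := (Reeb K).
Local Notation P := (hproj K).
Local Notation form2 := (VF -> VF -> VF).
Implicit Types (X Y Z V W : VF) (f : C).

Lemma JD X Y : J (X + Y) = J X + J Y. Proof. exact: linearD. Qed.
Lemma JN X : J (- X) = - J X. Proof. exact: linearN. Qed.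
Lemma JZ f X : J (f *: X) = f *: J X. Proof. by rewrite linearZ. Qed.
Lemma J0 : J 0 = 0. Proof. exact: linear0. Qed.
Lemma PD X Y : P (X + Y) = P X + P Y. Proof. exact: linearD. Qed.
Lemma PN X : P (- X) = - P X. Proof. exact: linearN. Qed.
Lemma PZ f X : P (f *: X) = f *: P X. Proof. by rewrite linearZ. Qed.
Lemma P0 : P 0 = 0. Proof. exact: linear0. Qed.

Definition JPE := (JD, JN, JZ, J0, PD, PN, PZ, P0).

Lemma etaD X Y : eta (X + Y) = eta X + eta Y. Proof. exact: linearD. Qed.
Lemma etaN X : eta (- X) = - eta X. Proof. exact: linearN. Qed.
Lemma etaZ f X : eta (f *: X) = f * eta X. Proof. by rewrite linearZ. Qed.
Lemma eta0 : eta 0 = 0. Proof. exact: linear0. Qed.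

Definition etaE := (etaD, etaN, etaZ, eta0).

Lemma vfield_ptP X Y : (forall V q, g X V q = g Y V q) -> X = Y.
Proof. by move=> H; apply: (@metric_inj _ _ _ g) => V; exact: CinfP. Qed.

Section Rules.
Variable B : form2.
Hypothesis hB : Omega2_CC K B.

Lemma cc_skew X Y : B X Y = - B Y X. Proof. by case: hB. Qed.
Lemma cc_eta X Y : eta (B X Y) = 0.
Proof. by case: hB => _ _ _; exact. Qed.
Lemma cc_xi1 Y : B xi Y = 0. Proof. by case: hB. Qed.
Lemma cc_xi2 Y : B Y xi = 0. Proof. by rewrite cc_skew cc_xi1 oppr0. Qed.
Lemma cc_P X Y : P (B X Y) = B X Y. Proof. by rewrite hproj_id // cc_eta. Qed.
Lemma cc_JJ X Y : J (J (B X Y)) = - B X Y. Proof. by rewrite JJ cc_P. Qed.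

Let tB := Omega2_CC_twoform hB.

Lemma cc_N1 X Y : B (- X) Y = - B X Y. Proof. exact: twoformNl tB X Y. Qed.
Lemma cc_N2 X Y : B X (- Y) = - B X Y. Proof. exact: twoformNr tB X Y. Qed.
Lemma cc_Z1 f X Y : B (f *: X) Y = f *: B X Y. Proof. exact: twoformZl. Qed.
Lemma cc_Z2 f X Y : B X (f *: Y) = f *: B X Y. Proof. exact: twoformZr. Qed.
Lemma cc_D1 X X' Y : B (X + X') Y = B X Y + B X' Y. Proof. exact: twoformDl. Qed.
Lemma cc_D2 X X' Y : B Y (X + X') = B Y X + B Y X'. Proof. exact: twoformDr. Qed.
Lemma cc_P1 X Y : B (P X) Y = B X Y.
Proof. by rewrite /hproj cc_D1 cc_N1 cc_Z1 cc_xi1 scaler0 subr0. Qed.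
Lemma cc_P2 X Y : B X (P Y) = B X Y.
Proof. by rewrite cc_skew cc_P1 -cc_skew. Qed.
Lemma cc_JJ1 X Y : B (J (J X)) Y = - B X Y.
Proof. by rewrite JJ cc_N1 cc_P1. Qed.
Lemma cc_JJ2 X Y : B X (J (J Y)) = - B X Y.
Proof. by rewrite JJ cc_N2 cc_P2. Qed.

Lemma cc_lowP X Y Z : g (P X) (B Y Z) = g X (B Y Z).
Proof. by rewrite metric_hproj cc_P. Qed.
Lemma cc_lowJJ X Y Z : g (J (J X)) (B Y Z) = - g X (B Y Z).
Proof. by rewrite JJ metricNl cc_lowP. Qed.
Lemma cc_lowxi Y Z : g xi (B Y Z) = 0.
Proof. by rewrite Reeb_dual cc_eta. Qed.
End Rules.

Definition cc_E B (hB : Omega2_CC K B) :=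
  (cc_D1 hB, cc_D2 hB, cc_N1 hB, cc_N2 hB, cc_Z1 hB, cc_Z2 hB).
Definition cc_JE B (hB : Omega2_CC K B) :=
  (cc_N1 hB, cc_N2 hB, cc_P1 hB, cc_P2 hB, cc_JJ1 hB, cc_JJ2 hB, cc_JJ hB, cc_P hB).

Lemma cc_comb (a b : C) B B' : Omega2_CC K B -> Omega2_CC K B' ->
  Omega2_CC K (fun X Y => a *: B X Y + b *: B' X Y).
Proof.
move=> hB hB'; split=> [Y f X X'|X Y|Y|X Y].
- apply: vfield_ptP => V q; rewrite !(cc_E hB) !(cc_E hB') !gE !CinfE; ring.
- apply: vfield_ptP => V q; rewrite (cc_skew hB X) (cc_skew hB' X) !gE !CinfE; ring.
- by rewrite (cc_xi1 hB) (cc_xi1 hB') !scaler0 addr0.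
- by rewrite /horizontal !etaE (cc_eta hB) (cc_eta hB') !mulr0 addr0.
Qed.

Lemma cc_Mop B : Omega2_CC K B -> Omega2_CC K (Mop K B).
Proof.
move=> hB; split=> [Y f X X'|X Y|Y|X Y]; rewrite /Mop ?JPE.
- by rewrite !(cc_E hB).
- by rewrite (cc_skew hB).
- by rewrite J_Reeb (twoform0l (Omega2_CC_twoform hB)).
- by rewrite /horizontal (cc_eta hB).
Qed.

Lemma cc_Jd B : Omega2_CC K B ->
  Omega2_CC K (fun X Y => J (B (J X) Y + B X (J Y))).
Proof.
move=> hB; split=> [Y f X X'|X Y|Y|X Y].
- by apply: vfield_ptP => V q; rewrite !JPE !(cc_E hB) !JPE !gE !CinfE; ring.
- by rewrite (cc_skew hB X) (cc_skew hB (J X)) -JN opprD addrC.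
- by rewrite J_Reeb (twoform0l (Omega2_CC_twoform hB)) (cc_xi1 hB) addr0 J0.
- by rewrite /horizontal eta_J.
Qed.

Definition part11 (B : form2) X Y : VF :=
  cstf M (1 / 2) *: B X Y + cstf M (1 / 2) *: Mop K B X Y.
(** B - MB is 2 B on types (2,0) and (0,2) and 0 on (1,1); the last term without [c] is -2 B, 2 B
    and 0 on (2,0), (0,2) and (1,1). The sign of c = -1/4 or 1/4 selects the type. *)
Definition part_mixed (c : R) (B : form2) X Y : VF :=
  cstf M (1 / 4) *: (1 *: B X Y + (- 1) *: Mop K B X Y)
  + cstf M c *: J (B (J X) Y + B X (J Y)).
Definition part20 := part_mixed (- (1 / 4)).
Definition part02 := part_mixed (1 / 4).

Lemma Omega20P B : Omega20 K B <-> Omega2_CC K B /\ forall X Y, B (J X) Y = J (B X Y).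
Proof.
split=> -[hB H]; last by split=> // X Y _ _; exact: H.
split=> // X Y; rewrite -(cc_P2 hB) -(J_hproj K X) H /horizontal ?eta_hproj //.
by rewrite (cc_P1 hB) (cc_P2 hB).
Qed.

Lemma Omega02P B : Omega02 K B <-> Omega2_CC K B /\ forall X Y, B (J X) Y = - J (B X Y).
Proof.
split=> -[hB H]; last by split=> // X Y _ _; exact: H.
split=> // X Y; rewrite -(cc_P2 hB) -(J_hproj K X) H /horizontal ?eta_hproj //.
by rewrite (cc_P1 hB) (cc_P2 hB).
Qed.

Lemma Omega20_J2 B : Omega20 K B -> forall X Y, B X (J Y) = J (B X Y).
Proof. by move=> /Omega20P [hB H] X Y; rewrite (cc_skew hB) H -JN -(cc_skew hB). Qed.

Lemma Omega02_J2 B : Omega02 K B -> forall X Y, B X (J Y) = - J (B X Y).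
Proof. by move=> /Omega02P [hB H] X Y; rewrite (cc_skew hB) H -JN -(cc_skew hB). Qed.

Lemma Omega11_J2 B : Omega11 K B -> forall X Y, B X (J Y) = - B (J X) Y.
Proof.
move=> [hB H] X Y; rewrite -H /Mop (cc_JJ2 hB).
by [].
Qed.

Lemma part11_Omega B : Omega2_CC K B -> Omega11 K (part11 B).
Proof.
move=> hB; split; first exact: cc_comb hB (cc_Mop hB).
by move=> X Y; rewrite /part11 /Mop !(cc_JE hB) opprK addrC.
Qed.

Lemma part_mixed_CC c B : Omega2_CC K B -> Omega2_CC K (part_mixed c B).
Proof.
move=> hB; exact: cc_comb (cc_comb 1 (- 1) hB (cc_Mop hB)) (cc_Jd hB).
Qed.

Lemma part20_Omega B : Omega2_CC K B -> Omega20 K (part20 B).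
Proof.
move=> hB; apply/Omega20P; split; first exact: part_mixed_CC.
move=> X Y; apply: vfield_ptP => V q; rewrite /part20 /part_mixed /Mop.
by rewrite !JPE !(cc_JE hB) ?JPE !gE !CinfE; field.
Qed.

Lemma part02_Omega B : Omega2_CC K B -> Omega02 K (part02 B).
Proof.
move=> hB; apply/Omega02P; split; first exact: part_mixed_CC.
move=> X Y; apply: vfield_ptP => V q; rewrite /part02 /part_mixed /Mop.
by rewrite !JPE !(cc_JE hB) ?JPE !gE !CinfE; field.
Qed.

Lemma part_sum B X Y : B X Y = part20 B X Y + part11 B X Y + part02 B X Y.
Proof.
apply: vfield_ptP => V q; rewrite /part20 /part02 /part_mixed /part11.
by rewrite !gE !CinfE; field.
Qed.

Lemma part_unique B b20 b11 b02 : Omega20 K b20 -> Omega11 K b11 -> Omega02 K b02 ->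
  (forall X Y, B X Y = b20 X Y + b11 X Y + b02 X Y) ->
  forall X Y, [/\ part20 B X Y = b20 X Y, part11 B X Y = b11 X Y
    & part02 B X Y = b02 X Y].
Proof.
move=> h20 h11 h02 BE X Y.
have [c20 r20] := iffLR (Omega20P b20) h20; have [c02 r02] := iffLR (Omega02P b02) h02.
have [c11 r11] := h11; rewrite /Mop in r11.
split; apply: vfield_ptP => V q;
  rewrite /part20 /part02 /part_mixed /part11 /Mop !BE ?r11 ?(Omega11_J2 h11);
  rewrite ?r20 ?r02 ?(Omega20_J2 h20) ?(Omega02_J2 h02) ?JPE ?(cc_JJ c20) ?(cc_JJ c02)
    ?JPE ?(cc_JJ c20) ?(cc_JJ c02) !gE !CinfE;
  by field.
Qed.

Lemma bianchiB A B X Y Z :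
  bianchi K (fun U V => A U V - B U V) X Y Z = bianchi K A X Y Z - bianchi K B X Y Z.
Proof. by rewrite /bianchi !metricDr !metricNr; ring. Qed.

Lemma bianchi_form3 B : Omega2_CC K B -> Omega3_C K (bianchi K B).
Proof.
move=> hB; split=> [Y Z f X X'|X Y Z|X Y Z|Y Z]; rewrite /bianchi /=.
- by rewrite !(cc_E hB) !gE; ring.
- by rewrite (cc_skew hB Y Z) (cc_skew hB Z X) (cc_skew hB X Y) !gE; ring.
- by rewrite (cc_skew hB Y Z) (cc_skew hB Z X) (cc_skew hB X Y) !gE; ring.
- by rewrite (cc_lowxi hB) (cc_xi1 hB) (cc_xi2 hB) !gE !addr0 mulr0.
Qed.

End TwoForms.

(** * Uniqueness of the decomposition *)

Section UniqueParts.
Variables (R : realType) (m : nat) (M : manifold R m.*2.+1).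
Variable K : metric_contact M.
Local Notation VF := (vfield M).
Local Notation C := (Cinf M).
Local Notation g := (cg K).
Local Notation eta := (ceta K).
Local Notation J := (cJ K).
Local Notation xi := (Reeb K).
Local Notation P := (hproj K).
Local Notation form2 := (VF -> VF -> VF).
Implicit Types (X Y Z V W : VF) (f : C).

Lemma functional_expand p (e : 'I_(m.*2.+1) -> VF) (al : VF -> C) X :
  orthonormal_at K p e -> scalar al ->
  al X p = \sum_i g X (e i) p * al (e i) p.
Proof.
move=> eo als; have gal := @sharp_scalar _ _ _ g al als.
rewrite -gal Defs.metric_sym (orthonormal_expand X _ eo).
by apply: eq_bigr => i _; rewrite gal.
Qed.

(** Definiteness at a single point: a vanishing sum of squares annihilates every coordinate of [U]
    in an orthonormal frame at [p]. *)
Lemma metric_null p U V : g U U p = 0 -> g U V p = 0.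
Proof.
have [e eo] := orthonormal_exists g p.
rewrite !(orthonormal_expand _ _ eo) => /eqP; rewrite psumr_eq0; last first.
  by move=> i _; rewrite -expr2 sqr_ge0.
move=> /allP U0; rewrite big1 // => i _.
have := U0 i (mem_index_enum i); rewrite /= -expr2 sqrf_eq0 => /eqP ->.
by rewrite mul0r.
Qed.

Lemma orthogonal_self A : twoform A -> orthogonal_forms K A A ->
  forall X Y, A X Y = 0.
Proof.
move=> hA oA X Y; apply: (@vfield_ptP _ _ _ K) => V p; rewrite metric0l Cinf0.
have [e eo] := orthonormal_exists g p.
have Ae i j W : g (A (e i) (e j)) W p = 0.
  apply: metric_null; have := oA p e eo.
  move=> /eqP; rewrite psumr_eq0; last first.
    by move=> k _; apply: sumr_ge0 => l _; exact: metric_ge0.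
  move=> /allP /(_ i (mem_index_enum i)) /=; rewrite psumr_eq0; last first.
    by move=> l _; exact: metric_ge0.
  by move=> /allP /(_ j (mem_index_enum j)) /= /eqP.
have s1 Y' : scalar (fun X => g (A X Y') V).
  by move=> f Z Z'; rewrite (twoformDl hA) (twoformZl hA) !gE.
have s2 X' : scalar (fun Y => g (A X' Y) V).
  by move=> f Z Z'; rewrite (twoformDr hA) (twoformZr hA) !gE.
rewrite (functional_expand X eo (s1 Y)) big1 // => i _.
rewrite (functional_expand Y eo (s2 (e i))) big1 ?mulr0 // => j _.
by rewrite Ae mulr0.
Qed.

Lemma sym_skew_unique (Fp Fm Gp Gm : VF -> VF) :
  symmetric_end K Fp -> skew_end K Fm -> symmetric_end K Gp -> skew_end K Gm ->
  (forall X, Fp X + Fm X = Gp X + Gm X) ->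
  forall X, Fp X = Gp X /\ Fm X = Gm X.
Proof.
move=> sFp sFm sGp sGm FG X.
have E V q : g (Fp X) V q = g (Gp X) V q.
  have := congr1 (fun Z => g Z V q) (FG X).
  have := congr1 (fun Z => g X Z q) (FG V).
  rewrite !gE -(sFp X V) -(sGp X V) !CinfE.
  have := congr1 (fun f : C => f q) (sFm X V).
  have := congr1 (fun f : C => f q) (sGm X V).
  by rewrite !CinfE; lra.
split; apply: (@vfield_ptP _ _ _ K) => V q; first exact: E.
have := congr1 (fun Z => g Z V q) (FG X).
by rewrite !gE !CinfE E => /addrI.
Qed.

Lemma Omega11_sB B B' : Omega11_s K B -> Omega11_s K B' ->
  Omega11_s K (fun X Y => 1 *: B X Y + (- 1) *: B' X Y).
Proof.
move=> [[hB iB] bB] [[hB' iB'] bB']; split; first split.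
- exact: cc_comb.
- by move=> X Y; rewrite /Mop; have := iB X Y; have := iB' X Y; rewrite /Mop => -> ->.
- move=> X Y Z; have := bB X Y Z; have := bB' X Y Z.
  rewrite /bianchi !gE => H' H; rewrite -[RHS](subrr 0) -{1}H -H'; ring.
Qed.

Section Unique.
Variable B : form2.

Lemma is_parts_eqs d : is_parts K B d -> forall X Y,
  [/\ P (B (P X) (P Y)) = p20 d X Y + p11 d X Y + p02 d X Y,
      eta (B (P X) (P Y)) = p2plus d X Y + p2minus d X Y,
      P (B xi X) = p1plus d X + p1minus d X
    & eta (B xi X) = p1R d X].
Proof.
move=> [[h20 h11 h02] _ [[s2p k2p x2p] m2p [s2m k2m x2m] m2m]
  [[lFp xFp hFp] sFp [lFm xFm hFm] sFm [sR xR]] BE] X Y.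
have c20 := h20.1; have c11 := h11.1; have c02 := h02.1.
have sc1 (a : VF -> VF -> C) : (forall Y, scalar (a^~ Y)) -> (forall Y, a xi Y = 0) ->
    forall X Y, a (P X) Y = a X Y.
  move=> sa xa X' Y'; have [a' aE] := scalar_bundle (sa Y').
  have aE' Z : a Z Y' = a' Z by rewrite -aE.
  by rewrite !aE' /hproj linearB linearZ /= -!aE' xa mulr0 subr0.
have P2p X' Y' : p2plus d (P X') (P Y') = p2plus d X' Y'.
  by rewrite (sc1 _ s2p x2p) k2p (sc1 _ s2p x2p) -k2p.
have P2m X' Y' : p2minus d (P X') (P Y') = p2minus d X' Y'.
  by rewrite (sc1 _ s2m x2m) k2m (sc1 _ s2m x2m) -k2m.
have hor : eta (p20 d X Y) = 0 /\ eta (p11 d X Y) = 0 /\ eta (p02 d X Y) = 0.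
  by rewrite (cc_eta c20) (cc_eta c11) (cc_eta c02).
have BP : B (P X) (P Y) = p20 d X Y + p11 d X Y + p02 d X Y
    + (p2plus d X Y + p2minus d X Y) *: xi.
  rewrite BE P2p P2m /eta_wedge !eta_hproj !mul0r subrr !scale0r.
  rewrite !(cc_P1 c20, cc_P2 c20, cc_P1 c11, cc_P2 c11, cc_P1 c02, cc_P2 c02).
  by apply: (@vfield_ptP _ _ _ K) => V q; rewrite !gE !CinfE; ring.
have Bx : B xi X = p1plus d X + p1minus d X + p1R d X *: xi.
  rewrite BE (cc_xi1 c20) (cc_xi1 c11) (cc_xi1 c02) x2p x2m /eta_wedge xFp xFm xR.
  rewrite eta_Reeb.
  by apply: (@vfield_ptP _ _ _ K) => V q; rewrite !gE !CinfE; ring.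
have hP Z : eta Z = 0 -> P Z = Z by exact: hproj_id.
rewrite BP Bx !PD !PZ !etaD !etaZ hproj_Reeb eta_Reeb (cc_eta c20) (cc_eta c11).
rewrite (cc_eta c02) (cc_P c20) (cc_P c11) (cc_P c02) (hP _ (hFp X)) (hP _ (hFm X)).
have -> : eta (p1plus d X) = 0 by exact: hFp.
have -> : eta (p1minus d X) = 0 by exact: hFm.
by split; rewrite ?scaler0 ?addr0 ?add0r ?mulr1.
Qed.

(** Types on the contact distribution are separated by projection formulas, the two-forms by
    invariance under J, the endomorphisms by symmetry. Only the splitting of the (1,1) part uses
    orthogonality. *)
Lemma parts_unique d d' : is_parts K B d -> is_parts K B d' -> d = d'.
Proof.
move=> hd hd'; have E := is_parts_eqs hd; have E' := is_parts_eqs hd'.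
have [[h20 h11 h02] [h11s h11a a11] [u2p m2p u2m m2m] [eFp sFp eFm sFm uR] _] := hd.
have [[k20 k11 k02] [k11s k11a b11] [q2p n2p q2m n2m] [fFp tFp fFm tFm qR] _] := hd'.
pose B' X Y := P (B (P X) (P Y)).
have U X Y := part_unique (B := B') h20 h11 h02
  (fun X Y => let: And4 h _ _ _ := E X Y in h) X Y.
have U' X Y := part_unique (B := B') k20 k11 k02
  (fun X Y => let: And4 h _ _ _ := E' X Y in h) X Y.
have e20 X Y : p20 d X Y = p20 d' X Y.
  by have [ <- _ _] := U X Y; have [ <- _ _] := U' X Y.
have e11 X Y : p11 d X Y = p11 d' X Y.
  by have [_ <- _] := U X Y; have [_ <- _] := U' X Y.
have e02 X Y : p02 d X Y = p02 d' X Y.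
  by have [_ _ <- ] := U X Y; have [_ _ <- ] := U' X Y.
have e2 X Y : p2plus d X Y + p2minus d X Y = p2plus d' X Y + p2minus d' X Y.
  by have [_ <- _ _] := E X Y; have [_ <- _ _] := E' X Y.
have e2p X Y : p2plus d X Y = p2plus d' X Y.
  apply: CinfP => q.
  have := congr1 (fun f : C => f q) (e2 X Y).
  have := congr1 (fun f : C => f q) (e2 (J X) (J Y)).
  have := congr1 (fun f : C => f q) (m2p X Y).
  have := congr1 (fun f : C => f q) (m2m X Y).
  have := congr1 (fun f : C => f q) (n2p X Y).
  have := congr1 (fun f : C => f q) (n2m X Y).
  by rewrite /Mop !CinfE; lra.
have e2m X Y : p2minus d X Y = p2minus d' X Y.
  by have := e2 X Y; rewrite e2p => /addrI.
have eF X : p1plus d X + p1minus d X = p1plus d' X + p1minus d' X.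
  by have [_ _ <- _] := E X X; have [_ _ <- _] := E' X X.
have eFF := sym_skew_unique sFp sFm tFp tFm eF.
have eR X : p1R d X = p1R d' X.
  by have [_ _ _ <- ] := E X X; have [_ _ _ <- ] := E' X X.
(* This difference lies in [Omega11_s] and is also a difference of elements of [Omega11_a], so it is
   orthogonal to itself. *)
pose A X Y := 1 *: p11s d X Y + (- 1) *: p11s d' X Y.
have hA : Omega11_s K A by exact: Omega11_sB.
have AE X Y : A X Y = p11a d' X Y - p11a d X Y.
  have := e11 X Y; rewrite a11 b11 /A => H.
  apply: (@vfield_ptP _ _ _ K) => V q.
  have := congr1 (fun Z => g Z V q) H; rewrite !gE !CinfE; lra.
have oA : orthogonal_forms K A A.
  move=> p e eo; have H1 := h11a.2 A hA p e eo; have H2 := k11a.2 A hA p e eo.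
  transitivity (\sum_i \sum_j g (p11a d' (e i) (e j)) (A (e i) (e j)) p
    - \sum_i \sum_j g (p11a d (e i) (e j)) (A (e i) (e j)) p); last first.
    by rewrite H1 H2 subrr.
  rewrite -sumrB; apply: eq_bigr => i _; rewrite -sumrB; apply: eq_bigr => j _.
  by rewrite [X in g X _]AE !gE !CinfE.
have A0 := orthogonal_self (Omega2_CC_twoform hA.1.1) oA.
have es X Y : p11s d X Y = p11s d' X Y.
  have := A0 X Y; rewrite /A scale1r scaleN1r => /eqP; rewrite subr_eq0.
  by move=> /eqP.
have ea X Y : p11a d X Y = p11a d' X Y.
  by have := A0 X Y; rewrite AE => /eqP; rewrite subr_eq0 => /eqP.
have f2 (T : Type) (a b : VF -> VF -> T) : (forall X Y, a X Y = b X Y) -> a = b.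
  by move=> ab; apply/funext => X; apply/funext => Y.
have f1 (T : Type) (a b : VF -> T) : (forall X, a X = b X) -> a = b.
  by move=> ab; apply/funext => X.
move: (f2 _ _ _ e20) (f2 _ _ _ e11) (f2 _ _ _ es) (f2 _ _ _ ea) (f2 _ _ _ e02)
  (f2 _ _ _ e2p) (f2 _ _ _ e2m) (f1 _ _ _ (fun X => (eFF X).1))
  (f1 _ _ _ (fun X => (eFF X).2)) (f1 _ _ _ eR).
case: (d) => ? ? ? ? ? ? ? ? ? ?; case: (d') => ? ? ? ? ? ? ? ? ? ? /=.
by do 10!move=> ->.
Qed.

Lemma parts_ofE d : is_parts K B d -> parts_of K B = d.
Proof.
move=> hd; rewrite /parts_of /the; case: pselect => [ex|[]]; last by exists d.
by apply: parts_unique hd; case: cid.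
Qed.

End Unique.

End UniqueParts.

(** * Vector-valued two-forms built from a three-form *)

Section FormulaTensor.
Variables (R : realType) (m : nat) (M : manifold R m.*2.+1).
Variable K : metric_contact M.
Local Notation VF := (vfield M).
Local Notation C := (Cinf M).
Local Notation g := (cg K).
Local Notation eta := (ceta K).
Local Notation J := (cJ K).
Local Notation xi := (Reeb K).
Local Notation P := (hproj K).
Local Notation form2 := (VF -> VF -> VF).
Local Notation form3 := (VF -> VF -> VF -> C).
Local Notation v2 := (vec2 K).
Implicit Types (X Y Z V W : VF) (f : C).

(** The matrix of the skew endomorphism J in an orthonormal frame is antisymmetric; expand and
    exchange the two indices. *)
Lemma J_move p (e : 'I_(m.*2.+1) -> VF) (H : VF -> VF -> C) :
  orthonormal_at K p e -> (forall Y, scalar (H^~ Y)) -> (forall X, scalar (H X)) ->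
  \sum_i H (J (e i)) (e i) p = - \sum_i H (e i) (J (e i)) p.
Proof.
move=> eo s1 s2.
transitivity (\sum_i \sum_k g (J (e i)) (e k) p * H (e k) (e i) p).
  by apply: eq_bigr => i _; rewrite (functional_expand _ eo (s1 (e i))).
rewrite exchange_big -sumrN; apply: eq_bigr => k _ /=.
rewrite (functional_expand _ eo (s2 (e k))) -sumrN; apply: eq_bigr => i _.
by rewrite J_skew CinfN Defs.metric_sym mulNr.
Qed.

Section Omega3.
Variable w : form3.
Hypothesis hw : Omega3_C K w.

Lemma vec2_low X Y Z : g X (v2 w Y Z) = w X Y Z.
Proof. by rewrite Defs.metric_sym sharp_scalar //; case: hw. Qed.

Lemma vec2_lowl X Y Z : g (v2 w Y Z) X = w X Y Z.
Proof. by rewrite Defs.metric_sym vec2_low. Qed.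

Lemma vec2_CC : Omega2_CC K (v2 w).
Proof.
split=> [Y f X X'|X Y|Y|X Y].
- apply: (@vfield_ptP _ _ _ K) => V q; rewrite !gE !vec2_lowl.
  by rewrite !(form3E hw).
- apply: (@vfield_ptP _ _ _ K) => V q; rewrite !gE !vec2_lowl.
  by rewrite (form3_23 hw).
- apply: (@vfield_ptP _ _ _ K) => V q; rewrite !gE !vec2_lowl.
  by rewrite (form3_xi2 hw).
- by rewrite /horizontal -Reeb_dual vec2_low (form3_xi1 hw).
Qed.

(** For w fixed by [Sop], [w20] and [w11] are normalized to have Bianchi image w/2; they are the
    (2,0) and [Omega11_a] parts of a torsion whose plus part is w. *)
Definition w20 X Y : VF :=
  cstf M (3 / 4) *: v2 w X Y + cstf M (- (3 / 4)) *: Mop K (v2 w) X Y.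
Definition w11 X Y : VF :=
  cstf M (3 / 8) *: v2 w X Y + cstf M (3 / 8) *: Mop K (v2 w) X Y.

Lemma bianchi_vec2 X Y Z : bianchi K (v2 w) X Y Z = w X Y Z.
Proof.
apply: CinfP => q; rewrite /bianchi !vec2_low.
by rewrite (form3_rot hw Y) !(form3_rot hw Z) !CinfE; field.
Qed.

Lemma w11_11 : Omega11 K w11.
Proof.
split; first exact: cc_comb vec2_CC (cc_Mop vec2_CC).
by move=> X Y; rewrite /w11 /Mop !(cc_JE vec2_CC) opprK addrC.
Qed.

(** w is invariant under rotation of its arguments, so three times the pairing is the pairing of w
    with the cyclic sum of B, which is zero. *)
Lemma vec2_orthogonal p (e : 'I_(m.*2.+1) -> VF) (B : form2) :
  orthonormal_at K p e -> (forall X Y Z, bianchi K B X Y Z = 0) ->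
  \sum_i \sum_j g (v2 w (e i) (e j)) (B (e i) (e j)) p = 0.
Proof.
move=> eo bB; pose t k i j := w (e k) (e i) (e j) p.
pose b k i j := g (e k) (B (e i) (e j)) p.
have -> : \sum_i \sum_j g (v2 w (e i) (e j)) (B (e i) (e j)) p =
    \sum_i \sum_j \sum_k t k i j * b k i j.
  apply: eq_bigr => i _; apply: eq_bigr => j _.
  rewrite (orthonormal_expand _ _ eo); apply: eq_bigr => k _.
  by rewrite vec2_lowl (Defs.metric_sym g (B _ _)).
have tr k i j : t k i j = t i j k by rewrite /t (form3_rot hw).
have b0 k i j : b k i j + b i j k + b j k i = 0.
  have := congr1 (fun f : C => f p) (bB (e k) (e i) (e j)).
  rewrite /bianchi !CinfE => /eqP; rewrite mulf_eq0 => /orP[ | /eqP //].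
  by rewrite div1r invr_eq0 pnatr_eq0.
pose S (s : 'I_(m.*2.+1) -> 'I_(m.*2.+1) -> 'I_(m.*2.+1) -> R) :=
  \sum_i \sum_j \sum_k s k i j.
rewrite -/(S (fun k i j => t k i j * b k i j)).
have rot s : S s = S (fun k i j => s i j k).
  rewrite /S; transitivity (\sum_k \sum_i \sum_j s k i j); last by [].
  under eq_bigr => i _ do rewrite exchange_big.
  by rewrite exchange_big.
have sD s s' : S s + S s' = S (fun k i j => s k i j + s' k i j).
  rewrite /S -big_split; apply: eq_bigr => i _; rewrite -big_split.
  by apply: eq_bigr => j _; rewrite -big_split.
pose s k i j := t k i j * b k i j; rewrite -/s.
have e1 : S s = S (fun k i j => s i j k) by exact: rot.
have e2 : S s = S (fun k i j => s j k i) by rewrite e1 rot.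
have : S s + S (fun k i j => s i j k) + S (fun k i j => s j k i) = 0.
  rewrite !sD /S big1 // => i _; rewrite big1 // => j _; rewrite big1 // => k _.
  by rewrite /s (tr j k i) -(tr k i j) -!mulrDr b0 mulr0.
by rewrite -e1 -e2; lra.
Qed.

(** [Mop] is self-adjoint, since moving each of the two J across the pairing changes the sign once,
    and it fixes B. The pairing with [Mop K (v2 w)] thus reduces to [vec2_orthogonal]. *)
Lemma w11_11a : Omega11_a K w11.
Proof.
split; first exact: w11_11.
move=> B [[hB iB] bB] p e eo.
have H1 := vec2_orthogonal eo bB.
have H2 : \sum_i \sum_j g (Mop K (v2 w) (e i) (e j)) (B (e i) (e j)) p = 0.
  have cv := vec2_CC.
  transitivity
    (\sum_i \sum_j g (v2 w (e i) (e j)) (B (J (e i)) (J (e j))) p); last first.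
    rewrite -[RHS]H1; apply: eq_bigr => i _; apply: eq_bigr => j _.
    by have := iB (e i) (e j); rewrite /Mop => ->.
  transitivity (- \sum_i \sum_j g (v2 w (e i) (J (e j))) (B (J (e i)) (e j)) p).
    rewrite exchange_big [in RHS]exchange_big -sumrN.
    apply: eq_bigr => j _ /=.
    apply: (@J_move p e (fun U U' => g (v2 w U (J (e j))) (B U' (e j))) eo).
      by move=> Y f U U'; rewrite (cc_D1 cv) (cc_Z1 cv) !gE.
    by move=> X f U U'; rewrite (cc_D1 hB) (cc_Z1 hB) !gE.
  rewrite -sumrN; apply: eq_bigr => i _.
  rewrite -[RHS]opprK; congr (- _).
  apply: (@J_move p e (fun U U' => g (v2 w (e i) U) (B (J (e i)) U')) eo).
    by move=> Y f U U'; rewrite (cc_D2 cv) (cc_Z2 cv) !gE.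
  by move=> X f U U'; rewrite (cc_D2 hB) (cc_Z2 hB) !gE.
transitivity (3 / 8 * (\sum_i \sum_j g (v2 w (e i) (e j)) (B (e i) (e j)) p)
  + 3 / 8 * (\sum_i \sum_j g (Mop K (v2 w) (e i) (e j)) (B (e i) (e j)) p)); last first.
  by rewrite H1 H2 !mulr0 addr0.
rewrite !mulr_sumr -big_split; apply: eq_bigr => i _ /=.
rewrite !mulr_sumr -big_split; apply: eq_bigr => j _ /=.
by rewrite /w11 !gE !CinfE.
Qed.

Hypothesis Sw : forall X Y Z, Sop K w X Y Z = w X Y Z.

Lemma bianchi_Mvec2 X Y Z : bianchi K (Mop K (v2 w)) X Y Z = cstf M (1 / 3) * w X Y Z.
Proof.
rewrite /bianchi /Mop !vec2_low; congr (_ * _); rewrite -[RHS]Sw /Sop.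
by rewrite (form3_rot hw Y) (form3_rot hw (J Z)) (form3_rot hw Z); ring.
Qed.

Lemma w20_20 : Omega20 K w20.
Proof.
apply/Omega20P; split; first exact: cc_comb vec2_CC (cc_Mop vec2_CC).
move=> X Y; apply: (@vfield_ptP _ _ _ K) => V q.
rewrite /w20 /Mop J_skew !gE !vec2_lowl.
have := congr1 (fun f : C => f q) (Sw (J V) X Y); rewrite /Sop !(form3J hw) !CinfE.
by lra.
Qed.

Lemma bianchi_w20 X Y Z : bianchi K w20 X Y Z = cstf M (1 / 2) * w X Y Z.
Proof.
have := bianchi_vec2 X Y Z; have := bianchi_Mvec2 X Y Z.
rewrite /bianchi /w20 !gE => /(congr1 (fun f : C => cstf M (-(3 / 4)) * f)) H2.
move=> /(congr1 (fun f : C => cstf M (3 / 4) * f)) H1.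
apply: CinfP => q; have := congr1 (fun f : C => f q) H1.
have := congr1 (fun f : C => f q) H2; rewrite !CinfE; lra.
Qed.

Lemma bianchi_w11 X Y Z : bianchi K w11 X Y Z = cstf M (1 / 2) * w X Y Z.
Proof.
have := bianchi_vec2 X Y Z; have := bianchi_Mvec2 X Y Z.
rewrite /bianchi /w11 !gE => /(congr1 (fun f : C => cstf M (3 / 8) * f)) H2.
move=> /(congr1 (fun f : C => cstf M (3 / 8) * f)) H1.
apply: CinfP => q; have := congr1 (fun f : C => f q) H1.
have := congr1 (fun f : C => f q) H2; rewrite !CinfE; lra.
Qed.

Lemma phi_inv_w11 X Y : phi_inv K w11 X Y = w20 X Y.
Proof.
have hb := bianchi_form3 w11_11.1.
apply: (@vfield_ptP _ _ _ K) => V q; rewrite /phi_inv /w20 /Mop !gE.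
have E X' Y' : g (v2 (bianchi K w11) X' Y') V = cstf M (1 / 2) * w V X' Y'.
  rewrite Defs.metric_sym /vec2 Defs.metric_sym sharp_scalar; last by case: hb.
  exact: bianchi_w11.
by rewrite !E !vec2_lowl !CinfE; field.
Qed.

End Omega3.
End FormulaTensor.

(** * Decomposition of the torsion *)

Section TorsionForm.
Variables (R : realType) (m : nat) (M : manifold R m.*2.+1).
Variable K : metric_contact M.
Local Notation VF := (vfield M).
Local Notation C := (Cinf M).
Local Notation g := (cg K).
Local Notation eta := (ceta K).
Local Notation J := (cJ K).
Local Notation xi := (Reeb K).
Local Notation P := (hproj K).
Local Notation form2 := (VF -> VF -> VF).
Local Notation form3 := (VF -> VF -> VF -> C).
Local Notation v2 := (vec2 K).
Implicit Types (X Y Z V W : VF) (f : C).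

Lemma extdE X Y : extd eta X Y = g (J X) Y.
Proof. exact: contact_extd. Qed.

Lemma Omega2_extd : Omega2_C K (extd eta).
Proof.
split=> [Y f X X'|X Y|Y]; rewrite !extdE.
- by rewrite !JPE !gE.
- by rewrite J_skew Defs.metric_sym.
- by rewrite J_Reeb metric0l.
Qed.

Lemma extd_JJ X Y : extd eta (J X) (J Y) = extd eta X Y.
Proof. by rewrite !extdE metricJJ -metric_hproj hproj_J. Qed.

Variables (N : form2) (w : form3) (B : form2) (F Phi : VF -> VF).

(** The coefficients are 9/8 = 3/4 + 3/8 and -3/8 = 3/8 - 3/4, from [w20] plus [w11]. *)
Definition torsion_form X Y : VF :=
  N X Y + cstf M (9 / 8) *: v2 w X Y - cstf M (3 / 8) *: Mop K (v2 w) X Y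
  + B X Y + extd eta X Y *: xi + eta_wedge K F X Y + eta_wedge K Phi X Y.

Definition torsion_parts : parts M :=
  Parts (w20 K w) (fun X Y => 1 *: B X Y + 1 *: w11 K w X Y) B (w11 K w) N
    (extd eta) (fun _ _ => 0) F Phi (fun=> 0).

Hypotheses (hN : Omega02 K N) (hw : Omega3_C K w)
  (Sw : forall X Y Z, Sop K w X Y Z = w X Y Z) (hB : Omega11_s K B)
  (hF : endC K F) (sF : symmetric_end K F) (hPhi : EndJ_minus K Phi).

Lemma is_parts_torsion T : (forall X Y, T X Y = torsion_form X Y) ->
  is_parts K T torsion_parts.
Proof.
move=> TE; have h11 := w11_11 hw; split.
- split; [exact: w20_20| |exact: hN].
  split; first exact: cc_comb hB.1.1 h11.1.
  by move=> X Y; rewrite /= /Mop; have := hB.1.2 X Y; have := h11.2 X Y;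
    rewrite /Mop => -> ->.
- split; [exact: hB|exact: w11_11a|by move=> X Y /=; rewrite !scale1r].
- split; [exact: Omega2_extd|exact: extd_JJ| |by move=> X Y; rewrite /= oppr0].
  by split=> [Y f X X'|X Y|Y] /=; rewrite ?oppr0 // mulr0 addr0.
- split; [exact: hF|exact: sF|by case: hPhi|by case: hPhi| ].
  by split=> // f X Y /=; rewrite mulr0 addr0.
- move=> X Y; rewrite TE /torsion_form /= /w20 /w11.
  by apply: (@vfield_ptP _ _ _ K) => V q; rewrite !gE !CinfE; field.
Qed.

(** The eigenvalue -3 says that the Bianchi image of the (0,2) part has no plus part, so N does not
    contribute to w. *)
Lemma Sop_bianchi02 X Y Z :
  Sop K (bianchi K N) X Y Z = - (cstf M 3 * bianchi K N X Y Z).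
Proof.
have [cN rN] := iffLR (Omega02P K N) hN; have rN2 := Omega02_J2 hN.
apply: CinfP => q; rewrite /Sop /bianchi !(rN, rN2) !JPE !(cc_JJ cN) !gE.
by rewrite !J_skewr ?gE !(cc_lowJJ cN) !CinfE; field.
Qed.

Lemma plus_part_torsion T : (forall X Y, T X Y = torsion_form X Y) ->
  forall X Y Z, plus_part K (bianchi K T) X Y Z = w X Y Z.
Proof.
move=> TE; have [cN _] := hN; have hb := bianchi_form3 cN.
have cB := hB.1.1; have bB := hB.2; have cv := vec2_CC hw.
have E X Y Z : bianchi K T (P X) (P Y) (P Z) = comb3 1 1 (bianchi K N) w X Y Z.
  have H1 := bianchi_vec2 hw X Y Z; have H2 := bianchi_Mvec2 hw Sw X Y Z.
  have H3 := bB X Y Z.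
  have lowE U V W : g (P U) (T (P V) (P W)) = g U (N V W)
      + cstf M (9 / 8) * g U (v2 w V W) - cstf M (3 / 8) * g U (Mop K (v2 w) V W)
      + g U (B V W).
    have xU : g (P U) xi = 0 by rewrite metric_eta eta_hproj.
    have lN := cc_lowP cN U; have lv := cc_lowP cv U; have lB := cc_lowP cB U.
    move: (P U) xU lN lv lB => U' xU lN lv lB.
    rewrite TE /torsion_form /eta_wedge !eta_hproj !gE xU /Mop lN !lv lB !J_hproj.
    rewrite !(cc_P1 cN, cc_P2 cN, cc_P1 cv, cc_P2 cv, cc_P1 cB, cc_P2 cB).
    by ring.
  rewrite /bianchi !lowE /comb3 -[X in _ + 1 * X]H1.
  apply: CinfP => q.
  have := congr1 (fun f : C => f q) H1.
  have := congr1 (fun f : C => f q) H2.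
  have := congr1 (fun f : C => f q) H3.
  rewrite /bianchi !CinfE; lra.
have E' : (fun X Y Z => bianchi K T (P X) (P Y) (P Z)) = comb3 1 1 (bianchi K N) w.
  by apply/funext => X; apply/funext => Y; apply/funext => Z; exact: E.
move=> X Y Z; rewrite plus_partE E'; last exact: Omega3_comb.
have := Sop_bianchi02 X Y Z; have := Sw X Y Z.
rewrite /plus_formula /comb3 /Sop => H1 H2; apply: CinfP => q.
have := congr1 (fun f : C => f q) H1; have := congr1 (fun f : C => f q) H2.
by rewrite !CinfE; lra.
Qed.

End TorsionForm.

Section SplitByJ.
Variables (R : realType) (m : nat) (M : manifold R m.*2.+1).
Variable K : metric_contact M.
Local Notation VF := (vfield M).
Local Notation g := (cg K).
Local Notation eta := (ceta K).
Local Notation J := (cJ K).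
Local Notation xi := (Reeb K).
Implicit Types (X Y Z V W : VF).

Variable F : VF -> VF.
Hypotheses (hF : endC K F) (JF_sym : forall X Y, g (J (F X)) Y = g (J (F Y)) X).

Lemma endC_JJ X : F (J (J X)) = - F X.
Proof.
have [l x _] := hF.
have FN : J (J X) = (- 1) *: X + eta X *: xi by rewrite (contact_J K) scaleN1r.
have F0 : F 0 = 0.
  by have := l 1 0 0; rewrite !scale1r addr0 => /eqP; rewrite -subr_eq subrr => /eqP.
have FZ : F (eta X *: xi) = 0 by rewrite -[_ *: _]addr0 l F0 x scaler0 addr0.
by rewrite FN l FZ addr0 scaleN1r.
Qed.

Lemma endC_J_Reeb : F (J xi) = 0.
Proof.
have [l _ _] := hF; rewrite J_Reeb.
by have := l 1 0 0; rewrite !scale1r addr0 => /eqP; rewrite -subr_eq subrr => /eqP.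
Qed.

(** Symmetry of J F means that the adjoint of F is J F J. The symmetric and skew parts of F are then
    [Jplus] and [Jminus], which anticommute and commute with J. *)
Lemma JFJ_adjoint X Y : g (J (F (J X))) Y = g X (F Y).
Proof.
have [_ _ h] := hF; rewrite JF_sym metricJJ -metric_hproj.
by rewrite (hproj_id (h Y)) Defs.metric_sym.
Qed.

Definition Jplus X := cstf M (1 / 2) *: (F X + J (F (J X))).
Definition Jminus X := cstf M (1 / 2) *: (F X - J (F (J X))).

Lemma Jplus_endC : endC K Jplus.
Proof.
have [l x h] := hF; split=> [f X Y| |X]; rewrite /Jplus.
- rewrite JD JZ !l JD JZ; move: (F X) (F Y) (J _) (J (F (J Y))) => a b c d.
  by apply: (@metric_inj _ _ _ g) => V; rewrite !gE; ring.
- by rewrite x endC_J_Reeb J0 addr0 scaler0.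
- by rewrite /horizontal etaZ etaD h eta_J addr0 mulr0.
Qed.

Lemma Jplus_sym : symmetric_end K Jplus.
Proof.
move=> X Y; rewrite /Jplus !gE JFJ_adjoint.
by rewrite (Defs.metric_sym g X (J _)) JFJ_adjoint (Defs.metric_sym g Y); ring.
Qed.

Lemma Jminus_EndJ : EndJ_minus K Jminus.
Proof.
have [l x h] := hF; split; first split=> [f X Y| |X]; rewrite /Jminus.
- rewrite JD JZ !l JD JZ; move: (F X) (F Y) (J _) (J (F (J Y))) => a b c d.
  by apply: (@metric_inj _ _ _ g) => V; rewrite !gE; ring.
- by rewrite x endC_J_Reeb J0 subr0 scaler0.
- by rewrite /horizontal etaZ etaD etaN h eta_J subr0 mulr0.
- move=> X Y; rewrite !gE JFJ_adjoint.
  by rewrite (Defs.metric_sym g X (J _)) JFJ_adjoint (Defs.metric_sym g Y); ring.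
- move=> X; rewrite endC_JJ !JPE JJ (hproj_id (h _)).
  by apply: (@metric_inj _ _ _ g) => V; rewrite !gE; ring.
Qed.

End SplitByJ.

Section BianchiParts.
Variables (R : realType) (m : nat) (M : manifold R m.*2.+1).
Variable K : metric_contact M.
Local Notation VF := (vfield M).
Local Notation C := (Cinf M).
Local Notation g := (cg K).
Local Notation J := (cJ K).
Local Notation form2 := (VF -> VF -> VF).
Implicit Types (X Y Z V W : VF) (B : form2).

(* The operator [Dop] has no kernel, and maps [bianchi (part20 B - part11 B)] to
   the (2,1) + (1,2) part of the cyclic sum of [J o B]. *)
Lemma bianchi_part20_part11 B : Omega2_CC K B ->
  (forall X Y Z, g (J X) (B Y Z) + g (J Y) (B Z X) + g (J Z) (B X Y) = 0) ->
  forall X Y Z, bianchi K (part20 K B) X Y Z = bianchi K (part11 K B) X Y Z.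
Proof.
move=> hB cyc X Y Z; pose c X Y Z q := congr1 (fun f : C => f q) (cyc X Y Z).
apply: CinfP => q.
have := c (J X) Y Z q; have := c X (J Y) Z q; have := c X Y (J Z) q.
have := c (J X) (J Y) (J Z) q.
rewrite !(cc_lowJJ hB) /bianchi /part20 /part_mixed /part11 /Mop !JD !gE !J_skewr.
rewrite (cc_skew hB (J Z) X) (cc_skew hB Z (J X)) (cc_skew hB (J Z) (J X)).
rewrite (cc_skew hB Z X) !gE !CinfE.
lra.
Qed.

Lemma Sop_bianchi11 B : Omega11 K B ->
  forall X Y Z, Sop K (bianchi K B) X Y Z = bianchi K B X Y Z.
Proof.
move=> [hB iB] X Y Z; rewrite /Mop in iB; have J2 := Omega11_J2 (conj hB iB).
apply: CinfP => q; rewrite /Sop /bianchi !iB !J2.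
by rewrite !gE !CinfE; field.
Qed.

Definition twice (w : VF -> VF -> VF -> C) := comb3 (cstf M 2) 0 w w.

Lemma twiceE w X Y Z : twice w X Y Z = cstf M 2 * w X Y Z.
Proof. by rewrite /twice /comb3 mul0r addr0. Qed.

(** Subtract from the Bianchi sum at (V, X, Y) the one at (V, JX, JY). As B is complex bilinear, the
    terms pairing with X and Y cancel and the remaining one doubles. *)
Lemma Omega20_w20 B w : Omega20 K B -> Omega3_C K w ->
  (forall X Y Z, w X Y Z = cstf M 2 * bianchi K B X Y Z) ->
  forall X Y, B X Y = w20 K w X Y.
Proof.
move=> hB hw wE X Y; have [cB rB] := iffLR (Omega20P K B) hB.
have rB2 := Omega20_J2 hB.
apply: (@vfield_ptP _ _ _ K) => V q.
rewrite /w20 /Mop !gE !(vec2_lowl hw) !wE /bianchi !rB !rB2 !(cc_JJ cB) !metricJJ.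
by rewrite !(cc_P cB) !gE (Defs.metric_sym g (B X Y)) !CinfE; field.
Qed.

(** The Bianchi image of B is fixed by [Sop], so [w11] of twice that image has the same Bianchi
    image as B. *)
Lemma Omega11_split B : Omega11 K B ->
  Omega11_s K (fun X Y => 1 *: B X Y + (- 1) *: w11 K (twice (bianchi K B)) X Y).
Proof.
move=> hB; have [cB iB] := hB; set w := twice _.
have hw : Omega3_C K w by apply: Omega3_comb; exact: bianchi_form3.
have Sw X Y Z : Sop K w X Y Z = w X Y Z.
  by rewrite -[RHS]/(w X Y Z) /w !twiceE -(Sop_bianchi11 hB) /Sop /w !twiceE; ring.
have [c11 i11] := w11_11 hw; split; first split.
- exact: cc_comb.
- move=> X Y; have := iB X Y; have := i11 X Y; rewrite /Mop => E1 E2.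
  by rewrite E1 E2.
- move=> X Y Z; apply: CinfP => q.
  have := congr1 (fun f : C => f q) (bianchi_w11 hw Sw X Y Z).
  by rewrite /w twiceE /bianchi !gE !CinfE; lra.
Qed.

End BianchiParts.

(** * The torsion of an adapted connection *)

Section AdaptedTorsion.
Variables (R : realType) (m : nat) (M : manifold R m.*2.+1).
Variable K : metric_contact M.
Local Notation VF := (vfield M).
Local Notation C := (Cinf M).
Local Notation g := (cg K).
Local Notation eta := (ceta K).
Local Notation J := (cJ K).
Local Notation xi := (Reeb K).
Local Notation P := (hproj K).
Local Notation form2 := (VF -> VF -> VF).
Local Notation form3 := (VF -> VF -> VF -> C).
Local Notation v2 := (vec2 K).
Local Notation T20 := (part20 K).
Local Notation T11 := (part11 K).
Implicit Types (X Y Z V W : VF) (f : C).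

Lemma jacobi X Y Z :
  [| [| X, Y |], Z |] - [| [| X, Z |], Y |] + [| [| Y, Z |], X |] = 0.
Proof.
apply: vfieldP => f; rewrite !vfieldDE vfieldNE vfield0E /= !vfield_apB.
by ring.
Qed.

(** Apply eta to the Jacobi identity: the remaining derivatives of eta cancel in pairs. *)
Lemma extd_closed X Y Z :
  X (extd eta Y Z) - Y (extd eta X Z) + Z (extd eta X Y)
  - extd eta [| X, Y |] Z + extd eta [| X, Z |] Y - extd eta [| Y, Z |] X = 0.
Proof.
have := congr1 eta (jacobi X Y Z); rewrite !etaE /extd !vfield_apB => H.
rewrite /= -[RHS]H /=; ring.
Qed.

Variables (nabla : VF -> VF -> VF) (hA : adapted K nabla).
Local Notation T := (torsion nabla).

Lemma adapted_twoform : twoform T.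
Proof. by case: hA => hc _ _ _ _; exact: (twoform_torsion K). Qed.

Lemma bracketE X Y : [| X, Y |] = nabla X Y - nabla Y X - T X Y.
Proof.
by apply: (@metric_inj _ _ _ g) => V; rewrite /torsion !gE; ring.
Qed.

Lemma eta_torsion X Y : eta (T X Y) = extd eta X Y.
Proof. by case: hA => _ _ _ nE _; rewrite /torsion !etaE -!nE. Qed.

Lemma torsion_cyclic X Y Z :
  g (J (T X Y)) Z + g (J (T Y Z)) X + g (J (T Z X)) Y = 0.
Proof.
have [_ ng nJ _ _] := hA; have tw := adapted_twoform.
have bE := bracketE; move: (T) tw bE => t tw bE.
have := extd_closed X Y Z; rewrite !extdE !ng !nJ !bE !JPE !gE.
rewrite (tw.2 Z X) JN metricNl => H.
have sJ U V : g (J U) V = - g U (J V) by exact: J_skew.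
rewrite -[RHS]H !sJ !(Defs.metric_sym g (nabla _ _)) !sJ.
by ring.
Qed.

Lemma LieJ_torsion X : LieJ K X = J (T xi X) - T xi (J X).
Proof.
have [[nl _ _] _ nJ _ nxi] := hA.
have bE := bracketE; move: (T) bE => t bE.
by rewrite /LieJ !bE nJ !nxi !subr0 !JPE; apply: (@metric_inj _ _ _ g) => V;
  rewrite !gE; ring.
Qed.

Lemma nijenhuis_torsion X Y : nijenhuis K X Y =
  cstf M (1 / 4) *: (- T (J X) (J Y) - J (J (T X Y)) + J (T (J X) Y + T X (J Y))).
Proof.
have [_ _ nJ _ _] := hA.
have bE := bracketE; move: (T) bE => t bE.
rewrite /nijenhuis !bE !nJ !JPE; congr (_ *: _).
by apply: (@metric_inj _ _ _ g) => V; rewrite !gE; ring.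
Qed.

Definition T1 X := T xi X.

Lemma T1_endC : endC K T1.
Proof.
have tw := adapted_twoform; split=> [f X Y| |X]; rewrite /T1 /horizontal.
- by rewrite (twoformDr tw) (twoformZr tw).
- exact: (twoform_diag tw).
- by rewrite eta_torsion extdE J_Reeb metric0l.
Qed.

Lemma JT1_sym X Y : g (J (T1 X)) Y = g (J (T1 Y)) X.
Proof.
have := torsion_cyclic xi X Y; rewrite (adapted_twoform.2 Y xi) JN metricNl.
rewrite (J_skew K (T X Y)) J_Reeb metric0r oppr0 addr0 => /eqP.
by rewrite subr_eq0 => /eqP.
Qed.

Definition T1p := Jplus K T1.
Definition T1m := Jminus K T1.

Lemma T1p_LieJ X : T1p X = - (cstf M (1 / 2) *: J (LieJ K X)).
Proof.
have [_ _ h] := T1_endC; move: (h X); rewrite LieJ_torsion -/(T1 _) -/(T1 (J X)).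
rewrite /T1p /Jplus => hX; move: (T1 X) (T1 (J X)) hX => U V hX.
by rewrite !JPE JJ (hproj_id hX) -scalerN opprB opprK addrC.
Qed.

Definition Tcc X Y := P (T (P X) (P Y)).

Lemma Tcc_CC : Omega2_CC K Tcc.
Proof.
have := adapted_twoform; rewrite /Tcc; move: (T) => t tw.
split=> [Y f X X'|X Y|Y|X Y].
- by rewrite PD PZ (twoformDl tw) (twoformZl tw) PD PZ.
- by rewrite tw.2 PN.
- by rewrite hproj_Reeb (twoform0l tw) P0.
- by rewrite /horizontal eta_hproj.
Qed.

Lemma torsion_split X Y :
  T X Y = Tcc X Y + extd eta X Y *: xi + eta_wedge K T1 X Y.
Proof.
have tw := adapted_twoform; have [l x _] := T1_endC.
have T1P Z : T1 (P Z) = T1 Z.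
  by rewrite /hproj addrC -scaleNr l x scaler0 add0r.
have e : T X Y = T (P X) (P Y) + eta X *: T1 (P Y) - eta Y *: T1 (P X).
  rewrite /T1; move: (T) tw => t tw.
  have aux X' Y' a b : t (X' + a *: xi) (Y' + b *: xi) =
      t X' Y' + a *: t xi Y' - b *: t xi X'.
    rewrite (twoformDl tw) !(twoformDr tw) !(twoformZl tw) !(twoformZr tw).
    by rewrite (twoform_diag tw) (tw.2 X' xi) !scaler0 addr0 scalerN addrAC.
  by rewrite {1}(hproj_split K X) {1}(hproj_split K Y) aux.
have e' : T (P X) (P Y) = Tcc X Y + extd eta X Y *: xi.
  rewrite {1}(hproj_split K (T (P X) (P Y))) eta_torsion.
  by rewrite !extdE J_hproj -metric_hproj hproj_J.
by rewrite e e' !T1P /eta_wedge addrA.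
Qed.

Lemma Tcc_cyclic X Y Z :
  g (J X) (Tcc Y Z) + g (J Y) (Tcc Z X) + g (J Z) (Tcc X Y) = 0.
Proof.
have E U V W : g (J U) (Tcc V W) = - g (J (T (P V) (P W))) (P U).
  by rewrite /Tcc -metric_hproj hproj_J -{1}(J_hproj K U) J_skew Defs.metric_sym.
have := torsion_cyclic (P X) (P Y) (P Z).
rewrite !E => H; apply: oppr_inj; rewrite oppr0 -[RHS]H; move: (T) => t; ring.
Qed.

Lemma Tcc_bianchi X Y Z :
  bianchi K (T20 Tcc) X Y Z = bianchi K (T11 Tcc) X Y Z.
Proof. exact: bianchi_part20_part11 Tcc_CC Tcc_cyclic X Y Z. Qed.

(** The (2,0) and (1,1) parts have equal Bianchi images by [Tcc_bianchi], so twice one of them is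
    the plus part of the whole, as [plus_part_adapted] confirms. *)
Definition Tw : form3 := twice (bianchi K (T11 Tcc)).

Lemma Tw_form3 : Omega3_C K Tw.
Proof.
by have [h _] := part11_Omega Tcc_CC; apply: Omega3_comb; exact: bianchi_form3.
Qed.

Lemma Tw_S X Y Z : Sop K Tw X Y Z = Tw X Y Z.
Proof.
rewrite /Tw twiceE -(Sop_bianchi11 (part11_Omega Tcc_CC)) /Sop !twiceE; ring.
Qed.

Definition Ts X Y : VF := 1 *: T11 Tcc X Y + (- 1) *: w11 K Tw X Y.

Lemma Ts_11s : Omega11_s K Ts.
Proof. exact: Omega11_split (part11_Omega Tcc_CC). Qed.

Lemma T20_w20 X Y : T20 Tcc X Y = w20 K Tw X Y.
Proof.
apply: Omega20_w20; [exact: part20_Omega Tcc_CC|exact: Tw_form3| ].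
by move=> U V W; rewrite /Tw twiceE Tcc_bianchi.
Qed.

Lemma torsion_formE X Y :
  T X Y = torsion_form K (part02 K Tcc) Tw Ts T1p T1m X Y.
Proof.
rewrite torsion_split (part_sum K Tcc) T20_w20 /torsion_form /Ts /T1p /T1m.
rewrite /eta_wedge /w20 /w11 /Jplus /Jminus.
move: (v2 Tw) (part02 K Tcc) (T11 Tcc) T1 => v n b F.
by apply: (@vfield_ptP _ _ _ K) => V q; rewrite !gE !CinfE; field.
Qed.

Lemma T1p_endC : endC K T1p. Proof. exact: Jplus_endC T1_endC. Qed.
Lemma T1p_sym : symmetric_end K T1p. Proof. exact: Jplus_sym T1_endC JT1_sym. Qed.
Lemma T1m_EndJ : EndJ_minus K T1m. Proof. exact: Jminus_EndJ T1_endC JT1_sym. Qed.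

Lemma is_parts_adapted :
  is_parts K T (torsion_parts K (part02 K Tcc) Tw Ts T1p T1m).
Proof.
exact: (is_parts_torsion (part02_Omega Tcc_CC) Tw_form3 Tw_S Ts_11s T1p_endC
  T1p_sym T1m_EndJ torsion_formE).
Qed.

Lemma plus_part_adapted X Y Z : plus_part K (bianchi K T) X Y Z = Tw X Y Z.
Proof.
exact: (plus_part_torsion (part02_Omega Tcc_CC) Tw_form3 Tw_S Ts_11s torsion_formE).
Qed.

(** Read off from [nijenhuis_torsion]: the J-twisted average there kills types (2,0) and (1,1) and
    is the identity on (0,2). The other two nonzero entries come from the xi-component of T(JX, JY)
    and from an argument xi. *)
Definition nijenhuis_parts : parts M :=
  Parts (fun _ _ => 0) (fun _ _ => 0) (fun _ _ => 0) (fun _ _ => 0) (part02 K Tcc)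
    (fun X Y => cstf M (- (1 / 4)) * extd eta X Y) (fun _ _ => 0)
    (fun X => cstf M (1 / 2) *: T1p X) (fun=> 0) (fun=> 0).

Lemma Omega2_CC0 : Omega2_CC K (fun _ _ => 0).
Proof.
by split=> [Y f X X'|X Y|//|X Y]; rewrite ?oppr0 /horizontal ?eta0 // scaler0 addr0.
Qed.

Lemma is_parts_nijenhuis : is_parts K (nijenhuis K) nijenhuis_parts.
Proof.
have h2 := part02_Omega Tcc_CC; have z := Omega2_CC0.
have z11 : Omega11 K (fun _ _ => 0) by split.
split.
- by split=> //; split=> // X Y _ _; rewrite J0.
- split=> /=; [split=> // X Y Z|split=> // B _ p e _|by move=> Y Z; rewrite addr0].
    by rewrite /bianchi !gE !addr0 mulr0.
  by rewrite big1 // => i _; rewrite big1 // => j _; rewrite metric0l.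
- have [e1 e2 e3] := Omega2_extd K; split=> /=.
  + split=> [Y f X X'|X Y|Y]; [rewrite e1; ring|by rewrite e2 mulrN| ].
    by rewrite e3 mulr0.
  + by move=> X Y; rewrite /Mop extd_JJ.
  + by split=> [Y f X X'|X Y|//]; rewrite ?oppr0 // mulr0 addr0.
  + by move=> X Y; rewrite /Mop oppr0.
- have [l x h] := T1p_endC; split=> /=.
  + split=> [f X Y| |X]; [ |by rewrite x scaler0|by rewrite /horizontal etaZ h mulr0].
    by rewrite /= l scalerDr !scalerA [_ * f]mulrC.
  + by move=> X Y; rewrite metricZl metricZr T1p_sym.
  + by split=> [f X Y| |X]; rewrite ?scaler0 ?addr0 // /horizontal eta0.
  + by move=> X Y; rewrite !gE oppr0.
  + by split=> // f X Y; rewrite mulr0 addr0.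
- move=> X Y; rewrite /= nijenhuis_torsion !torsion_split extd_JJ.
  have ct := Tcc_CC; have [l x h] := T1_endC.
  rewrite /T1p /Jplus /part02 /part_mixed /eta_wedge /Mop !eta_J.
  have JJT U : J (J (T1 U)) = - T1 U by rewrite JJ (hproj_id (h U)).
  move: Tcc T1 ct h JJT => t F ct h JJT.
  move: (extd eta X Y) (extd eta (J X) Y) (extd eta X (J Y)) => a b c.
  have tJJ := cc_JJ ct; move: (xi) (J_Reeb K) => k Jk.
  move: (eta X) (eta Y) => x0 y0; clear ct h l x.
  move: (J : VF -> VF) (JD K) (JN K) (JZ K) (J0 K) t JJT tJJ Jk => j jD jN jZ j0.
  move=> t jjF jjt jk; rewrite !(jD, jN, jZ) !jjF !jjt jk j0.
  by apply: (@vfield_ptP _ _ _ K) => V q; rewrite !gE !CinfE; field.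
Qed.

End AdaptedTorsion.

(** * Existence of adapted connections *)

Section MetricConnection.
Variables (R : realType) (n : nat) (M : manifold R n) (g : metric M).
Local Notation VF := (vfield M).
Local Notation C := (Cinf M).
Implicit Types (X Y Z V W : VF) (f : C).

Definition koszul X Y Z : C :=
  cstf M (1 / 2) * (X (g Y Z) + Y (g X Z) - Z (g X Y)
    + g [| X, Y |] Z - g [| X, Z |] Y - g [| Y, Z |] X).

Lemma bracketZr X Y f : [| X, f *: Y |] = X f *: Y + f *: [| X, Y |].
Proof. by apply: vfieldP => h; rewrite /= vfield_apM; ring. Qed.

Lemma bracketDr X Y Z : [| X, Y + Z |] = [| X, Y |] + [| X, Z |].
Proof. by apply: vfieldP => h; rewrite /= vfield_apD; ring. Qed.

Lemma bracketZl X Y f : [| f *: X, Y |] = f *: [| X, Y |] - Y f *: X.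
Proof. by apply: vfieldP => h; rewrite /= vfield_apM; ring. Qed.

Lemma bracketDl X Y Z : [| X + Y, Z |] = [| X, Z |] + [| Y, Z |].
Proof. by apply: vfieldP => h; rewrite /= vfield_apD; ring. Qed.

Definition metric_gE := (@metricDl R _ M g, @metricDr R _ M g, @metricNl R _ M g,
  @metricNr R _ M g, @metricZl R _ M g, @metricZr R _ M g).

Lemma koszul_scalar X Y : scalar (koszul X Y).
Proof.
move=> f Z Z' /=; rewrite /koszul !bracketDr !bracketZr !metric_gE !vfield_apD.
rewrite !vfield_apM !vfieldDE !vfieldZE.
by rewrite (Defs.metric_sym g Z X) (Defs.metric_sym g Z Y); ring.
Qed.

(** The Levi-Civita connection of [g]. *)
Definition metric_nabla X Y : VF := sharp g (koszul X Y).

Lemma metric_nablaE X Y Z : g (metric_nabla X Y) Z = koszul X Y Z.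
Proof. exact/sharp_scalar/koszul_scalar. Qed.

(** Constants are smooth functions here, opaque to [ring]; this supplies 1/2 + 1/2 = 1. *)
Lemma half_half (x : C) : cstf M (1 / 2) * x + cstf M (1 / 2) * x = x.
Proof. by apply: CinfP => q; rewrite !CinfE; field. Qed.

Lemma metric_nabla_connection : connection metric_nabla.
Proof.
split=> [Y f X X'|X Y Y'|X f Y]; apply: (@metric_inj _ _ _ g) => Z;
  rewrite !metric_gE !metric_nablaE /koszul.
- rewrite !bracketDl !bracketZl !metric_gE !vfield_apD !vfield_apM !vfieldDE !vfieldZE.
  by rewrite (Defs.metric_sym g X Y) (Defs.metric_sym g X Z); ring.
- rewrite !bracketDl !bracketDr !metric_gE !vfield_apD !vfieldDE; ring.
- rewrite !bracketZl !bracketZr !metric_gE !vfield_apM !vfieldZE.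
  rewrite -[X in _ = X + _](half_half).
  by rewrite (Defs.metric_sym g Y X) (Defs.metric_sym g Y Z); ring.
Qed.

Lemma metric_nabla_metric X Y Z :
  X (g Y Z) = g (metric_nabla X Y) Z + g Y (metric_nabla X Z).
Proof.
rewrite (Defs.metric_sym g Y (metric_nabla X Z)) !metric_nablaE /koszul -[LHS]half_half.
rewrite (Defs.metric_sym g Z Y) (bracket_skew Y Z) !metric_gE; ring.
Qed.

End MetricConnection.

Section AdaptedConnection.
Variables (R : realType) (m : nat) (M : manifold R m.*2.+1).
Variable K : metric_contact M.
Local Notation VF := (vfield M).
Local Notation C := (Cinf M).
Local Notation g := (cg K).
Local Notation eta := (ceta K).
Local Notation J := (cJ K).
Local Notation xi := (Reeb K).
Local Notation P := (hproj K).
Implicit Types (X Y Z V W : VF) (f : C).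

Lemma adapted_exists : exists nabla, adapted K nabla.
Proof.
pose n := metric_nabla g.
have [nl nD nZ] := metric_nabla_connection g; have ng := metric_nabla_metric g.
rewrite -/n in nl nD nZ ng; clearbody n.
have n0 X : n X 0 = 0.
  by have := nD X 0 0; rewrite addr0 => /eqP; rewrite -subr_eq subrr => /eqP.
have nN X Y : n X (- Y) = - n X Y.
  by apply/eqP; rewrite -addr_eq0 -nD addNr n0.
pose h := cstf M (1 / 2).
have hh (x : C) : h * x + h * x = x by exact: half_half.
have hhV (x : VF) : h *: x + h *: x = x.
  by apply: vfieldP => f; rewrite vfieldDE vfieldZE hh.
(* On ker eta the inverse of J is -J, so the bracket adds a connection and its conjugate by J. The
   last term makes xi parallel. *)
pose nb X Y := h *: (P (n X (P Y)) - J (n X (J Y))) + X (eta Y) *: xi.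
have nbE X Y : nb X Y = h *: (P (n X (P Y)) - J (n X (J Y))) + X (eta Y) *: xi by [].
have eta_nb X Y : X (eta Y) = eta (nb X Y).
  rewrite nbE etaD !etaZ etaD etaN eta_hproj eta_J subr0 mulr0 add0r eta_Reeb.
  by rewrite mulr1.
exists nb; split=> //.
- split=> [Y f X X'|X Y Y'|X f Y]; rewrite !nbE.
  + rewrite !nl PD PZ JD JZ vfieldDE vfieldZE.
    move: (P (n X _)) (P (n X' _)) (J (n X _)) (J (n X' _)) (xi) => a b c d k.
    by apply: (@metric_inj _ _ _ g) => V; rewrite !gE; ring.
  + rewrite PD JD etaD !nD vfield_apD PD JD.
    move: (P (n X (P Y))) (P (n X (P Y'))) (J (n X (J Y))) (J (n X (J Y'))) (xi).
    move=> a b c d k.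
    by apply: (@metric_inj _ _ _ g) => V; rewrite !gE; ring.
  + rewrite PZ JZ etaZ !nZ vfield_apM PD PZ JD JZ PZ JZ hproj_hproj JJ.
    (* Each half of the average contributes the same derivative term X(f) P Y, since -J J Y = P
       Y. *)
    have -> : X f *: Y = h *: (X f *: P Y) + h *: (X f *: P Y) + X f *: (eta Y *: xi).
      by rewrite hhV -scalerDr -hproj_split.
    move: (P (n X (P Y))) (J (n X (J Y))) (P Y) (xi) => a b c k.
    by apply: (@metric_inj _ _ _ g) => V; rewrite !gE; ring.
- have PP U V : g (P U) (P V) = g U V - eta U * eta V.
    rewrite metric_hproj hproj_hproj -metric_hproj /hproj metricDl metricNl metricZl.
    by rewrite Reeb_dual.
  have JJ' U V : g (J U) (J V) = g (P U) (P V).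
    by rewrite metricJJ [RHS]metric_hproj hproj_hproj.
  have lowP U V : g (P U) V = g U (P V) by exact: metric_hproj.
  have lowJ U V : g (J U) V = - g U (J V) by exact: J_skew.
  have low a c e V : g (h *: (P a - J c) + e *: xi) V =
      h * (g a (P V) + g c (J V)) + e * eta V.
    rewrite metricDl metricZl metricDl metricNl metricZl Reeb_dual lowP lowJ.
    by rewrite opprK.
  move=> X Y Z.
  (* Splitting g(Y, Z) in this way matches the two halves of [nb], so metric compatibility of [n]
     can be applied to each. *)
  have gYZ : g Y Z = h * g (P Y) (P Z) + h * g (J Y) (J Z) + eta Y * eta Z.
    by rewrite JJ' hh PP subrK.
  have Xh (x : C) : X (h * x) = h * X x by exact: vfield_apZ.
  rewrite gYZ !vfield_apD !Xh !ng vfield_apM !nbE low.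
  rewrite (Defs.metric_sym g Y (_ + _)) low.
  rewrite (Defs.metric_sym g (P Y)) (Defs.metric_sym g (J Y)).
  by ring.
- move=> X Y; rewrite !nbE eta_J hproj_J JJ JD JZ JZ J_Reeb scaler0 addr0 JD JN.
  have -> : X 0 = 0 by exact: vfield_ap0.
  rewrite scale0r addr0 nN JN opprK J_hproj JJ opprK addrC.
  by [].
- move=> X; rewrite nbE hproj_Reeb J_Reeb n0 P0 J0 subrr scaler0 add0r eta_Reeb.
  by rewrite vfield_ap1 scale0r.
Qed.

End AdaptedConnection.

(** * Changing the torsion of an adapted connection *)

Section Modification.
Variables (R : realType) (m : nat) (M : manifold R m.*2.+1).
Variable K : metric_contact M.
Local Notation VF := (vfield M).
Local Notation C := (Cinf M).
Local Notation g := (cg K).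
Local Notation eta := (ceta K).
Local Notation J := (cJ K).
Local Notation xi := (Reeb K).
Local Notation P := (hproj K).
Implicit Types (X Y Z V W : VF) (f : C).

Variables (nabla : VF -> VF -> VF) (w : VF -> VF -> VF -> C)
  (B : VF -> VF -> VF) (Phi : VF -> VF).
Hypotheses (hA : adapted K nabla) (hw : Omega3_C K w)
  (Sw : forall X Y Z, Sop K w X Y Z = w X Y Z)
  (hB : Omega11_s K B) (hPhi : EndJ_minus K Phi).

(* As [bianchi B = 0], skew-symmetrizing [- g X (B Y Z)] in [X] and [Y] gives
   [g Z (B X Y)]. The factor [3 / 8] is the one for which the same operation turns
   the second term into the [w]-part of the torsion. *)
Definition contorsion X Y Z : C :=
  - g X (B Y Z) + cstf M (3 / 8) * (w X Y Z + w X (J Y) (J Z)) + eta X * g (Phi Y) Z.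

Let cB : Omega2_CC K B := hB.1.1.

Lemma contorsion_scalar X Y : scalar (contorsion X Y).
Proof.
move=> f Z Z' /=; rewrite /contorsion (cc_D2 cB) (cc_Z2 cB) JD JZ.
by rewrite !(form3E hw) !gE; ring.
Qed.

Definition conn_diff X Y : VF := sharp g (contorsion X Y).

Lemma conn_diffE X Y Z : g (conn_diff X Y) Z = contorsion X Y Z.
Proof. exact/sharp_scalar/contorsion_scalar. Qed.

Lemma conn_diff_linl Y : linear (conn_diff^~ Y).
Proof.
move=> f X X'; apply: (@metric_inj _ _ _ g) => Z.
rewrite !(metricDl, metricZl) !conn_diffE /contorsion etaD etaZ.
by rewrite !(form3_D1 hw) !(form3_Z1 hw) !gE; ring.
Qed.

Lemma conn_diff_linr X : linear (conn_diff X).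
Proof.
have [[l _ _] _ _] := hPhi.
move=> f Y Y'; apply: (@metric_inj _ _ _ g) => Z.
rewrite !(metricDl, metricZl) !conn_diffE /contorsion l.
rewrite (cc_D1 cB) (cc_Z1 cB) JD JZ.
by rewrite !(form3E hw) !gE; ring.
Qed.

Lemma conn_diffD X Y Y' : conn_diff X (Y + Y') = conn_diff X Y + conn_diff X Y'.
Proof. by have := conn_diff_linr X 1 Y Y'; rewrite !scale1r. Qed.

Lemma conn_diffZ X f Y : conn_diff X (f *: Y) = f *: conn_diff X Y.
Proof.
have z : conn_diff X 0 = 0.
  by have := conn_diffD X 0 0; rewrite addr0 => /eqP; rewrite -subr_eq subrr => /eqP.
by have := conn_diff_linr X f Y 0; rewrite z !addr0.
Qed.

Lemma contorsion_skew X Y Z : contorsion X Y Z = - contorsion X Z Y.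
Proof.
have [_ s _] := hPhi; rewrite /contorsion (cc_skew cB Y) (form3_23 hw X Y).
rewrite (form3_23 hw X (J Y)) s (Defs.metric_sym g Y) !gE.
by ring.
Qed.

(** The terms in w form a J-invariant expression in the last two slots, B has type (1,1) and Phi
    commutes with J; with [contorsion_skew], the difference tensor is skew and complex linear. *)
Lemma contorsion_J X Y Z : contorsion X (J Y) Z = - contorsion X Y (J Z).
Proof.
have [_ _ c] := hPhi; rewrite /contorsion (Omega11_J2 hB.1) c J_skew !(form3J hw).
by rewrite !gE; ring.
Qed.

Lemma contorsion_xi X Y : contorsion X xi Y = 0.
Proof.
have [[_ x _] _ _] := hPhi.
rewrite /contorsion (cc_xi1 cB) J_Reeb x !metric0l metric0r.
by rewrite (form3_xi2 hw) (form3_12 hw) (form3_01 hw) oppr0 !addr0 !mulr0 !addr0.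
Qed.

Lemma conn_diff_J X Y : conn_diff X (J Y) = J (conn_diff X Y).
Proof.
by apply: (@metric_inj _ _ _ g) => Z; rewrite J_skew !conn_diffE contorsion_J.
Qed.

Lemma eta_conn_diff X Y : eta (conn_diff X Y) = 0.
Proof. by rewrite -metric_eta conn_diffE contorsion_skew contorsion_xi oppr0. Qed.

Lemma conn_diff_xi X : conn_diff X xi = 0.
Proof.
by apply: (@metric_inj _ _ _ g) => Z; rewrite conn_diffE contorsion_xi metric0l.
Qed.

Definition modified X Y : VF := nabla X Y + conn_diff X Y.

Lemma modified_adapted : adapted K modified.
Proof.
have [[nl nD nZ] ng nJ ne nx] := hA; split; first split.
- move=> Y f X X'; rewrite /modified nl conn_diff_linl scalerDr.
  by rewrite addrACA.
- by move=> X Y Y'; rewrite /modified nD conn_diffD addrACA.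
- by move=> X f Y; rewrite /modified nZ conn_diffZ scalerDr addrA.
- move=> X Y Z; rewrite /modified metricDl metricDr ng conn_diffE.
  by rewrite (Defs.metric_sym g Y (conn_diff _ _)) conn_diffE contorsion_skew; ring.
- by move=> X Y; rewrite /modified JD nJ conn_diff_J.
- by move=> X Y; rewrite /modified etaD -ne eta_conn_diff addr0.
- by move=> X; rewrite /modified nx conn_diff_xi addr0.
Qed.

Lemma torsion_modified X Y : torsion modified X Y = torsion nabla X Y
  + (cstf M (9 / 8) *: vec2 K w X Y - cstf M (3 / 8) *: Mop K (vec2 K w) X Y
     + B X Y + eta_wedge K Phi X Y).
Proof.
have -> : torsion modified X Y = torsion nabla X Y + (conn_diff X Y - conn_diff Y X).
  rewrite /torsion /modified; move: (nabla X Y) (nabla Y X) => a b.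
  move: (conn_diff X Y) (conn_diff Y X) => c d.
  by apply: (@metric_inj _ _ _ g) => V; rewrite !gE; ring.
congr (_ + _); apply: (@vfield_ptP _ _ _ K) => V q.
rewrite metricDl metricNl !conn_diffE /contorsion /eta_wedge /Mop.
rewrite !(metricDl, metricNl, metricZl) !(vec2_lowl hw).
(* By S w = w, the terms w(X, JY, JV) + w(JX, Y, JV) equal w(X, Y, V) - w(JX, JY, V). Together with
   2 w(X, Y, V) and the factor 3/8 this gives 9/8 and -3/8. *)
have bB := hB.2 X Y V; have sw := Sw X Y V.
move: bB sw; rewrite /bianchi /Sop => bB sw.
rewrite (form3_rot hw V X Y) (form3_rot hw V (J X) (J Y)).
rewrite (form3_12 hw Y X V) (form3_12 hw Y (J X) (J V)).
rewrite (Defs.metric_sym g (B X Y)).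
have := congr1 (fun f : C => f q) bB; have := congr1 (fun f : C => f q) sw.
rewrite (cc_skew cB V X) metricNr !CinfE.
lra.
Qed.

End Modification.

Section EndJ.
Variables (R : realType) (m : nat) (M : manifold R m.*2.+1).
Variable K : metric_contact M.

Lemma EndJ_minusB F G : EndJ_minus K F -> EndJ_minus K G ->
  EndJ_minus K (fun X => F X - G X).
Proof.
move=> [[l x h] s c] [[l' x' h'] s' c']; split; first split.
- move=> f X Y; rewrite l l'.
  by apply: (@metric_inj _ _ _ (cg K)) => V; rewrite !gE; ring.
- by rewrite x x' subr0.
- by move=> X; rewrite /horizontal etaD etaN h h' subr0.
- by move=> X Y; rewrite !gE s s'; ring.
- by move=> X; rewrite c c' JD JN.
Qed.

End EndJ.

Unset Implicit Arguments.
Theorem theorem4p2 (R : realType) (m : nat) (M : manifold R m.*2.+1)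
    (K : metric_contact M) :
  (forall nabla : vfield M -> vfield M -> vfield M, adapted K nabla ->
    let T := parts_of K (torsion nabla) in
    let N := parts_of K (nijenhuis K) in
    [/\ forall X Y, p02 T X Y = p02 N X Y,
        (forall X Y, p20 T X Y - phi_inv K (p11a T) X Y = 0) /\
        (forall X Y Z,
           bianchi K (fun U V => p20 T U V - p11a T U V) X Y Z = 0),
        (forall X Y, p2plus T X Y = extd (ceta K) X Y) /\
        (forall X Y, p2minus T X Y = 0),
        (forall X, p1plus T X = - (cstf M (1 / 2) *: cJ K (LieJ K X))) /\
        EndJ_minus K (p1minus T)
      & forall X, p1R T X = 0]) /\
  (forall (omega : vfield M -> vfield M -> vfield M -> Cinf M)
      (B : vfield M -> vfield M -> vfield M) (Phi : vfield M -> vfield M),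
    Omega_plus K omega -> Omega11_s K B -> EndJ_minus K Phi ->
    let prescribed nabla :=
      [/\ forall X Y Z, plus_part K (bianchi K (torsion nabla)) X Y Z = omega X Y Z,
          forall X Y, p11s (parts_of K (torsion nabla)) X Y = B X Y
        & forall X, p1minus (parts_of K (torsion nabla)) X = Phi X] in
    (exists nabla, adapted K nabla /\ prescribed nabla) /\
    (forall nabla, adapted K nabla -> prescribed nabla -> forall Y Z,
       torsion nabla Y Z =
         p02 (parts_of K (nijenhuis K)) Y Z
         + cstf M (9 / 8) *: vec2 K omega Y Z
         - cstf M (3 / 8) *: Mop K (vec2 K omega) Y Z
         + B Y Z
         + extd (ceta K) Y Z *: Reeb K
         - cstf M (1 / 2) *: eta_wedge K (fun X => cJ K (LieJ K X)) Y Z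
         + eta_wedge K Phi Y Z)).
Proof.
have funext2 (S T U : Type) (a b : S -> T -> U) : (forall X Y, a X Y = b X Y) -> a = b.
  by move=> ab; apply/funext => X; apply/funext => Y.
have funext3 (S T U W : Type) (a b : S -> T -> U -> W) :
    (forall X Y Z, a X Y Z = b X Y Z) -> a = b.
  by move=> ab; apply/funext => X; apply/funext2.
split.
- move=> nabla hA; have hw := Tw_form3 hA; have Sw := Tw_S hA.
  rewrite (parts_ofE (is_parts_adapted hA)) (parts_ofE (is_parts_nijenhuis hA)).
  split=> /=.
  (* Both records store the same tensor [part02 K (Tcc K nabla)]. *)
  + by [].
  + split=> [X Y|X Y Z]; first by rewrite phi_inv_w11 // subrr.
    by rewrite bianchiB (bianchi_w20 hw Sw) (bianchi_w11 hw Sw) subrr.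
  + by [].
  + by split; [exact: T1p_LieJ|exact: T1m_EndJ].
  + by [].
- move=> omega B Phi /Omega_plusP [hw Sw] hB hPhi prescribed; split; last first.
    move=> nabla hA [pw pB pPhi] Y Z.
    (* The prescribed data are exactly the free parameters of the normal form. *)
    have Ew : Tw K nabla = omega.
      by apply/funext3 => X Y' Z'; rewrite -pw plus_part_adapted.
    have EB : Ts K nabla = B.
      by apply/funext2 => X Y'; rewrite -pB (parts_ofE (is_parts_adapted hA)).
    have EPhi : T1m K nabla = Phi.
      by apply/funext => X; rewrite -pPhi (parts_ofE (is_parts_adapted hA)).
    rewrite (torsion_formE hA) Ew EB EPhi /torsion_form.
    rewrite (parts_ofE (is_parts_nijenhuis hA)) /= /eta_wedge !(T1p_LieJ hA).
    move: (vec2 K omega) (Reeb K) => v k.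
    apply: (@vfield_ptP _ _ _ K) => V q.
    by rewrite !(gE, scalerN) !CinfE; ring.
  have [n0 h0] := adapted_exists K.
  (* The parameters of the torsion shift additively, so the modification is by the differences
     between the prescribed values and those of [n0]. *)
  pose w' := comb3 1 (- 1) omega (Tw K n0).
  pose B' X Y := 1 *: B X Y + (- 1) *: Ts K n0 X Y.
  pose Phi' X := Phi X - T1m K n0 X.
  have hw' : Omega3_C K w' by apply: Omega3_comb => //; exact: Tw_form3.
  have Sw' X Y Z : Sop K w' X Y Z = w' X Y Z.
    by rewrite /w' {2}/comb3 -Sw -(Tw_S h0) /Sop /comb3; ring.
  have hB' : Omega11_s K B' by apply: Omega11_sB => //; exact: Ts_11s.
  have hPhi' : EndJ_minus K Phi' by apply: EndJ_minusB => //; exact: T1m_EndJ.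
  pose n1 := modified K n0 w' B' Phi'.
  have h1 : adapted K n1 by exact: modified_adapted.
  have TE X Y : torsion n1 X Y =
      torsion_form K (part02 K (Tcc K n0)) omega B (T1p K n0) Phi X Y.
    rewrite torsion_modified // (torsion_formE h0) /torsion_form /B' /Phi' /eta_wedge.
    have vE U V : vec2 K w' U V = vec2 K omega U V - vec2 K (Tw K n0) U V.
      apply: (@vfield_ptP _ _ _ K) => W q.
      rewrite metricDl metricNl.
      rewrite (vec2_lowl hw') (vec2_lowl hw) (vec2_lowl (Tw_form3 h0)).
      by rewrite /w' /comb3 !CinfE; ring.
    rewrite /Mop !vE.
    move: (vec2 K omega) (vec2 K (Tw K n0)) (Reeb K) (part02 _ _ _ _) => v v0 k b.
    move: (T1m K n0) (T1p K n0) (Ts K n0) (extd _ _ _) => F F' b' e.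
    apply: (@vfield_ptP _ _ _ K) => W q; rewrite !gE !CinfE; ring.
  exists n1; split=> //.
  have hp := is_parts_torsion (part02_Omega (Tcc_CC h0)) hw Sw hB (T1p_endC h0)
    (T1p_sym h0) hPhi TE.
  split=> [X Y Z|X Y|X].
  + exact: (plus_part_torsion (part02_Omega (Tcc_CC h0)) hw Sw hB TE).
  + by rewrite (parts_ofE hp).
  + by rewrite (parts_ofE hp).
Qed.
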